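(* For $0<p<\infty$ let $C(1,p):=\sup\{|f'(0)|:\ \|f\|_{H^p(\mathbb{D})}=1\}$. Then $$C(1,p)=1\ \text{ if } p\ge1,\qquad C(1,p)=\sqrt{\frac2p}\Big(1-\frac p2\Big)^{\frac1p-\frac12}\ \text{ if } 0<p<1.$$ The corresponding extremals (that is, the functions $f$ with $\|f\|_{H^p(\mathbb{D})}=1$ and $|f'(0)|=C(1,p)$), modulo the trivial modifications $f(z)\mapsto e^{i\theta_1}f(e^{i\theta_2}z)$ with $\theta_1,\theta_2$ real, are (a) $f(z)=z$ for $p>1$; (b) the family $f_a(z)=\big(a+\sqrt{1-a^2}\,z\big)\big(\sqrt{1-a^2}+az\big)$ with $0\le a\le1$ for $p=1$; (c) $f(z)=\big(\sqrt{1-p/2}+z\sqrt{p/2}\big)^{2/p}$ for $0<p<1$.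
   Context: $\mathbb{D}$ is the open unit disc, $\mathbb{T}$ the unit circle with normalized Lebesgue measure $\mu$. $H^p(\mathbb{D})$ is the space of analytic $f:\mathbb{D}\to\mathbb{C}$ with $\|f\|_{H^p(\mathbb{D})}^p:=\sup_{0<r<1}\int_{\mathbb{T}}|f(rz)|^p\,d\mu(z)<\infty$. In (c) the power is the principal branch on $\mathbb{D}$ (the base has positive real part there). *)

(* Defs.v *)
From Stdlib Require Import Reals Lra.
From Coquelicot Require Import Coquelicot.
Open Scope R_scope.

(* Real power of a nonnegative base with the usual convention 0 ^ p = 0 for
   p > 0; Stdlib's [Rpower 0 p] is 1. *)
Definition rpow (x p : R) : R :=
  if Req_EM_T x 0 then 0 else Rpower x p.

Definition cis (t : R) : C := (cos t, sin t).

Definition unit_disc (z : C) : Prop := Cmod z < 1.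

(* Only the values of [f : C -> C] on the disc matter. *)
Definition analytic_on_disc (f : C -> C) : Prop :=
  forall z : C, unit_disc z -> @ex_derive C_AbsRing C_NormedModule f z.

(* Integral over the unit circle for normalized Lebesgue measure, in the
   parametrization t |-> e^{it}.  It is applied to continuous functions only,
   for which the Riemann and Lebesgue integrals agree. *)
Definition circle_mean (g : C -> R) : R :=
  / (2 * PI) * RInt (fun t : R => g (cis t)) 0 (2 * PI).

(* The p-th power of the H^p norm, possibly infinite. *)
Definition Hp_norm_pow (p : R) (f : C -> C) : Rbar :=
  Lub_Rbar (fun x : R => exists r : R, 0 < r < 1 /\
    x = circle_mean (fun z : C => rpow (Cmod (f (RtoC r * z)%C)) p)).

Definition in_Hp (p : R) (f : C -> C) : Prop :=
  analytic_on_disc f /\ Rbar_lt (Hp_norm_pow p f) p_infty.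

(* Meaningful for [in_Hp p f]: [real] sends infinite values to 0. *)
Definition Hp_norm (p : R) (f : C -> C) : R :=
  rpow (real (Hp_norm_pow p f)) (/ p).

(* [C_derive f] takes its limit along the real direction only; on analytic
   functions it is the complex derivative ([is_C_derive_unique]). *)
Definition const_C1 (p : R) : Rbar :=
  Lub_Rbar (fun x : R => exists f : C -> C,
    in_Hp p f /\ Hp_norm p f = 1 /\ x = Cmod (C_derive f (RtoC 0))).

Definition extremal (p : R) (f : C -> C) : Prop :=
  in_Hp p f /\ Hp_norm p f = 1 /\ Finite (Cmod (C_derive f (RtoC 0))) = const_C1 p.

Definition trivial_modification (g f : C -> C) : Prop :=
  exists theta1 theta2 : R, forall z : C, unit_disc z ->
    f z = (cis theta1 * g (cis theta2 * z))%C.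

(* Principal argument, by the half-angle formula; valid off the half-line
   (-oo, 0], see [Carg_polar] and [Carg_bound]. *)
Definition Carg (z : C) : R := 2 * atan (Im z / (Cmod z + Re z)).

(* Principal branch of z ^ s, s real, off (-oo, 0]. *)
Definition Cpow_principal (z : C) (s : R) : C :=
  (RtoC (Rpower (Cmod z) s) * cis (s * Carg z))%C.

Definition f_gt1 (z : C) : C := z.

Definition f_eq1 (a : R) (z : C) : C :=
  ((RtoC a + RtoC (sqrt (1 - a ^ 2)) * z) *
   (RtoC (sqrt (1 - a ^ 2)) + RtoC a * z))%C.

Definition f_lt1 (p : R) (z : C) : C :=
  Cpow_principal
    (RtoC (sqrt (1 - p / 2)) + z * RtoC (sqrt (p / 2)))%C (2 / p).

Lemma Carg_bound (z : C) : - PI < Carg z < PI.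
Proof.
  unfold Carg; destruct (atan_bound (Im z / (Cmod z + Re z))); lra.
Qed.

Lemma Carg_polar (z : C) :
  0 < Cmod z + Re z -> z = (RtoC (Cmod z) * cis (Carg z))%C.
Proof.
  intros Hs.
  assert (Hm : Cmod z * Cmod z = Re z * Re z + Im z * Im z).
  { unfold Cmod, Re, Im. rewrite sqrt_sqrt; [ring | nra]. }
  assert (Hm0 : 0 < Cmod z).
  { pose proof (Cmod_ge_0 z) as H0.
    destruct (Req_dec (Cmod z) 0) as [E | E]; [| lra].
    rewrite E in Hm. rewrite E in Hs. nra. }
  unfold Carg, cis, RtoC, Cmult; simpl.
  rewrite cos_2a, sin_2a, cos_atan, sin_atan.
  set (m := Cmod z) in *.
  set (t := Im z / (m + Re z)).
  assert (Ht : t * (m + Re z) = Im z) by (unfold t; field; lra).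
  clearbody t.
  set (q := sqrt (1 + t²)).
  assert (Hq2 : q * q = 1 + t * t).
  { unfold q. rewrite sqrt_sqrt; unfold Rsqr; nra. }
  assert (Hq : 0 < q) by (apply sqrt_lt_R0; unfold Rsqr; nra).
  assert (Hk : (1 + t * t) * (m + Re z) = 2 * m).
  { apply (Rmult_eq_reg_r (m + Re z)); [| lra].
    replace ((1 + t * t) * (m + Re z) * (m + Re z))
      with ((m + Re z) * (m + Re z) + (t * (m + Re z)) * (t * (m + Re z)))
      by ring.
    rewrite Ht. nra. }
  assert (Hx : (1 + t * t) * Re z = m * (1 - t * t)) by nra.
  assert (Hy : (1 + t * t) * Im z = 2 * m * t).
  { rewrite <- Ht.
    replace ((1 + t * t) * (t * (m + Re z)))
      with (t * ((1 + t * t) * (m + Re z))) by ring.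
    rewrite Hk. ring. }
  assert (H1 : 0 < 1 + t * t) by nra.
  transitivity (Re z, Im z); [destruct z; reflexivity |].
  f_equal.
  - replace (1 / q * (1 / q) - t / q * (t / q)) with ((1 - t * t) / (q * q))
      by (field; lra).
    rewrite Hq2. apply (Rmult_eq_reg_l (1 + t * t)); [| lra].
    rewrite Hx. field. lra.
  - replace (2 * (t / q) * (1 / q)) with (2 * t / (q * q)) by (field; lra).
    rewrite Hq2. apply (Rmult_eq_reg_l (1 + t * t)); [| lra].
    rewrite Hy. field. lra.
Qed.

(* Main.v *)
Require Import Defs.
From Stdlib Require Import Reals Lra Lia Psatz ZArith.
From Stdlib Require Import IndefiniteDescription.
From Coquelicot Require Import Coquelicot.
Open Scope R_scope.

(** Why the theorem is true.

    Let p >= 1.  On the circle of radius r < 1 the number r f'(0) is a Fourier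
    coefficient of f, so r |f'(0)| is at most the mean of |f|, which is at most
    the norm ([derive_mod_le], [mean_mod_le_1]).  Equality forces f(z) / z to
    become real and nonnegative on the circle as r tends to 1, which pairs the
    coefficients of f around the first one: after a rotation
    f(z) = a + z + conj(a) z^2 ([extremal_quadratic]).  For p = 1 nonnegativity
    means |a| <= 1/2, and such a polynomial is a rotation of some f_a by the
    factorization of nonnegative trigonometric polynomials of degree 1.  For
    p > 1 the modulus must moreover be constant on the circle, so a = 0
    ([extremal_form]).

    Let p < 1 and s = 2 / p.  The idea is the inner-outer factorization
    f = B h^s with |B| <= 1 and h in the unit ball of H^2.  With
    c = |h(0)|, x = |h'(0)| and b = |B(0)|, the Schwarz-Pick inequality and
    Parseval's formula give
      |f'(0)| <= (1 - b^2) c^s + b s c^(s-1) x,   c^2 + x^2 <= 1,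
    and elementary calculus shows that the right side is largest exactly for
    b = 1, c^2 = 1 - p/2, x^2 = p/2 ([coefficient_maximum]).  The factors need
    only be approximate: on a circle of radius r < 1 the function |f|^p is
    majorized by |exp L|^2 for a polynomial L, with almost the same mean
    ([outer_majorant]), and h = exp L, B = f exp(- s L) satisfy the same
    inequalities, wherever f vanishes ([factorization]).  The polynomial L comes
    from approximating a continuous function on the circle by its Poisson
    integral ([real_part_approx]).

    For an extremal f with p < 1 let r tend to 1.  The bounds above are stable,
    so the Taylor coefficients of B and h converge to those of a unimodular
    constant and of c + H z with |H| = x, where now (c, x) is the maximizer
    ([near_extremal_limits]).  The relation
    (h^s)' h = s h^s h' then passes to the limit as a two-term recurrence for
    the Taylor coefficients of f ([extremal_recurrence]), which the rotated
    function (c + x z)^s satisfies too ([binomial_recurrence]).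

    The underlying function theory starts from complex differentiability at each
    point only.  Goursat's theorem on rectangles ([goursat]), transported by the
    exponential, makes the mean of f over circles independent of the radius
    ([circle_const]).  Together with continuity of the mean in the radius this
    gives the mean value property even for functions that are merely continuous
    at one point ([mean_value]), hence Cauchy's formula and Taylor expansions
    with a geometric error ([cauchy_formula], [taylor_unif]). *)

(** * Continuity and complex derivatives *)

Definition cts {U : UniformSpace} (f : U -> C) (x : U) : Prop :=
  @continuous U C_UniformSpace f x.

Lemma cts_pair {U : UniformSpace} (u v : U -> R) (x : U) :
  continuous u x -> continuous v x -> cts (fun y => (u y, v y)) x.
Proof.
  intros Hu Hv P [e He].
  assert (H1 := Hu _ (locally_ball (u x) e)).
  assert (H2 := Hv _ (locally_ball (v x) e)).
  unfold filtermap in *.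
  generalize (filter_and _ _ H1 H2); apply filter_imp.
  intros y [A B]; apply He; split; assumption.
Qed.

Lemma cts_re {U : UniformSpace} (f : U -> C) (x : U) :
  cts f x -> continuous (fun y => Re (f y)) x.
Proof.
  intros H; apply (@continuous_comp U C_UniformSpace R_UniformSpace f (fun z : C => fst z)).
  exact H. apply (@continuous_fst R_UniformSpace R_UniformSpace).
Qed.

Lemma cts_im {U : UniformSpace} (f : U -> C) (x : U) :
  cts f x -> continuous (fun y => Im (f y)) x.
Proof.
  intros H; apply (@continuous_comp U C_UniformSpace R_UniformSpace f (fun z : C => snd z)).
  exact H. apply (@continuous_snd R_UniformSpace R_UniformSpace).
Qed.

Lemma cts_comp {U V : UniformSpace} (g : U -> V) (f : V -> C) (x : U) :
  continuous g x -> cts f (g x) -> cts (fun y => f (g y)) x.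
Proof.
  intros Hg Hf. exact (@continuous_comp U V C_UniformSpace g f x Hg Hf).
Qed.

Lemma continuous_compC {U V : UniformSpace} (g : U -> C) (f : C -> V) (x : U) :
  cts g x -> @continuous C_UniformSpace V f (g x) -> continuous (fun y => f (g y)) x.
Proof.
  intros Hg Hf. exact (@continuous_comp U C_UniformSpace V g f x Hg Hf).
Qed.

Lemma cts_const {U : UniformSpace} (c : C) (x : U) : cts (fun _ => c) x.
Proof. apply continuous_const. Qed.

Lemma cts_id (z : C) : cts (U := C_UniformSpace) (fun w => w) z.
Proof. apply continuous_id. Qed.

Lemma cts_plus {U : UniformSpace} (f g : U -> C) (x : U) :
  cts f x -> cts g x -> cts (fun y => f y + g y)%C x.
Proof.
  intros Hf Hg. apply (cts_pair (fun y => Re (f y) + Re (g y)) (fun y => Im (f y) + Im (g y))).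
  - apply (continuous_plus (fun y => Re (f y)) (fun y => Re (g y))); apply cts_re; assumption.
  - apply (continuous_plus (fun y => Im (f y)) (fun y => Im (g y))); apply cts_im; assumption.
Qed.

Lemma cts_opp {U : UniformSpace} (f : U -> C) (x : U) :
  cts f x -> cts (fun y => - f y)%C x.
Proof.
  intros Hf. apply (cts_pair (fun y => - Re (f y)) (fun y => - Im (f y))).
  - apply (continuous_opp (fun y => Re (f y))); apply cts_re; assumption.
  - apply (continuous_opp (fun y => Im (f y))); apply cts_im; assumption.
Qed.

Lemma cts_minus {U : UniformSpace} (f g : U -> C) (x : U) :
  cts f x -> cts g x -> cts (fun y => f y - g y)%C x.
Proof. intros; apply (cts_plus f (fun y => - g y)%C); auto using cts_opp. Qed.

Lemma continuous_Rmult {U : UniformSpace} (f g : U -> R) (x : U) :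
  continuous f x -> continuous g x -> continuous (fun y => f y * g y) x.
Proof. intros; apply (continuous_mult f g); assumption. Qed.

Lemma continuous_Rplus {U : UniformSpace} (f g : U -> R) (x : U) :
  continuous f x -> continuous g x -> continuous (fun y => f y + g y) x.
Proof. intros; apply (continuous_plus f g); assumption. Qed.

Lemma continuous_Rminus {U : UniformSpace} (f g : U -> R) (x : U) :
  continuous f x -> continuous g x -> continuous (fun y => f y - g y) x.
Proof. intros; apply (continuous_minus f g); assumption. Qed.

Lemma continuous_Rfun {U : UniformSpace} (h : R -> R) (f : U -> R) (x : U) :
  continuous f x -> continuity_pt h (f x) -> continuous (fun y => h (f y)) x.
Proof.
  intros H K; apply (continuous_comp f h); [exact H |].
  apply continuity_pt_filterlim; exact K.
Qed.

Lemma continuous_sqr {U : UniformSpace} (f : U -> R) (x : U) :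
  continuous f x -> continuous (fun y => f y ^ 2) x.
Proof.
  intros H; apply (continuous_Rfun (fun y => y ^ 2)); [exact H |].
  apply derivable_continuous_pt, derivable_pt_pow.
Qed.

Lemma cts_mult {U : UniformSpace} (f g : U -> C) (x : U) :
  cts f x -> cts g x -> cts (fun y => f y * g y)%C x.
Proof.
  intros Hf Hg.
  pose proof (cts_re _ _ Hf); pose proof (cts_im _ _ Hf).
  pose proof (cts_re _ _ Hg); pose proof (cts_im _ _ Hg).
  apply (cts_pair (fun y => Re (f y) * Re (g y) - Im (f y) * Im (g y))
                  (fun y => Re (f y) * Im (g y) + Im (f y) * Re (g y)));
  [apply continuous_Rminus | apply continuous_Rplus];
  apply continuous_Rmult; assumption.
Qed.

Lemma cts_conj {U : UniformSpace} (f : U -> C) (x : U) :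
  cts f x -> cts (fun y => Cconj (f y)) x.
Proof.
  intros Hf. apply (cts_pair (fun y => Re (f y)) (fun y => - Im (f y))).
  - apply cts_re; assumption.
  - apply (continuous_opp (fun y => Im (f y))); apply cts_im; assumption.
Qed.

Lemma cts_RtoC {U : UniformSpace} (f : U -> R) (x : U) :
  continuous f x -> cts (fun y => RtoC (f y)) x.
Proof.
  intros H; apply (cts_pair f (fun _ => 0)); [exact H | apply continuous_const].
Qed.

Lemma continuous_Cmod {U : UniformSpace} (f : U -> C) (x : U) :
  cts f x -> continuous (fun y => Cmod (f y)) x.
Proof.
  intros H. unfold Cmod.
  apply (continuous_Rfun sqrt).
  - apply continuous_Rplus; apply continuous_sqr; [apply (cts_re f) | apply (cts_im f)]; exact H.
  - apply continuity_pt_sqrt. nra.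
Qed.

Lemma Cmod2 (z : C) : Cmod z * Cmod z = Re z * Re z + Im z * Im z.
Proof. generalize (Cmod2_alt z); simpl; lra. Qed.

Lemma Cnz_mod2 (z : C) : z <> 0%C -> 0 < Re z * Re z + Im z * Im z.
Proof. intros H; rewrite <- Cmod2; apply Cmod_gt_0 in H; nra. Qed.

Lemma cts_inv {U : UniformSpace} (f : U -> C) (x : U) :
  cts f x -> f x <> 0%C -> cts (fun y => / f y)%C x.
Proof.
  intros Hf Hn.
  pose proof (cts_re _ _ Hf); pose proof (cts_im _ _ Hf).
  pose proof (Cnz_mod2 _ Hn).
  assert (D : continuous (fun y => / (Re (f y) ^ 2 + Im (f y) ^ 2)) x).
  { apply (continuous_Rfun Rinv).
    - apply continuous_Rplus; apply continuous_sqr; assumption.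
    - apply continuity_pt_inv. 
      + apply derivable_continuous_pt, derivable_pt_id.
      + unfold id; simpl; nra. }
  apply (cts_pair (fun y => Re (f y) * / (Re (f y) ^ 2 + Im (f y) ^ 2))
                  (fun y => - Im (f y) * / (Re (f y) ^ 2 + Im (f y) ^ 2)));
  apply continuous_Rmult; try assumption.
  apply (continuous_opp (fun y => Im (f y))); assumption.
Qed.

Lemma cts_div {U : UniformSpace} (f g : U -> C) (x : U) :
  cts f x -> cts g x -> g x <> 0%C -> cts (fun y => f y / g y)%C x.
Proof. intros; apply (cts_mult f (fun y => / g y)%C); auto using cts_inv. Qed.

Lemma cts_cis {U : UniformSpace} (u : U -> R) (x : U) :
  continuous u x -> cts (fun y => cis (u y)) x.
Proof.
  intros H. apply (cts_pair (fun y => cos (u y)) (fun y => sin (u y))).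
  - apply (continuous_Rfun cos); [exact H | apply continuity_cos].
  - apply (continuous_Rfun sin); [exact H | apply continuity_sin].
Qed.

Lemma Cabs_split (z : C) : Cmod z <= Rabs (Re z) + Rabs (Im z).
Proof.
  pose proof (Cmod2 z). pose proof (Cmod_ge_0 z).
  pose proof (Rabs_pos (Re z)); pose proof (Rabs_pos (Im z)).
  assert (Rabs (Re z) * Rabs (Re z) = Re z * Re z) by (rewrite <- Rabs_mult; apply Rabs_pos_eq; nra).
  assert (Rabs (Im z) * Rabs (Im z) = Im z * Im z) by (rewrite <- Rabs_mult; apply Rabs_pos_eq; nra).
  nra.
Qed.

Lemma im_le_Cmod (z : C) : Rabs (Im z) <= Cmod z.
Proof.
  eapply Rle_trans; [apply Rmax_r | apply (Rmax_Cmod z)].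
Qed.

(** The uniform structure of C is that of R * R, whose balls are boxes. *)
Lemma locally_Cmod (z : C) (P : C -> Prop) :
  (exists d, 0 < d /\ forall w, Cmod (w - z) < d -> P w) <->
  locally (T := C_UniformSpace) z P.
Proof.
  split.
  - intros [d [Hd H]]. exists (mkposreal (d / 2) (ltac:(lra))). intros w [H1 H2].
    apply H. eapply Rle_lt_trans; [apply Cabs_split |].
    change (Rabs (Re w - Re z) < d / 2) in H1. change (Rabs (Im w - Im z) < d / 2) in H2.
    change (Rabs (Re w - Re z) + Rabs (Im w - Im z) < d). lra.
  - intros [d H]. exists d. split; [apply cond_pos |]. intros w Hw. apply H.
    split.
    + change (Rabs (Re (w - z)%C) < d). eapply Rle_lt_trans; [apply re_le_Cmod | exact Hw].
    + change (Rabs (Im (w - z)%C) < d). eapply Rle_lt_trans; [apply im_le_Cmod | exact Hw].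
Qed.

Lemma locally_all (z : C) (P : C -> Prop) :
  (forall w, P w) -> locally (T := C_UniformSpace) z P.
Proof. apply (filter_forall (F := locally (T := C_UniformSpace) z)). Qed.

Lemma cts_eps {U : UniformSpace} (f : U -> C) (x : U) :
  cts f x <-> (forall e, 0 < e -> locally x (fun y => Cmod (f y - f x) < e)).
Proof.
  split.
  - intros H e He.
    assert (K : locally (T := C_UniformSpace) (f x) (fun w => Cmod (w - f x) < e))
      by (apply locally_Cmod; exists e; split; auto).
    apply (H _ K).
  - intros H P HP. apply locally_Cmod in HP. destruct HP as [d [Hd HP]].
    unfold filtermap. generalize (H d Hd). apply filter_imp. intros y Hy; apply HP, Hy.
Qed.

Lemma locally_imp (z : C) (P Q : C -> Prop) :
  (forall w, P w -> Q w) ->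
  locally (T := C_UniformSpace) z P -> locally (T := C_UniformSpace) z Q.
Proof. apply (filter_imp (F := locally (T := C_UniformSpace) z)). Qed.

Lemma locally_imp2 (z : C) (P Q S : C -> Prop) :
  (forall w, P w -> Q w -> S w) -> locally (T := C_UniformSpace) z P ->
  locally (T := C_UniformSpace) z Q -> locally (T := C_UniformSpace) z S.
Proof.
  intros H A B. apply (locally_imp z (fun w => P w /\ Q w)).
  - intros w [X Y]; auto.
  - apply (filter_and (F := locally (T := C_UniformSpace) z)); assumption.
Qed.

(** Caratheodory's form of complex differentiability: the difference quotient
    has a continuous extension.  It makes the calculus rules algebraic. *)
Definition cderiv (F : C -> C) (z d : C) : Prop :=
  exists Phi : C -> C, cts (U := C_UniformSpace) Phi z /\ Phi z = d /\
    locally (T := C_UniformSpace) z (fun w => F w = F z + Phi w * (w - z))%C.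

Lemma cderiv_cts (F : C -> C) (z d : C) :
  cderiv F z d -> cts (U := C_UniformSpace) F z.
Proof.
  intros [Phi [H1 [H2 H3]]].
  apply (continuous_ext_loc (T := C_UniformSpace) (U := C_UniformSpace) F (fun w => F z + Phi w * (w - z))%C z).
  - revert H3; apply locally_imp; intros w E; symmetry; exact E.
  - apply cts_plus; [apply cts_const |]. apply cts_mult; [exact H1 |].
    apply cts_minus; [apply cts_id | apply cts_const].
Qed.

Lemma cderiv_ext_loc (F G : C -> C) (z d : C) :
  locally (T := C_UniformSpace) z (fun w => F w = G w) -> cderiv F z d -> cderiv G z d.
Proof.
  intros E [Phi [H1 [H2 H3]]]. exists Phi; repeat split; try assumption.
  pose proof (locally_singleton _ _ E) as E0; simpl in E0.
  apply (fun H => locally_imp2 _ _ _ _ H E H3); intros w A B. rewrite <- A, <- E0; exact B.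
Qed.

Lemma cderiv_ext (F G : C -> C) (z d : C) :
  (forall w, F w = G w) -> cderiv F z d -> cderiv G z d.
Proof. intros E; apply cderiv_ext_loc, locally_all, E. Qed.

Lemma cderiv_const (c z : C) : cderiv (fun _ => c) z 0%C.
Proof.
  exists (fun _ => 0%C). repeat split; [apply cts_const |].
  apply locally_all; intros; ring.
Qed.

Lemma cderiv_id (z : C) : cderiv (fun w => w) z 1%C.
Proof.
  exists (fun _ => 1%C). repeat split; [apply cts_const |].
  apply locally_all; intros; ring.
Qed.

Lemma cderiv_plus (F G : C -> C) (z a b : C) :
  cderiv F z a -> cderiv G z b -> cderiv (fun w => F w + G w)%C z (a + b)%C.
Proof.
  intros [P [P1 [P2 P3]]] [Q [Q1 [Q2 Q3]]].
  exists (fun w => P w + Q w)%C. repeat split.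
  - apply cts_plus; assumption.
  - rewrite P2, Q2; reflexivity.
  - apply (fun H => locally_imp2 _ _ _ _ H P3 Q3); intros w A B; rewrite A, B; ring.
Qed.

Lemma cderiv_mult (F G : C -> C) (z a b : C) :
  cderiv F z a -> cderiv G z b ->
  cderiv (fun w => F w * G w)%C z (a * G z + F z * b)%C.
Proof.
  intros HF HG. pose proof (cderiv_cts _ _ _ HG) as KG.
  destruct HF as [P [P1 [P2 P3]]]; destruct HG as [Q [Q1 [Q2 Q3]]].
  exists (fun w => P w * G w + F z * Q w)%C. repeat split.
  - apply cts_plus; apply cts_mult; try assumption; apply cts_const.
  - rewrite P2, Q2; reflexivity.
  - apply (fun H => locally_imp2 _ _ _ _ H P3 Q3); intros w A B; rewrite A, B. ring.
Qed.

Lemma cderiv_scal (c : C) (F : C -> C) (z a : C) :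
  cderiv F z a -> cderiv (fun w => c * F w)%C z (c * a)%C.
Proof.
  intros H. replace (c * a)%C with (0 * F z + c * a)%C by ring.
  apply (cderiv_mult (fun _ => c)); [apply cderiv_const | exact H].
Qed.

Lemma cderiv_comp (F G : C -> C) (z a b : C) :
  cderiv F (G z) a -> cderiv G z b -> cderiv (fun w => F (G w)) z (a * b)%C.
Proof.
  intros HF HG. pose proof (cderiv_cts _ _ _ HG) as KG.
  destruct HF as [P [P1 [P2 P3]]]; destruct HG as [Q [Q1 [Q2 Q3]]].
  exists (fun w => P (G w) * Q w)%C. repeat split.
  - apply cts_mult; [| exact Q1]. apply (cts_comp (V := C_UniformSpace) G P); assumption.
  - rewrite P2, Q2; reflexivity.
  - assert (P4 : locally (T := C_UniformSpace) z
      (fun w => F (G w) = F (G z) + P (G w) * (G w - G z))%C) by exact (KG _ P3).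
    apply (fun H => locally_imp2 _ _ _ _ H P4 Q3); intros w A B.
    rewrite A. rewrite B at 2. ring.
Qed.

Lemma cderiv_inv (G : C -> C) (z b : C) :
  cderiv G z b -> G z <> 0%C ->
  cderiv (fun w => / G w)%C z (- b / (G z * G z))%C.
Proof.
  intros HG Hz. pose proof (cderiv_cts _ _ _ HG) as KG.
  destruct HG as [Q [Q1 [Q2 Q3]]].
  exists (fun w => - Q w / (G w * G z))%C. repeat split.
  - apply cts_div.
    + apply cts_opp; exact Q1.
    + apply cts_mult; [exact KG | apply cts_const].
    + apply Cmult_neq_0; assumption.
  - rewrite Q2; reflexivity.
  - assert (N : locally (T := C_UniformSpace) z (fun w => G w <> 0%C)).
    { apply (KG (fun u : C => u <> 0%C)). apply locally_Cmod. exists (Cmod (G z)). split; [apply Cmod_gt_0, Hz |].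
      intros w Hw E. rewrite E in Hw.
      replace (0 - G z)%C with (- G z)%C in Hw by ring.
      rewrite Cmod_opp in Hw; lra. }
    apply (fun H => locally_imp2 _ _ _ _ H N Q3); intros w A B.
    assert (E : (Q w * (w - z) = G w - G z)%C) by (rewrite B; ring).
    replace (- Q w / (G w * G z) * (w - z))%C with (- (Q w * (w - z)) / (G w * G z))%C
      by (unfold Cdiv; ring).
    rewrite E. field; auto.
Qed.

Lemma cderiv_pow (n : nat) (z : C) :
  cderiv (fun w => Cpow w n) z (INR n * Cpow z (pred n))%C.
Proof.
  induction n as [|n IH].
  - replace (INR 0 * Cpow z (pred 0))%C with (RtoC 0) by (simpl INR; ring).
    apply (cderiv_const 1).
  - replace (INR (S n) * Cpow z (pred (S n)))%C with
      (1 * Cpow z n + z * (INR n * Cpow z (pred n)))%C.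
    + apply (cderiv_mult (fun w => w) (fun w => Cpow w n)); [apply cderiv_id | exact IH].
    + rewrite S_INR, RtoC_plus. destruct n; simpl pred; simpl; ring.
Qed.

(** Total on C, so that a removable singularity becomes a point of mere
    continuity, which [mean_value] tolerates. *)
Definition slope (F : C -> C) (z d w : C) : C :=
  match Req_EM_T (Cmod (w - z)) 0 with
  | left _ => d
  | right _ => ((F w - F z) / (w - z))%C
  end.

Lemma slope_refl (F : C -> C) (z d : C) : slope F z d z = d.
Proof.
  unfold slope. destruct (Req_EM_T (Cmod (z - z)) 0) as [|N]; [reflexivity |].
  exfalso; apply N. replace (z - z)%C with (RtoC 0) by ring. apply Cmod_0.
Qed.

Lemma slope_neq (F : C -> C) (z d w : C) :
  w <> z -> slope F z d w = ((F w - F z) / (w - z))%C.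
Proof.
  intros H. unfold slope. destruct (Req_EM_T (Cmod (w - z)) 0) as [E|]; [| reflexivity].
  apply Cmod_eq_0 in E. exfalso; apply H.
  replace w with ((w - z) + z)%C by ring. rewrite E; ring.
Qed.

Lemma slope_spec (F : C -> C) (z d w : C) :
  F w = (F z + slope F z d w * (w - z))%C.
Proof.
  unfold slope. destruct (Req_EM_T (Cmod (w - z)) 0) as [E|N].
  - apply Cmod_eq_0 in E.
    replace w with z by (replace w with ((w - z) + z)%C by ring; rewrite E; ring). ring.
  - assert (N' : (w - z)%C <> 0%C) by (intros E; apply N; rewrite E; apply Cmod_0).
    field; exact N'.
Qed.

Lemma slope_cts_eps (F : C -> C) (z d : C) :
  (forall e, 0 < e -> locally (T := C_UniformSpace) z
    (fun w => Cmod (F w - F z - d * (w - z)) <= e * Cmod (w - z))) ->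
  cts (U := C_UniformSpace) (slope F z d) z.
Proof.
  intros H. apply cts_eps. intros e He. rewrite slope_refl.
  assert (K := H (e / 2) (ltac:(lra))).
  revert K. apply locally_imp. intros w Hw.
  unfold slope. destruct (Req_EM_T (Cmod (w - z)) 0) as [|N].
  - replace (d - d)%C with (RtoC 0) by ring. rewrite Cmod_0; exact He.
  - assert (N' : (w - z)%C <> 0%C) by (intros E; apply N; rewrite E; apply Cmod_0).
    replace ((F w - F z) / (w - z) - d)%C with ((F w - F z - d * (w - z)) / (w - z))%C
      by (field; exact N').
    rewrite Cmod_div by exact N'.
    pose proof (Cmod_ge_0 (w - z)).
    apply Rle_lt_trans with (e / 2); [| lra].
    apply Rle_div_l; lra.
Qed.

Lemma cderiv_eps (F : C -> C) (z d : C) :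
  cderiv F z d <-> forall e, 0 < e -> locally (T := C_UniformSpace) z
    (fun w => Cmod (F w - F z - d * (w - z)) <= e * Cmod (w - z)).
Proof.
  split.
  - intros [Phi [H1 [H2 H3]]] e He.
    assert (K := proj1 (cts_eps _ _) H1 e He).
    apply (fun H => locally_imp2 _ _ _ _ H K H3); intros w A B.
    rewrite B. subst d.
    replace (F z + Phi w * (w - z) - F z - Phi z * (w - z))%C
      with ((Phi w - Phi z) * (w - z))%C by ring.
    rewrite Cmod_mult. apply Rmult_le_compat_r; [apply Cmod_ge_0 | lra].
  - intros H. exists (slope F z d). repeat split.
    + apply slope_cts_eps, H.
    + apply slope_refl.
    + apply locally_all. intros w. apply slope_spec.
Qed.

Lemma slope_cts (F : C -> C) (z d : C) :
  cderiv F z d -> cts (U := C_UniformSpace) (slope F z d) z.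
Proof. intros H. apply slope_cts_eps. apply cderiv_eps, H. Qed.

Lemma cderiv_is_derive (F : C -> C) (z d : C) :
  cderiv F z d <-> @is_derive C_AbsRing C_NormedModule F z d.
Proof.
  rewrite cderiv_eps. split.
  - intros H. split.
    + apply (is_linear_scal_l (K := C_AbsRing) (V := C_NormedModule) d).
    + intros x Hx e.
      assert (x = z).
      { symmetry. apply (is_filter_lim_locally_unique (K := C_AbsRing) (V := AbsRing_NormedModule C_AbsRing) z x Hx). }
      subst x.
      apply locally_C. generalize (H e (cond_pos e)). apply locally_imp.
      intros w B. simpl.
      change (Cmod (F w - F z - (w - z) * d)%C <= e * Cmod (w - z)%C).
      rewrite (Cmult_comm (w - z) d). exact B.
  - intros [_ H] e He.
    assert (K := H z (fun P HP => HP) (mkposreal e He)).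
    apply locally_C in K. revert K. apply locally_imp.
    intros w Hw. simpl in Hw.
    change (Cmod (F w - F z - (w - z) * d)%C <= e * Cmod (w - z)%C) in Hw.
    rewrite (Cmult_comm d (w - z)). exact Hw.
Qed.

(** * Exponential and principal power *)

Lemma C_ext (z w : C) : Re z = Re w -> Im z = Im w -> z = w.
Proof. destruct z, w; simpl; intros; subst; reflexivity. Qed.

Lemma cis_plus (a b : R) : cis (a + b) = (cis a * cis b)%C.
Proof.
  apply C_ext; unfold cis; simpl; [rewrite cos_plus | rewrite sin_plus]; ring.
Qed.

Lemma cis_0 : cis 0 = 1%C.
Proof. unfold cis. rewrite cos_0, sin_0. reflexivity. Qed.

Lemma cis_conj (a : R) : Cconj (cis a) = cis (- a).
Proof. unfold cis, Cconj; simpl. rewrite cos_neg, sin_neg. reflexivity. Qed.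

Lemma cis_mod (a : R) : Cmod (cis a) = 1.
Proof.
  unfold Cmod, cis; simpl. 
  transitivity (sqrt 1); [apply (f_equal sqrt) | apply sqrt_1].
  generalize (sin2_cos2 a); unfold Rsqr; lra.
Qed.

Lemma cis_neq_0 (a : R) : cis a <> 0%C.
Proof. intros E. generalize (cis_mod a). rewrite E, Cmod_0. lra. Qed.

Lemma cis_inv (a : R) : (/ cis a)%C = cis (- a).
Proof.
  assert (E : (cis a * cis (- a) = 1)%C).
  { rewrite <- cis_plus, Rplus_opp_r. apply cis_0. }
  replace (cis (- a)) with (/ cis a * (cis a * cis (- a)))%C.
  - rewrite E. ring.
  - field. apply cis_neq_0.
Qed.

Lemma cis_mult_opp (a : R) : (cis a * cis (- a) = 1)%C.
Proof. rewrite <- cis_plus, Rplus_opp_r. apply cis_0. Qed.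

Lemma cis_pow (n : nat) (t : R) : Cpow (cis t) n = cis (INR n * t).
Proof.
  induction n as [|n IH].
  - simpl. rewrite Rmult_0_l, cis_0; reflexivity.
  - rewrite S_INR. replace ((INR n + 1) * t) with (t + INR n * t) by ring.
    rewrite cis_plus, <- IH. reflexivity.
Qed.

Lemma cis_2PI (t : R) : cis (t + 2 * PI) = cis t.
Proof. unfold cis. rewrite cos_plus, sin_plus, cos_2PI, sin_2PI. f_equal; ring. Qed.

Lemma periodic_Z {A : Type} (u : R -> A) : (forall t, u (t + 2 * PI) = u t) ->
  forall (k : Z) t, u (t + IZR k * (2 * PI)) = u t.
Proof.
  intros H.
  assert (N : forall n t, u (t + INR n * (2 * PI)) = u t).
  { induction n as [|n IH]; intros t.
    - simpl. f_equal. ring.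
    - rewrite S_INR. replace (t + (INR n + 1) * (2 * PI)) with ((t + INR n * (2 * PI)) + 2 * PI) by ring.
      rewrite H. apply IH. }
  intros k t. destruct (Z.le_gt_cases 0 k) as [L|L].
  - rewrite <- (Z2Nat.id k L), <- INR_IZR_INZ. apply N.
  - rewrite <- (N (Z.to_nat (- k)) (t + IZR k * (2 * PI))).
    rewrite INR_IZR_INZ, Z2Nat.id, opp_IZR by lia. f_equal. ring.
Qed.

Lemma cis_Z (k : Z) : cis (IZR k * (2 * PI)) = 1%C.
Proof.
  rewrite <- cis_0, <- (periodic_Z cis cis_2PI k 0). f_equal. ring.
Qed.

Lemma polar (z : C) : exists t, z = (RtoC (Cmod z) * cis t)%C.
Proof.
  destruct (Rle_lt_dec (Cmod z + Re z) 0) as [H|H].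
  - exists PI. pose proof (re_le_Cmod z) as K. pose proof (Cmod2 z).
    pose proof (Cmod_ge_0 z).
    assert (E : Re z = - Cmod z).
    { unfold Rabs in K; destruct (Rcase_abs (Re z)); lra. }
    assert (Im z = 0) by (rewrite E in *; nra).
    apply C_ext; unfold cis; simpl; rewrite cos_PI, sin_PI; lra.
  - exists (Carg z). apply Carg_polar, H.
Qed.

Definition Cexp (z : C) : C := (RtoC (exp (Re z)) * cis (Im z))%C.

Lemma Cexp_plus (z w : C) : Cexp (z + w) = (Cexp z * Cexp w)%C.
Proof.
  unfold Cexp. change (Re (z + w)) with (Re z + Re w). change (Im (z + w)) with (Im z + Im w).
  rewrite exp_plus, cis_plus, RtoC_mult. ring.
Qed.

Lemma Cexp_mod (z : C) : Cmod (Cexp z) = exp (Re z).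
Proof.
  unfold Cexp. rewrite Cmod_mult, cis_mod, Cmod_R, Rmult_1_r.
  apply Rabs_pos_eq. left; apply exp_pos.
Qed.

Lemma Cexp_R (x : R) : Cexp (RtoC x) = RtoC (exp x).
Proof. unfold Cexp; simpl. rewrite cis_0. ring. Qed.

Lemma Cexp_opp (z : C) : (Cexp z * Cexp (- z) = 1)%C.
Proof.
  rewrite <- Cexp_plus. replace (z + - z)%C with (RtoC 0) by ring.
  rewrite Cexp_R, exp_0; reflexivity.
Qed.

Lemma derivable_pt_lim_0_eps (f : R -> R) (l : R) :
  derivable_pt_lim f 0 l -> forall e, 0 < e -> exists d, 0 < d /\
    forall h, Rabs h < d -> Rabs (f h - f 0 - l * h) <= e * Rabs h.
Proof.
  intros H e He. destruct (H e He) as [d Hd]. exists d. split; [apply cond_pos |].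
  intros h Hh. destruct (Req_dec h 0) as [->|N].
  - replace (f 0 - f 0 - l * 0) with 0 by ring. rewrite Rabs_R0. lra.
  - specialize (Hd h N Hh). rewrite Rplus_0_l in Hd.
    replace (f h - f 0 - l * h) with (((f h - f 0) / h - l) * h) by (field; exact N).
    rewrite Rabs_mult. apply Rmult_le_compat_r; [apply Rabs_pos | lra].
Qed.

(** The remainders of exp, cos and sin at 0 combine in
    e^x cos y - 1 - x = e^x (cos y - 1) + (e^x - 1 - x) and
    e^x sin y - y = (e^x - 1) sin y + (sin y - y). *)
Lemma cderiv_Cexp_0 : cderiv Cexp 0%C 1%C.
Proof.
  apply cderiv_eps. intros e0 He0.
  set (e := Rmin 1 (e0 / 16)).
  assert (He : 0 < e) by (apply Rmin_pos; lra).
  assert (He1 : e <= 1) by apply Rmin_l.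
  assert (He2 : e <= e0 / 16) by apply Rmin_r.
  clearbody e.
  destruct (derivable_pt_lim_0_eps exp 1) with (e := e) as [d1 [P1 D1]]; auto.
  { generalize (derivable_pt_lim_exp 0). rewrite exp_0. trivial. }
  destruct (derivable_pt_lim_0_eps cos 0) with (e := e) as [d2 [P2 D2]]; auto.
  { generalize (derivable_pt_lim_cos 0). rewrite sin_0, Ropp_0. trivial. }
  destruct (derivable_pt_lim_0_eps sin 1) with (e := e) as [d3 [P3 D3]]; auto.
  { generalize (derivable_pt_lim_sin 0). rewrite cos_0. trivial. }
  apply locally_Cmod.
  exists (Rmin e (Rmin d1 (Rmin d2 d3))). split.
  { repeat apply Rmin_pos; assumption. }
  intros w Hw.
  replace (w - 0)%C with w in * by ring.
  assert (Ha : Cmod w < e) by (eapply Rlt_le_trans; [exact Hw | apply Rmin_l]).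
  assert (Hb : Cmod w < d1) by (eapply Rlt_le_trans; [exact Hw | eapply Rle_trans; [apply Rmin_r | apply Rmin_l]]).
  assert (Hc : Cmod w < d2) by (eapply Rlt_le_trans; [exact Hw | eapply Rle_trans; [apply Rmin_r | eapply Rle_trans; [apply Rmin_r | apply Rmin_l]]]).
  assert (Hd : Cmod w < d3) by (eapply Rlt_le_trans; [exact Hw | eapply Rle_trans; [apply Rmin_r | eapply Rle_trans; [apply Rmin_r | apply Rmin_r]]]).
  pose proof (re_le_Cmod w) as Hx. pose proof (im_le_Cmod w) as Hy.
  set (x := Re w) in *. set (y := Im w) in *.
  specialize (D1 x (ltac:(lra))). specialize (D2 y (ltac:(lra))). specialize (D3 y (ltac:(lra))).
  rewrite exp_0 in D1. rewrite cos_0 in D2. rewrite sin_0 in D3.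
  pose proof (Rabs_pos x) as X0. pose proof (Rabs_pos y) as Y0.
  assert (E1 : Rabs (exp x - 1) <= 2 * e).
  { replace (exp x - 1) with ((exp x - 1 - 1 * x) + x) by ring.
    eapply Rle_trans; [apply Rabs_triang |]. nra. }
  assert (S1 : Rabs (sin y) <= 2 * Rabs y).
  { replace (sin y) with ((sin y - 0 - 1 * y) + y) by ring.
    eapply Rle_trans; [apply Rabs_triang |]. nra. }
  assert (E3 : Rabs (exp x) <= 3).
  { replace (exp x) with ((exp x - 1) + 1) by ring.
    eapply Rle_trans; [apply Rabs_triang |]. rewrite Rabs_R1; lra. }
  eapply Rle_trans; [apply Cabs_split |].
  replace (Cexp 0) with (RtoC 1) by (rewrite Cexp_R, exp_0; reflexivity).
  replace (Re (Cexp w - 1 - 1 * w)) with (exp x * (cos y - 1 - 0 * y) + (exp x - 1 - 1 * x))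
    by (unfold x, y; clear; destruct w as [a b]; unfold Cexp, cis; simpl; ring).
  replace (Im (Cexp w - 1 - 1 * w)) with ((exp x - 1) * sin y + (sin y - 0 - 1 * y))
    by (unfold x, y; clear; destruct w as [a b]; unfold Cexp, cis; simpl; ring).
  assert (A1 := Rabs_triang (exp x * (cos y - 1 - 0 * y)) (exp x - 1 - 1 * x)).
  assert (A2 := Rabs_triang ((exp x - 1) * sin y) (sin y - 0 - 1 * y)).
  rewrite Rabs_mult in A1, A2.
  pose proof (Rabs_pos (cos y - 1 - 0 * y)). pose proof (Rabs_pos (exp x)).
  pose proof (Rabs_pos (sin y)). pose proof (Rabs_pos (exp x - 1)).
  assert (M1 : Rabs (exp x) * Rabs (cos y - 1 - 0 * y) <= 3 * (e * Cmod w))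
    by (apply Rmult_le_compat; nra).
  assert (M2 : Rabs (exp x - 1) * Rabs (sin y) <= (2 * e) * (2 * Cmod w))
    by (apply Rmult_le_compat; nra).
  assert (M3 : e * Cmod w <= e0 / 16 * Cmod w) by (apply Rmult_le_compat_r; [apply Cmod_ge_0 | lra]).
  assert (M4 : e * Rabs x <= e * Cmod w) by (apply Rmult_le_compat_l; lra).
  assert (M5 : e * Rabs y <= e * Cmod w) by (apply Rmult_le_compat_l; lra).
  pose proof (Cmod_ge_0 w). nra.
Qed.

Lemma cderiv_shift (F : C -> C) (z d : C) (a : C) :
  cderiv F (z + a)%C d -> cderiv (fun w => F (w + a)%C) z d.
Proof.
  intros H. replace d with (d * (1 + 0))%C by ring.
  apply (cderiv_comp F (fun w => w + a)%C); [exact H |].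
  apply cderiv_plus; [apply cderiv_id | apply cderiv_const].
Qed.

Lemma cderiv_Cexp (z : C) : cderiv Cexp z (Cexp z).
Proof.
  apply (cderiv_ext (fun w => Cexp z * Cexp (w + - z))%C).
  - intros w. rewrite <- Cexp_plus. f_equal. ring.
  - enough (K : cderiv (fun w => Cexp z * Cexp (w + - z))%C z (Cexp z * 1)%C)
      by (rewrite Cmult_1_r in K; exact K).
    apply cderiv_scal. apply cderiv_shift.
    replace (z + - z)%C with (RtoC 0) by ring. apply cderiv_Cexp_0.
Qed.

Definition Clog (z : C) : C := (ln (Cmod z), Carg z).

Lemma Re_pos_mod (z : C) : 0 < Re z -> 0 < Cmod z /\ 0 < Cmod z + Re z.
Proof.
  intros H. pose proof (re_le_Cmod z). rewrite Rabs_pos_eq in H0; lra.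
Qed.

Lemma Cexp_Clog (z : C) : 0 < Re z -> Cexp (Clog z) = z.
Proof.
  intros H. destruct (Re_pos_mod z H) as [H1 H2].
  rewrite (Carg_polar z H2) at 2. unfold Cexp, Clog; simpl. rewrite exp_ln by exact H1.
  reflexivity.
Qed.

Lemma Cpow_principal_exp (z : C) (s : R) :
  Cpow_principal z s = Cexp (RtoC s * Clog z)%C.
Proof.
  unfold Cpow_principal, Cexp, Clog, Rpower; simpl.
  replace (s * ln (Cmod z) - 0 * Carg z) with (s * ln (Cmod z)) by ring.
  replace (s * Carg z + 0 * ln (Cmod z)) with (s * Carg z) by ring. reflexivity.
Qed.

Lemma cts_Clog (z : C) : 0 < Re z -> cts (U := C_UniformSpace) Clog z.
Proof.
  intros H. destruct (Re_pos_mod z H) as [H1 H2].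
  apply (cts_pair (U := C_UniformSpace) (fun w => ln (Cmod w)) Carg).
  - apply (continuous_Rfun (U := C_UniformSpace) ln).
    + apply continuous_Cmod, cts_id.
    + apply derivable_continuous_pt. exists (/ Cmod z). apply derivable_pt_lim_ln, H1.
  - unfold Carg.
    apply (continuous_Rmult (U := C_UniformSpace) (fun _ => 2)); [apply continuous_const |].
    apply (continuous_Rfun (U := C_UniformSpace) atan).
    + apply (continuous_Rmult (U := C_UniformSpace) (fun w => Im w) (fun w => / (Cmod w + Re w))).
      * apply cts_im, cts_id.
      * apply (continuous_Rfun (U := C_UniformSpace) Rinv).
        -- apply (continuous_Rplus (U := C_UniformSpace) (fun w => Cmod w) (fun w => Re w)).
           ++ apply continuous_Cmod, cts_id.
           ++ apply cts_re, cts_id.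
        -- apply continuity_pt_inv; [apply derivable_continuous_pt, derivable_pt_id |].
           unfold id; lra.
    + apply derivable_continuous_pt. eexists. apply derivable_pt_lim_atan.
Qed.

(** Inverse function argument: invert the Caratheodory slope of the exponential
    at the point Clog z, where it is z. *)
Lemma cderiv_Clog (z : C) : 0 < Re z -> cderiv Clog z (/ z)%C.
Proof.
  intros H. pose proof (cts_Clog z H) as KL.
  assert (Hz : z <> 0%C) by (intros E; rewrite E in H; simpl in H; lra).
  destruct (cderiv_Cexp (Clog z)) as [P [P1 [P2 P3]]].
  rewrite (Cexp_Clog z H) in *.
  exists (fun w => / P (Clog w))%C.
  assert (KP : cts (U := C_UniformSpace) (fun w => P (Clog w)) z)
    by (apply (cts_comp (V := C_UniformSpace) Clog P); assumption).
  repeat split.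
  - apply cts_inv; [exact KP |]. rewrite P2; exact Hz.
  - rewrite P2; reflexivity.
  - assert (P4 : locally (T := C_UniformSpace) z
      (fun w => Cexp (Clog w) = z + P (Clog w) * (Clog w - Clog z))%C) by exact (KL _ P3).
    assert (N : locally (T := C_UniformSpace) z (fun w => P (Clog w) <> 0%C)).
    { apply (KP (fun u : C => u <> 0%C)). apply locally_Cmod. rewrite P2.
      exists (Cmod z). split; [apply Cmod_gt_0, Hz |].
      intros w Hw E. rewrite E in Hw.
      replace (0 - z)%C with (- z)%C in Hw by ring.
      rewrite Cmod_opp in Hw; lra. }
    assert (M : locally (T := C_UniformSpace) z (fun w => 0 < Re w)).
    { apply locally_Cmod. exists (Re z). split; [exact H |]. intros w Hw.
      pose proof (re_le_Cmod (w - z)) as K. 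
      assert (Rabs (Re w - Re z) < Re z) by (eapply Rle_lt_trans; [exact K | exact Hw]).
      apply Rabs_def2 in H0. lra. }
    apply (locally_imp2 z (fun w => Cexp (Clog w) = z + P (Clog w) * (Clog w - Clog z) /\ 0 < Re w)%C (fun w => P (Clog w) <> 0%C)).
    + intros w [A B] D. rewrite (Cexp_Clog w B) in A.
      assert (E : (w - z = P (Clog w) * (Clog w - Clog z))%C) by (rewrite A at 1; ring).
      rewrite E. field. exact D.
    + apply (fun K => locally_imp2 _ _ _ _ K P4 M). intros w A B; split; assumption.
    + exact N.
Qed.

Definition analytic (rho : R) (F : C -> C) : Prop :=
  forall z, Cmod z < rho -> exists d, cderiv F z d.

Lemma analytic_on_disc_iff (F : C -> C) : analytic_on_disc F <-> analytic 1 F.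
Proof.
  split; intros H z Hz; destruct (H z Hz) as [d Hd]; exists d;
  apply cderiv_is_derive; exact Hd.
Qed.

(** * Complex line integrals and Goursat's theorem on rectangles *)

Definition CInt (g : R -> C) (a b : R) : C :=
  (RInt (fun t => Re (g t)) a b, RInt (fun t => Im (g t)) a b).

Definition cts_on (g : R -> C) (a b : R) : Prop :=
  forall t, a <= t <= b -> cts g t.

Lemma ex_RInt_cont (u : R -> R) (a b : R) :
  a <= b -> (forall t, a <= t <= b -> continuous u t) -> ex_RInt u a b.
Proof.
  intros H K. apply (ex_RInt_continuous (V := R_CompleteNormedModule)).
  rewrite Rmin_left, Rmax_right by exact H. exact K.
Qed.

Lemma cts_on_re g a b : a <= b -> cts_on g a b -> ex_RInt (fun t => Re (g t)) a b.
Proof. intros H K; apply ex_RInt_cont; [exact H | intros; apply cts_re, K; assumption]. Qed.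

Lemma cts_on_im g a b : a <= b -> cts_on g a b -> ex_RInt (fun t => Im (g t)) a b.
Proof. intros H K; apply ex_RInt_cont; [exact H | intros; apply cts_im, K; assumption]. Qed.

Lemma RInt_abs_le (u : R -> R) (a b M : R) :
  a <= b -> ex_RInt u a b -> (forall t, a <= t <= b -> Rabs (u t) <= M) ->
  Rabs (RInt u a b) <= M * (b - a).
Proof.
  intros H E K.
  rewrite (Rmult_comm M). apply (abs_RInt_le_const u a b M); assumption.
Qed.

Lemma CInt_ext (f g : R -> C) (a b : R) :
  a <= b -> (forall t, a <= t <= b -> f t = g t) -> CInt f a b = CInt g a b.
Proof.
  intros H E. unfold CInt. f_equal; apply RInt_ext;
  rewrite Rmin_left, Rmax_right by exact H; intros x Hx; rewrite E; auto; lra.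
Qed.

Lemma CInt_plus (f g : R -> C) (a b : R) :
  a <= b -> cts_on f a b -> cts_on g a b ->
  CInt (fun t => f t + g t)%C a b = (CInt f a b + CInt g a b)%C.
Proof.
  intros H Hf Hg. apply C_ext; simpl.
  - apply (RInt_plus (fun t => Re (f t)) (fun t => Re (g t))); apply cts_on_re; assumption.
  - apply (RInt_plus (fun t => Im (f t)) (fun t => Im (g t))); apply cts_on_im; assumption.
Qed.

Lemma CInt_le (g : R -> C) (a b M : R) :
  a <= b -> cts_on g a b -> (forall t, a <= t <= b -> Cmod (g t) <= M) ->
  Cmod (CInt g a b) <= 2 * M * (b - a).
Proof.
  intros H Hg K. eapply Rle_trans; [apply Cabs_split |]. simpl.
  assert (Rabs (RInt (fun t => Re (g t)) a b) <= M * (b - a)).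
  { apply RInt_abs_le; [exact H | apply cts_on_re; assumption |].
    intros t Ht. eapply Rle_trans; [apply re_le_Cmod | apply K, Ht]. }
  assert (Rabs (RInt (fun t => Im (g t)) a b) <= M * (b - a)).
  { apply RInt_abs_le; [exact H | apply cts_on_im; assumption |].
    intros t Ht. eapply Rle_trans; [apply im_le_Cmod | apply K, Ht]. }
  lra.
Qed.

Lemma CInt_Chasles (g : R -> C) (a b c : R) :
  a <= b -> b <= c -> cts_on g a c -> CInt g a c = (CInt g a b + CInt g b c)%C.
Proof.
  intros H1 H2 K.
  assert (K1 : cts_on g a b) by (intros t Ht; apply K; lra).
  assert (K2 : cts_on g b c) by (intros t Ht; apply K; lra).
  apply C_ext; simpl; symmetry.
  - apply (RInt_Chasles (fun t => Re (g t))); apply cts_on_re; assumption.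
  - apply (RInt_Chasles (fun t => Im (g t))); apply cts_on_im; assumption.
Qed.

Lemma RInt_affine (u v a b : R) :
  RInt (fun t => u + v * t) a b = u * (b - a) + v * (b * b - a * a) / 2.
Proof.
  apply is_RInt_unique.
  replace (u * (b - a) + v * (b * b - a * a) / 2)
    with (minus ((fun t => u * t + v * (t * t) / 2) b) ((fun t => u * t + v * (t * t) / 2) a)).
  - apply (is_RInt_derive (fun t => u * t + v * (t * t) / 2)).
    + intros x _. auto_derive; [trivial | field].
    + intros x _. apply continuous_Rplus; [apply continuous_const |].
      apply continuous_Rmult; [apply continuous_const | apply continuous_id].
  - unfold minus, plus, opp; simpl. field.
Qed.

(** The boundary is traversed counterclockwise. *)
Definition rect_int (phi : C -> C) (x y w h : R) : C :=
  (CInt (fun t => phi (t, y)) x (x + w) - CInt (fun t => phi (t, y + h)%R) x (x + w)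
   + Ci * (CInt (fun t => phi (x + w, t)%R) y (y + h) - CInt (fun t => phi (x, t)) y (y + h)))%C.

Definition cts_rect (phi : C -> C) (x y w h : R) : Prop :=
  forall s t, x <= s <= x + w -> y <= t <= y + h -> cts (U := C_UniformSpace) phi (s, t).

Lemma cts_horiz (phi : C -> C) (s t : R) :
  cts (U := C_UniformSpace) phi (s, t) -> cts (fun u => phi (u, t)) s.
Proof.
  intros H. apply (cts_comp (V := C_UniformSpace) (fun u : R => (u, t)) phi); [| exact H].
  apply (cts_pair (fun u : R => u) (fun _ => t)); [apply continuous_id | apply continuous_const].
Qed.

Lemma cts_vert (phi : C -> C) (s t : R) :
  cts (U := C_UniformSpace) phi (s, t) -> cts (fun u => phi (s, u)) t.
Proof.
  intros H. apply (cts_comp (V := C_UniformSpace) (fun u : R => (s, u)) phi); [| exact H].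
  apply (cts_pair (fun _ => s) (fun u : R => u)); [apply continuous_const | apply continuous_id].
Qed.

Lemma rect_int_split (phi : C -> C) (x y w h : R) :
  0 <= w -> 0 <= h -> cts_rect phi x y (2 * w) (2 * h) ->
  rect_int phi x y (2 * w) (2 * h) =
  (rect_int phi x y w h + rect_int phi (x + w) y w h
   + rect_int phi x (y + h) w h + rect_int phi (x + w) (y + h) w h)%C.
Proof.
  intros Hw Hh K. unfold rect_int.
  rewrite (CInt_Chasles (fun t => phi (t, y)) x (x + w) (x + 2 * w));
    [| lra | lra | intros t Ht; apply cts_horiz, K; lra].
  rewrite (CInt_Chasles (fun t => phi (t, (y + 2 * h)%R)) x (x + w) (x + 2 * w));
    [| lra | lra | intros t Ht; apply cts_horiz, K; lra].
  rewrite (CInt_Chasles (fun t => phi ((x + 2 * w)%R, t)) y (y + h) (y + 2 * h));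
    [| lra | lra | intros t Ht; apply cts_vert, K; lra].
  rewrite (CInt_Chasles (fun t => phi (x, t)) y (y + h) (y + 2 * h));
    [| lra | lra | intros t Ht; apply cts_vert, K; lra].
  replace (x + w + w) with (x + 2 * w) by ring.
  replace (y + h + h) with (y + 2 * h) by ring.
  ring.
Qed.

Lemma rect_int_plus (f g : C -> C) (x y w h : R) :
  0 <= w -> 0 <= h -> cts_rect f x y w h -> cts_rect g x y w h ->
  rect_int (fun z => f z + g z)%C x y w h = (rect_int f x y w h + rect_int g x y w h)%C.
Proof.
  intros Hw Hh Kf Kg. unfold rect_int.
  rewrite (CInt_plus (fun t => f (t, y)) (fun t => g (t, y)));
    [| lra | intros t Ht; apply cts_horiz, Kf; lra | intros t Ht; apply cts_horiz, Kg; lra].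
  rewrite (CInt_plus (fun t => f (t, (y + h)%R)) (fun t => g (t, (y + h)%R)));
    [| lra | intros t Ht; apply cts_horiz, Kf; lra | intros t Ht; apply cts_horiz, Kg; lra].
  rewrite (CInt_plus (fun t => f ((x + w)%R, t)) (fun t => g ((x + w)%R, t)));
    [| lra | intros t Ht; apply cts_vert, Kf; lra | intros t Ht; apply cts_vert, Kg; lra].
  rewrite (CInt_plus (fun t => f (x, t)) (fun t => g (x, t)));
    [| lra | intros t Ht; apply cts_vert, Kf; lra | intros t Ht; apply cts_vert, Kg; lra].
  ring.
Qed.

(** An affine function has a primitive; here its four integrals are computed. *)
Lemma rect_int_affine (a b : C) (x y w h : R) :
  rect_int (fun z => a + b * z)%C x y w h = 0%C.
Proof.
  destruct a as [a1 a2], b as [b1 b2].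
  assert (E : forall t s, (((a1, a2) + (b1, b2) * (t, s))%C : C) =
     (a1 + b1 * t - b2 * s, a2 + b1 * s + b2 * t)) by (intros; apply C_ext; simpl; ring).
  assert (H : forall s p q, CInt (fun t => (a1, a2) + (b1, b2) * (t, s))%C p q =
    ((a1 - b2 * s) * (q - p) + b1 * (q * q - p * p) / 2,
     (a2 + b1 * s) * (q - p) + b2 * (q * q - p * p) / 2)).
  { intros s p q. unfold CInt. f_equal.
    - rewrite <- RInt_affine. apply RInt_ext; intros t _; rewrite E; simpl; ring.
    - rewrite <- RInt_affine. apply RInt_ext; intros t _; rewrite E; simpl; ring. }
  assert (V : forall s p q, CInt (fun t => (a1, a2) + (b1, b2) * (s, t))%C p q =
    ((a1 + b1 * s) * (q - p) + (- b2) * (q * q - p * p) / 2,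
     (a2 + b2 * s) * (q - p) + b1 * (q * q - p * p) / 2)).
  { intros s p q. unfold CInt. f_equal.
    - rewrite <- RInt_affine. apply RInt_ext; intros t _; rewrite E; simpl; ring.
    - rewrite <- RInt_affine. apply RInt_ext; intros t _; rewrite E; simpl; ring. }
  unfold rect_int. rewrite !H, !V. apply C_ext; simpl; field.
Qed.

Lemma rect_int_le (phi : C -> C) (x y w h M : R) :
  0 <= w -> 0 <= h -> cts_rect phi x y w h ->
  (forall s t, x <= s <= x + w -> y <= t <= y + h -> Cmod (phi (s, t)) <= M) ->
  Cmod (rect_int phi x y w h) <= 4 * M * (w + h).
Proof.
  intros Hw Hh K B. unfold rect_int.
  assert (H1 : Cmod (CInt (fun t => phi (t, y)) x (x + w)) <= 2 * M * (x + w - x)).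
  { apply CInt_le; [lra | intros t Ht; apply cts_horiz, K; lra | intros; apply B; lra]. }
  assert (H2 : Cmod (CInt (fun t => phi (t, (y + h)%R)) x (x + w)) <= 2 * M * (x + w - x)).
  { apply CInt_le; [lra | intros t Ht; apply cts_horiz, K; lra | intros; apply B; lra]. }
  assert (H3 : Cmod (CInt (fun t => phi ((x + w)%R, t)) y (y + h)) <= 2 * M * (y + h - y)).
  { apply CInt_le; [lra | intros t Ht; apply cts_vert, K; lra | intros; apply B; lra]. }
  assert (H4 : Cmod (CInt (fun t => phi (x, t)) y (y + h)) <= 2 * M * (y + h - y)).
  { apply CInt_le; [lra | intros t Ht; apply cts_vert, K; lra | intros; apply B; lra]. }
  eapply Rle_trans; [apply Cmod_triangle |]. rewrite Cmod_mult, Cmod_Ci, Rmult_1_l.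
  assert (T : forall u v : C, Cmod (u - v) <= Cmod u + Cmod v).
  { intros u v. unfold Cminus. eapply Rle_trans; [apply Cmod_triangle |]. rewrite Cmod_opp; lra. }
  eapply Rle_trans; [apply Rplus_le_compat; apply T |]. lra.
Qed.

(** One of the four quarters always carries at least a quarter of J; iterating
    this choice gives nested rectangles around a point. *)
Lemma bisection (J : R -> R -> R -> R -> R) (x0 y0 w h : R) :
  0 <= w -> 0 <= h ->
  (forall x y u v, 0 <= u -> 0 <= v ->
     x0 <= x -> x + 2 * u <= x0 + w -> y0 <= y -> y + 2 * v <= y0 + h ->
     J x y (2 * u) (2 * v) <=
       J x y u v + J (x + u) y u v + J x (y + v) u v + J (x + u) (y + v) u v) ->
  exists xs ys, forall n, exists x y,
    (x0 <= x /\ x + w / 2 ^ n <= x0 + w) /\ (y0 <= y /\ y + h / 2 ^ n <= y0 + h) /\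
    x <= xs <= x + w / 2 ^ n /\ y <= ys <= y + h / 2 ^ n /\
    J x0 y0 w h / 4 ^ n <= J x y (w / 2 ^ n) (h / 2 ^ n).
Proof.
  intros Hw Hh Sub.
  set (step := fun (n : nat) (p : R * R) =>
    let x := fst p in let y := snd p in
    let u := w / 2 ^ (S n) in let v := h / 2 ^ (S n) in
    let m := J x0 y0 w h / 4 ^ (S n) in
    if Rle_dec m (J x y u v) then (x, y) else
    if Rle_dec m (J (x + u) y u v) then (x + u, y) else
    if Rle_dec m (J x (y + v) u v) then (x, y + v) else (x + u, y + v)).
  set (P := fix P n := match n with O => (x0, y0) | S k => step k (P k) end).
  assert (D2 : forall n, 0 < 2 ^ n) by (intros; apply pow_lt; lra).
  assert (D4 : forall n, 0 < 4 ^ n) by (intros; apply pow_lt; lra).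
  assert (W : forall n a, a / 2 ^ n = 2 * (a / 2 ^ S n)).
  { intros n a. simpl. field. apply Rgt_not_eq, D2. }
  assert (Wp : forall n a, 0 <= a -> 0 <= a / 2 ^ n).
  { intros n a Ha. apply Rmult_le_pos; [exact Ha |]. left; apply Rinv_0_lt_compat, D2. }
  assert (St : forall n,
     (fst (P n) <= fst (P (S n)) <= fst (P n) + w / 2 ^ S n) /\
     (snd (P n) <= snd (P (S n)) <= snd (P n) + h / 2 ^ S n)).
  { intros n. change (P (S n)) with (step n (P n)). unfold step.
    pose proof (Wp (S n) w Hw). pose proof (Wp (S n) h Hh).
    destruct (P n) as [px py]. cbv beta iota zeta delta [fst snd].
    repeat destruct (Rle_dec _ _); lra. }
  assert (In : forall n, (x0 <= fst (P n) /\ fst (P n) + w / 2 ^ n <= x0 + w) /\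
                         (y0 <= snd (P n) /\ snd (P n) + h / 2 ^ n <= y0 + h)).
  { induction n as [|n IH].
    - simpl. replace (w / 1) with w by field. replace (h / 1) with h by field. lra.
    - pose proof (St n). pose proof (W n w). pose proof (W n h). lra. }
  assert (Bd : forall n, J x0 y0 w h / 4 ^ n <= J (fst (P n)) (snd (P n)) (w / 2 ^ n) (h / 2 ^ n)).
  { induction n as [|n IH].
    - simpl. replace (w / 1) with w by field. replace (h / 1) with h by field. lra.
    - pose proof (Wp (S n) w Hw). pose proof (Wp (S n) h Hh).
      destruct (In n) as [[I1 I2] [I3 I4]].
      rewrite (W n w), (W n h) in IH.
      assert (S4 := Sub (fst (P n)) (snd (P n)) (w / 2 ^ S n) (h / 2 ^ S n)).
      rewrite <- !W in S4. rewrite <- !W in IH.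
      specialize (S4 (Wp (S n) w Hw) (Wp (S n) h Hh) I1 I2 I3 I4).
      assert (M : J x0 y0 w h / 4 ^ n = 4 * (J x0 y0 w h / 4 ^ S n)).
      { simpl. field. apply Rgt_not_eq, D4. }
      change (P (S n)) with (step n (P n)). unfold step.
      destruct (P n) as [px py]. cbv beta iota zeta delta [fst snd] in S4, IH |- *.
      repeat (destruct (Rle_dec _ _) as [|]; [assumption |]). lra. }
  assert (Lim : forall (q : nat -> R) a, 0 <= a ->
     (forall n, q n <= q (S n) <= q n + a / 2 ^ S n) ->
     exists l, forall n, q n <= l <= q n + a / 2 ^ n).
  { intros q a Ha Hq.
    assert (Dec : forall n, q (S n) + a / 2 ^ S n <= q n + a / 2 ^ n).
    { intros n. specialize (Hq n). rewrite (W n a). lra. }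
    assert (B : forall n, q n + a / 2 ^ n <= q O + a).
    { induction n as [|n IH]; [simpl; replace (a / 1) with a by field; lra |].
      specialize (Dec n); lra. }
    destruct (ex_finite_lim_seq_incr q (q O + a)) as [l Hl].
    - intros n; apply Hq.
    - intros n. specialize (B n). pose proof (Wp n a Ha). lra.
    - exists l. intros n. split.
      + apply (is_lim_seq_incr_compare q l Hl). intros k; apply Hq.
      + apply (is_lim_seq_decr_compare (fun k => q k + a / 2 ^ k) l); [| exact Dec].
        replace (Finite l) with (Rbar_plus l 0) by (simpl; f_equal; ring).
        apply (is_lim_seq_plus' q (fun k => a / 2 ^ k) l 0 Hl).
        apply (is_lim_seq_ext (fun k => a * (/ 2) ^ k)).
        * intros k. rewrite pow_inv. reflexivity.
        * replace (Finite 0) with (Rbar_mult a 0) by (simpl; f_equal; ring).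
          apply is_lim_seq_scal_l. apply is_lim_seq_geom. rewrite Rabs_pos_eq; lra. }
  destruct (Lim (fun n => fst (P n)) w Hw) as [xs Hx]; [intros n; apply St |].
  destruct (Lim (fun n => snd (P n)) h Hh) as [ys Hy]; [intros n; apply St |].
  exists xs, ys. intros n. exists (fst (P n)), (snd (P n)).
  specialize (In n); specialize (Bd n); specialize (Hx n); specialize (Hy n). tauto.
Qed.

(** At the limit point of the bisection phi is affine up to o(|z - z0|), and an
    affine function integrates to 0, so the integral over the n-th rectangle is
    o(4^-n), while bisection keeps it of order 4^-n. *)
Lemma goursat (phi : C -> C) (x0 y0 w h : R) :
  0 <= w -> 0 <= h ->
  (forall s t, x0 <= s <= x0 + w -> y0 <= t <= y0 + h -> exists d, cderiv phi (s, t) d) ->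
  rect_int phi x0 y0 w h = 0%C.
Proof.
  intros Hw Hh Df.
  assert (K : forall x y u v, x0 <= x -> x + u <= x0 + w -> y0 <= y -> y + v <= y0 + h ->
     cts_rect phi x y u v).
  { intros x y u v ? ? ? ? s t Hs Ht. destruct (Df s t) as [d Hd]; [lra | lra |].
    apply (cderiv_cts _ _ _ Hd). }
  apply Cmod_eq_0. apply Rle_antisym; [| apply Cmod_ge_0].
  apply Rnot_lt_le. intros Pos.
  set (m := Cmod (rect_int phi x0 y0 w h)) in *.
  destruct (bisection (fun x y u v => Cmod (rect_int phi x y u v)) x0 y0 w h Hw Hh)
    as [xs [ys B]].
  { intros x y u v Hu Hv ? ? ? ?. rewrite rect_int_split; [| assumption | assumption | apply K; lra].
    eapply Rle_trans; [apply Cmod_triangle |]. apply Rplus_le_compat_r.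
    eapply Rle_trans; [apply Cmod_triangle |]. apply Rplus_le_compat_r.
    apply Cmod_triangle. }
  fold m in B.
  set (T := w + h) in *.
  assert (HT : 0 <= T) by (unfold T; lra).
  destruct (Df xs ys) as [d Hd].
  { destruct (B O) as [x [y [? [? [? [? ?]]]]]]; lra. }
  { destruct (B O) as [x [y [? [? [? [? ?]]]]]]; lra. }
  (* Any e with 4 e T^2 < m contradicts the lower bound m / 4^n below. *)
  set (e := m / (8 * (T * T) + 1)).
  assert (He : 0 < e) by (apply Rdiv_lt_0_compat; nra).
  assert (Ee : 4 * e * (T * T) < m).
  { unfold e. apply (Rmult_lt_reg_r (8 * (T * T) + 1)); [nra |].
    replace (4 * (m / (8 * (T * T) + 1)) * (T * T) * (8 * (T * T) + 1)) with (4 * m * (T * T))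
      by (field; nra). nra. }
  assert (L := proj1 (cderiv_eps _ _ _) Hd e He).
  apply locally_Cmod in L. destruct L as [dl [Hdl L]].
  assert (Hn : exists n, T / 2 ^ n < dl).
  { destruct (pow_lt_1_zero (/ 2)) with (y := dl / (T + 1)) as [n Hn].
    - rewrite Rabs_pos_eq; lra.
    - apply Rdiv_lt_0_compat; lra.
    - exists n. specialize (Hn n (Nat.le_refl n)).
      rewrite Rabs_pos_eq in Hn by (apply pow_le; lra).
      rewrite pow_inv in Hn. unfold Rdiv.
      assert (P2 : 0 < / 2 ^ n) by (apply Rinv_0_lt_compat, pow_lt; lra).
      apply (Rmult_lt_compat_r (T + 1)) in Hn; [| lra].
      unfold Rdiv in Hn. rewrite Rmult_assoc, Rinv_l in Hn by lra. nra. }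
  destruct Hn as [n Hn].
  destruct (B n) as [x [y [[I1 I2] [[I3 I4] [I5 [I6 I7]]]]]].
  assert (D2 : 0 < 2 ^ n) by (apply pow_lt; lra).
  set (u := w / 2 ^ n) in *. set (v := h / 2 ^ n) in *.
  assert (Hu : 0 <= u) by (apply Rmult_le_pos; [lra | left; apply Rinv_0_lt_compat, D2]).
  assert (Hv : 0 <= v) by (apply Rmult_le_pos; [lra | left; apply Rinv_0_lt_compat, D2]).
  assert (Euv : T / 2 ^ n = u + v) by (unfold T, u, v; field; lra).
  set (A := fun z => ((phi (xs, ys) - d * (xs, ys)) + d * z)%C).
  set (E := fun z => (phi z - A z)%C).
  assert (KA : cts_rect A x y u v).
  { intros s t _ _. unfold A. apply cts_plus; [apply cts_const |].
    apply cts_mult; [apply cts_const | apply cts_id]. }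
  assert (Kp : cts_rect phi x y u v) by (apply K; assumption).
  assert (KE : cts_rect E x y u v).
  { intros s t Hs Ht. apply cts_minus; [apply Kp | apply KA]; assumption. }
  assert (Q : rect_int phi x y u v = rect_int E x y u v).
  { transitivity (rect_int (fun z => A z + E z)%C x y u v).
    - unfold rect_int, E. f_equal; [| f_equal]; f_equal; apply CInt_ext; try lra; intros; ring.
    - rewrite rect_int_plus by assumption. unfold A at 1. rewrite rect_int_affine. ring. }
  assert (Up : Cmod (rect_int E x y u v) <= 4 * (e * (u + v)) * (u + v)).
  { apply rect_int_le; try assumption. intros s t Hs Ht.
    assert (Ds : Cmod ((s, t) - (xs, ys)) <= u + v).
    { eapply Rle_trans; [apply Cabs_split |]. simpl. apply Rplus_le_compat; apply Rabs_le; lra. }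
    replace (E (s, t)) with (phi (s, t) - phi (xs, ys) - d * ((s, t) - (xs, ys)))%C
      by (unfold E, A; ring).
    eapply Rle_trans; [apply L; lra |]. apply Rmult_le_compat_l; lra. }
  rewrite Q in I7.
  assert (F4 : m / 4 ^ n <= 4 * e * (T * T) / 4 ^ n).
  { eapply Rle_trans; [exact I7 |]. eapply Rle_trans; [exact Up |].
    rewrite <- Euv. right. replace 4 with (2 * 2) at 3 by ring. rewrite Rpow_mult_distr. field. lra. }
  assert (0 < 4 ^ n) by (apply pow_lt; lra).
  apply (Rmult_le_compat_r (4 ^ n)) in F4; [| lra].
  unfold Rdiv in F4. rewrite !Rmult_assoc, Rinv_l, !Rmult_1_r in F4 by lra. lra.
Qed.

(** * Means over the circle *)

Definition Rmean (u : R -> R) : R := / (2 * PI) * RInt u 0 (2 * PI).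

Definition Cmean (g : R -> C) : C :=
  (Rmean (fun t => Re (g t)), Rmean (fun t => Im (g t))).

Definition rcont (u : R -> R) : Prop := forall t, continuous u t.
Definition ccont (g : R -> C) : Prop := forall t, cts g t.

Lemma twoPI_pos : 0 < 2 * PI.
Proof. pose proof PI_RGT_0; lra. Qed.

Lemma rcont_int (u : R -> R) (a b : R) : rcont u -> ex_RInt u a b.
Proof. intros H. apply (ex_RInt_continuous (V := R_CompleteNormedModule)). intros; apply H. Qed.

Lemma ccont_re g : ccont g -> rcont (fun t => Re (g t)).
Proof. intros H t; apply cts_re, H. Qed.

Lemma ccont_im g : ccont g -> rcont (fun t => Im (g t)).
Proof. intros H t; apply cts_im, H. Qed.

Lemma ccont_mod g : ccont g -> rcont (fun t => Cmod (g t)).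
Proof. intros H t; apply continuous_Cmod, H. Qed.

Lemma ccont_cis (k : R) : ccont (fun t => cis (k * t)).
Proof.
  intros t; apply cts_cis, continuous_Rmult; [apply continuous_const | apply continuous_id].
Qed.

Lemma ccont_cis1 : ccont cis.
Proof. intros t; apply (cts_cis (fun t => t)), continuous_id. Qed.

Lemma ccont_const c : ccont (fun _ => c).
Proof. intros t; apply cts_const. Qed.

Lemma ccont_plus f g : ccont f -> ccont g -> ccont (fun t => f t + g t)%C.
Proof. intros Hf Hg t; apply cts_plus; auto. Qed.

Lemma ccont_minus f g : ccont f -> ccont g -> ccont (fun t => f t - g t)%C.
Proof. intros Hf Hg t; apply cts_minus; auto. Qed.

Lemma ccont_mult f g : ccont f -> ccont g -> ccont (fun t => f t * g t)%C.
Proof. intros Hf Hg t; apply cts_mult; auto. Qed.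

Lemma Rmean_ext (u v : R -> R) : (forall t, u t = v t) -> Rmean u = Rmean v.
Proof. intros H. unfold Rmean. f_equal. apply RInt_ext; auto. Qed.

Lemma Rmean_plus (u v : R -> R) :
  rcont u -> rcont v -> Rmean (fun t => u t + v t) = Rmean u + Rmean v.
Proof.
  intros Hu Hv. unfold Rmean. rewrite <- Rmult_plus_distr_l. f_equal.
  apply (RInt_plus u v); apply rcont_int; assumption.
Qed.

Lemma Rmean_scal (c : R) (u : R -> R) :
  rcont u -> Rmean (fun t => c * u t) = c * Rmean u.
Proof.
  intros Hu. unfold Rmean.
  replace (RInt (fun t => c * u t) 0 (2 * PI)) with (c * RInt u 0 (2 * PI)); [ring |].
  symmetry. apply (RInt_scal u 0 (2 * PI) c), rcont_int, Hu.
Qed.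

Lemma Rmean_const (c : R) : Rmean (fun _ => c) = c.
Proof.
  unfold Rmean. rewrite RInt_const. unfold scal; simpl; unfold mult; simpl.
  pose proof twoPI_pos. field. pose proof PI_RGT_0. lra.
Qed.

Lemma Rmean_minus (u v : R -> R) :
  rcont u -> rcont v -> Rmean (fun t => u t - v t) = Rmean u - Rmean v.
Proof.
  intros Hu Hv.
  rewrite (Rmean_ext (fun t => u t - v t) (fun t => u t + (-1) * v t)) by (intros; ring).
  rewrite Rmean_plus, Rmean_scal; auto; [ring |].
  intros t; apply continuous_Rmult; [apply continuous_const | apply Hv].
Qed.

Lemma Rmean_le (u v : R -> R) :
  rcont u -> rcont v -> (forall t, u t <= v t) -> Rmean u <= Rmean v.
Proof.
  intros Hu Hv H. unfold Rmean. apply Rmult_le_compat_l.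
  - left; apply Rinv_0_lt_compat, twoPI_pos.
  - apply RInt_le; auto using rcont_int. left; apply twoPI_pos.
Qed.

Lemma Rmean_ge0 (u : R -> R) : rcont u -> (forall t, 0 <= u t) -> 0 <= Rmean u.
Proof.
  intros Hu H. rewrite <- (Rmean_const 0). apply Rmean_le; auto.
  intros t; apply continuous_const.
Qed.

Lemma Rmean_shift (u : R -> R) (a : R) :
  rcont u -> (forall t, u (t + 2 * PI) = u t) -> Rmean (fun t => u (t + a)) = Rmean u.
Proof.
  intros Hu Per. unfold Rmean. f_equal.
  assert (S1 : forall v p q, RInt (fun t => u (t + v)) p q = RInt u (p + v) (q + v)).
  { intros v p q.
    rewrite <- (Rmult_1_l p) at 2. rewrite <- (Rmult_1_l q) at 2.
    rewrite <- (RInt_comp_lin u 1 v p q) by (apply rcont_int, Hu).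
    apply RInt_ext. intros t _. unfold scal; simpl; unfold mult; simpl.
    rewrite !Rmult_1_l; reflexivity. }
  rewrite S1. rewrite Rplus_0_l.
  assert (E : RInt u (2 * PI) (2 * PI + a) = RInt u 0 a).
  { rewrite <- (Rplus_0_l (2 * PI)) at 1. rewrite (Rplus_comm (2 * PI) a), <- S1.
    apply RInt_ext. intros; apply Per. }
  rewrite <- (RInt_Chasles u a 0 (2 * PI + a)) by (apply rcont_int, Hu).
  rewrite <- (RInt_Chasles u 0 (2 * PI) (2 * PI + a)) by (apply rcont_int, Hu).
  rewrite E. rewrite <- (opp_RInt_swap u 0 a) by (apply rcont_int, Hu).
  unfold plus, opp; simpl. ring.
Qed.

(** A rotation moves a point of positivity to pi, the midpoint of the interval
    of integration. *)
Lemma Rmean_zero (u : R -> R) :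
  rcont u -> (forall t, u (t + 2 * PI) = u t) -> (forall t, 0 <= u t) ->
  Rmean u <= 0 -> forall t, u t = 0.
Proof.
  intros Hu Per Pos H t0. pose proof PI_RGT_0.
  destruct (Rle_lt_or_eq_dec 0 (u t0) (Pos t0)) as [P|]; [exfalso | auto].
  rewrite <- (Rmean_shift u (t0 - PI) Hu Per) in H.
  set (v := fun t => u (t + (t0 - PI))) in *.
  assert (Hv : rcont v).
  { intros t. apply (continuous_comp (fun t => t + (t0 - PI)) u); [| apply Hu].
    apply continuous_Rplus; [apply continuous_id | apply continuous_const]. }
  assert (VP : v PI = u t0) by (unfold v; f_equal; ring).
  assert (L := Hv PI (fun y => u t0 / 2 < y)). 
  destruct L as [d Hd].
  { exists (mkposreal (u t0 / 2) (ltac:(lra))). intros y Hy.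
    change (Rabs (y - v PI) < u t0 / 2) in Hy. apply Rabs_def2 in Hy. lra. }
  set (e := Rmin (d / 2) (PI / 2)).
  assert (He : 0 < e) by (apply Rmin_pos; [destruct d; simpl; lra | lra]).
  assert (He1 : e <= d / 2) by apply Rmin_l.
  assert (He2 : e <= PI / 2) by apply Rmin_r.
  assert (I : forall p q, p <= q -> 0 <= RInt v p q).
  { intros p q Hpq. apply RInt_ge_0; auto using rcont_int. intros; apply Pos. }
  unfold Rmean in H.
  rewrite <- (RInt_Chasles v 0 (PI - e) (2 * PI)) in H by (apply rcont_int, Hv).
  rewrite <- (RInt_Chasles v (PI - e) (PI + e) (2 * PI)) in H by (apply rcont_int, Hv).
  assert (I1 := I 0 (PI - e) (ltac:(lra))).
  assert (I2 := I (PI + e) (2 * PI) (ltac:(lra))).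
  assert (I3 : RInt (fun _ => u t0 / 2) (PI - e) (PI + e) <= RInt v (PI - e) (PI + e)).
  { apply RInt_le; [lra | apply ex_RInt_const | apply rcont_int, Hv |].
    intros x Hx. left. apply Hd. change (Rabs (x - PI) < d).
    apply Rabs_def1; lra. }
  rewrite RInt_const in I3. unfold scal in I3; simpl in I3; unfold mult in I3; simpl in I3.
  unfold plus in H; simpl in H.
  assert (0 < / (2 * PI)) by (apply Rinv_0_lt_compat; lra).
  assert (0 < e * u t0) by (apply Rmult_lt_0_compat; lra).
  nra.
Qed.

Lemma Cmean_ext (f g : R -> C) : (forall t, f t = g t) -> Cmean f = Cmean g.
Proof. intros H. unfold Cmean. f_equal; apply Rmean_ext; intros; rewrite H; reflexivity. Qed.

Lemma Cmean_plus (f g : R -> C) :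
  ccont f -> ccont g -> Cmean (fun t => f t + g t)%C = (Cmean f + Cmean g)%C.
Proof.
  intros Hf Hg. apply C_ext; simpl.
  - apply (Rmean_plus (fun t => Re (f t)) (fun t => Re (g t))); apply ccont_re; assumption.
  - apply (Rmean_plus (fun t => Im (f t)) (fun t => Im (g t))); apply ccont_im; assumption.
Qed.

Lemma Cmean_scal (c : C) (f : R -> C) :
  ccont f -> Cmean (fun t => c * f t)%C = (c * Cmean f)%C.
Proof.
  intros Hf. pose proof (ccont_re _ Hf) as Hr. pose proof (ccont_im _ Hf) as Hi.
  destruct c as [a b].
  assert (S : forall k u, rcont u -> rcont (fun t => k * u t)).
  { intros k u Hu t; apply continuous_Rmult; [apply continuous_const | apply Hu]. }
  apply C_ext; simpl.
  - rewrite <- !Rmean_scal by assumption.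
    rewrite <- (Rmean_minus (fun t => a * Re (f t)) (fun t => b * Im (f t))) by auto.
    reflexivity.
  - rewrite <- !Rmean_scal by assumption.
    rewrite <- (Rmean_plus (fun t => a * Im (f t)) (fun t => b * Re (f t))) by auto.
    reflexivity.
Qed.

Lemma Cmean_minus (f g : R -> C) :
  ccont f -> ccont g -> Cmean (fun t => f t - g t)%C = (Cmean f - Cmean g)%C.
Proof.
  intros Hf Hg.
  rewrite (Cmean_ext (fun t => f t - g t)%C (fun t => f t + (- (1)) * g t)%C) by (intros; ring).
  rewrite Cmean_plus; [| exact Hf | apply ccont_mult; [apply ccont_const | exact Hg]].
  rewrite Cmean_scal by exact Hg. ring.
Qed.

Lemma Cmean_const (c : C) : Cmean (fun _ => c) = c.
Proof. apply C_ext; simpl; apply Rmean_const. Qed.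

Lemma Cmean_conj (f : R -> C) :
  ccont f -> Cmean (fun t => Cconj (f t)) = Cconj (Cmean f).
Proof.
  intros Hf. pose proof (ccont_im _ Hf) as Hi. apply C_ext; simpl; [reflexivity |].
  replace (- Rmean (fun t => Im (f t))) with ((-1) * Rmean (fun t => Im (f t))) by ring.
  rewrite <- Rmean_scal by assumption. apply Rmean_ext; intros t.
  change (- Im (f t) = -1 * Im (f t)). ring.
Qed.

Lemma Cmean_re (f : R -> C) : Re (Cmean f) = Rmean (fun t => Re (f t)).
Proof. reflexivity. Qed.

(** Rotating the mean onto the positive axis reduces this to real parts. *)
Lemma Cmean_mod_le (f : R -> C) : ccont f -> Cmod (Cmean f) <= Rmean (fun t => Cmod (f t)).
Proof.
  intros Hf. destruct (polar (Cmean f)) as [t0 E].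
  assert (K : ccont (fun t => cis (- t0) * f t)%C)
    by (apply ccont_mult; [apply ccont_const | exact Hf]).
  assert (Q : Cmod (Cmean f) = Re (Cmean (fun t => cis (- t0) * f t)%C)).
  { rewrite Cmean_scal by exact Hf. rewrite E at 2.
    replace (cis (- t0) * (Cmod (Cmean f) * cis t0))%C
      with (Cmod (Cmean f) * (cis t0 * cis (- t0)))%C by ring.
    rewrite cis_mult_opp. simpl. ring. }
  rewrite Q, Cmean_re. apply Rmean_le.
  - apply (ccont_re _ K).
  - apply ccont_mod, Hf.
  - intros t. eapply Rle_trans; [apply Rle_abs |]. eapply Rle_trans; [apply re_le_Cmod |].
    rewrite Cmod_mult, cis_mod. lra.
Qed.

(** ** Dependence on the radius *)

Lemma Rmean_param (G : R -> R -> R) (r0 : R) :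
  (forall t, continuous (fun p : R * R => G (fst p) (snd p)) (r0, t)) ->
  (exists d, 0 < d /\ forall r, Rabs (r - r0) < d -> rcont (G r)) ->
  continuous (fun r => Rmean (G r)) r0.
Proof.
  intros H [d [Hd K]]. pose proof twoPI_pos.
  apply (continuous_Rmult (fun _ => / (2 * PI)) (fun r => RInt (G r) 0 (2 * PI)));
    [apply continuous_const |].
  apply continuity_pt_filterlim. intros e He.
  destruct (uniform_continuity_2d_1d' G 0 (2 * PI) r0) with (eps := mkposreal (e / (2 * (2 * PI))) (ltac:(apply Rdiv_lt_0_compat; lra))) as [dl Hdl].
  { intros x _. apply continuity_2d_pt_filterlim. apply H. }
  exists (Rmin d dl). split; [apply Rmin_pos; [exact Hd | apply cond_pos] |].
  intros r [_ Hr]. simpl in Hr. unfold R_dist in *.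
  assert (Hr1 : Rabs (r - r0) < d) by (eapply Rlt_le_trans; [exact Hr | apply Rmin_l]).
  assert (Hr2 : Rabs (r - r0) < dl) by (eapply Rlt_le_trans; [exact Hr | apply Rmin_r]).
  simpl. unfold R_dist.
  assert (C1 := K r Hr1). assert (C0 : rcont (G r0)).
  { apply K. rewrite Rminus_diag, Rabs_R0; exact Hd. }
  replace (RInt (G r) 0 (2 * PI) - RInt (G r0) 0 (2 * PI))
    with (RInt (fun t => G r t - G r0 t) 0 (2 * PI))
    by (apply (RInt_minus (G r) (G r0)); apply rcont_int; assumption).
  apply Rle_lt_trans with (e / (2 * (2 * PI)) * (2 * PI - 0)).
  - apply RInt_abs_le; [lra | |].
    + apply rcont_int. intros t; apply continuous_Rminus; [apply C1 | apply C0].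
    + intros t Ht. left. apply Hdl; try lra.
      * pose proof (cond_pos dl). lra.
      * apply Rabs_def2 in Hr2. lra.
      * rewrite Rminus_diag, Rabs_R0. apply cond_pos.
  - replace (e / (2 * (2 * PI)) * (2 * PI - 0)) with (e / 2) by (field; pose proof PI_RGT_0; lra). lra.
Qed.

Lemma cts_polar (F : C -> C) (r t : R) :
  cts (U := C_UniformSpace) F (RtoC r * cis t)%C ->
  cts (fun p : R * R => F (RtoC (fst p) * cis (snd p))%C) (r, t).
Proof.
  intros H. apply (cts_comp (V := C_UniformSpace) (fun p : R * R => RtoC (fst p) * cis (snd p))%C F).
  - apply cts_mult; [apply cts_RtoC; apply (@continuous_fst R_UniformSpace R_UniformSpace) |].
    apply cts_cis. apply (@continuous_snd R_UniformSpace R_UniformSpace).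
  - exact H.
Qed.

Lemma ccont_circle (F : C -> C) (r : R) :
  (forall z, Cmod z = Rabs r -> cts (U := C_UniformSpace) F z) ->
  ccont (fun t => F (RtoC r * cis t)%C).
Proof.
  intros H t. apply (cts_comp (V := C_UniformSpace) (fun t => RtoC r * cis t)%C F).
  - apply cts_mult; [apply cts_const | apply ccont_cis1].
  - apply H. rewrite Cmod_mult, cis_mod, Cmod_R. ring.
Qed.

(** A continuous functional of the values on a circle has a mean continuous in
    the radius; used with real parts, imaginary parts and powers of moduli. *)
Lemma circle_param (h : C -> R) (rho r0 : R) :
  Rabs r0 < rho ->
  (forall z, Cmod z < rho -> continuous (h : C_UniformSpace -> R) z) ->
  continuous (fun r => Rmean (fun t => h (RtoC r * cis t)%C)) r0.
Proof.
  intros Hr Hh. apply Rmean_param.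
  - intros t. apply (continuous_compC (fun p : R * R => RtoC (fst p) * cis (snd p))%C h).
    + apply (cts_polar (fun z => z)). apply cts_id.
    + apply Hh. simpl fst; simpl snd. rewrite Cmod_mult, cis_mod, Cmod_R. lra.
  - exists (rho - Rabs r0). split; [lra |]. intros r Hr' t.
    apply (continuous_compC (fun t => RtoC r * cis t)%C h).
    + apply cts_mult; [apply cts_const | apply ccont_cis1].
    + apply Hh. rewrite Cmod_mult, cis_mod, Cmod_R.
      assert (Rabs r <= Rabs (r - r0) + Rabs r0).
      { replace r with ((r - r0) + r0) at 1 by ring. apply Rabs_triang. }
      lra.
Qed.

(** * The mean value property *)

(** Goursat's theorem in the coordinate log z: the vertical sides of the
    rectangle [ln r1, ln r2] x [0, 2 pi] become the two circles, and its
    horizontal sides cancel by periodicity. *)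
Lemma circle_const (F : C -> C) (r1 r2 : R) :
  0 < r1 -> r1 <= r2 ->
  (forall z, r1 <= Cmod z <= r2 -> exists d, cderiv F z d) ->
  Cmean (fun t => F (RtoC r1 * cis t)%C) = Cmean (fun t => F (RtoC r2 * cis t)%C).
Proof.
  intros H1 H2 Df.
  assert (Hln : ln r1 <= ln r2).
  { destruct (Rle_lt_or_eq_dec _ _ H2) as [L | ->]; [left; apply ln_increasing; lra | lra]. }
  pose proof twoPI_pos.
  assert (G := goursat (fun z => F (Cexp z)) (ln r1) 0 (ln r2 - ln r1) (2 * PI)).
  assert (E : rect_int (fun z => F (Cexp z)) (ln r1) 0 (ln r2 - ln r1) (2 * PI) = 0%C).
  { apply G; [lra | lra |]. intros s t Hs Ht.
    destruct (Df (Cexp (s, t))) as [d Hd].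
    - rewrite Cexp_mod. simpl. rewrite <- (exp_ln r1) at 1 by lra.
      rewrite <- (exp_ln r2) by lra.
      split; [destruct (Req_dec (ln r1) s) as [->|]; [lra | left; apply exp_increasing; lra] |].
      destruct (Req_dec s (ln r2)) as [->|]; [lra | left; apply exp_increasing; lra].
    - exists (d * Cexp (s, t))%C. apply cderiv_comp; [exact Hd | apply cderiv_Cexp]. }
  clear G. unfold rect_int in E.
  assert (P : CInt (fun t => F (Cexp (t, (0 + 2 * PI)%R))) (ln r1) (ln r1 + (ln r2 - ln r1)) =
              CInt (fun t => F (Cexp (t, 0))) (ln r1) (ln r1 + (ln r2 - ln r1))).
  { apply CInt_ext; [lra |]. intros t _. f_equal. unfold Cexp; simpl. rewrite cis_2PI. reflexivity. }
  rewrite P in E. clear P.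
  assert (V : forall r, 0 < r -> CInt (fun t => F (Cexp (ln r, t))) 0 (2 * PI) =
     CInt (fun t => F (RtoC r * cis t)%C) 0 (2 * PI)).
  { intros r Hr. apply CInt_ext; [lra |]. intros t _. f_equal. unfold Cexp; simpl.
    rewrite exp_ln by exact Hr. reflexivity. }
  replace (ln r1 + (ln r2 - ln r1)) with (ln r2) in E by ring.
  rewrite Rplus_0_l in E. rewrite !V in E by lra.
  assert (Q : CInt (fun t => F (RtoC r1 * cis t)%C) 0 (2 * PI) =
              CInt (fun t => F (RtoC r2 * cis t)%C) 0 (2 * PI)).
  { set (A := CInt (fun t => F (RtoC r1 * cis t)%C) 0 (2 * PI)) in *.
    set (B := CInt (fun t => F (RtoC r2 * cis t)%C) 0 (2 * PI)) in *.
    assert (Z : (Ci * (B - A) = 0)%C).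
    { rewrite <- E. ring. }
    assert (Z2 : (B - A = 0)%C).
    { replace (B - A)%C with (- Ci * (Ci * (B - A)))%C.
      - rewrite Z. ring.
      - replace (- Ci * (Ci * (B - A)))%C with (- (Ci * Ci) * (B - A))%C by ring.
        replace (Ci * Ci)%C with (- (1))%C by (apply C_ext; simpl; ring). ring. }
    replace B with ((B - A) + A)%C by ring. rewrite Z2. ring. }
  apply (f_equal (fun z => (RtoC (/ (2 * PI)) * z)%C)) in Q.
  unfold CInt in Q. unfold Cmean, Rmean.
  apply C_ext.
  - apply (f_equal Re) in Q. simpl in Q. simpl. rewrite !Rmult_0_l, !Rminus_0_r in Q. exact Q.
  - apply (f_equal Im) in Q. simpl in Q. simpl. rewrite !Rmult_0_l, !Rplus_0_r in Q. exact Q.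
Qed.

Lemma cont_adherent (m : R -> R) (a c : R) :
  continuous m a -> (forall d, 0 < d -> exists x, Rabs (x - a) < d /\ m x = c) -> m a = c.
Proof.
  intros H K. destruct (Req_dec (m a) c) as [|N]; [assumption | exfalso].
  assert (P : 0 < Rabs (m a - c)) by (apply Rabs_pos_lt; lra).
  destruct (H (fun y => Rabs (y - m a) < Rabs (m a - c))) as [d Hd].
  { exists (mkposreal _ P). intros y Hy; exact Hy. }
  destruct (K d (cond_pos d)) as [x [Hx E]].
  specialize (Hd x Hx). rewrite E, (Rabs_minus_sym c (m a)) in Hd. lra.
Qed.

(** The circles of radius 0 and s0 are the exceptional ones: m is constant off
    them and continuous across them. *)
Lemma mvp_comp (m : R -> R) (R0 s0 : R) :
  0 <= s0 ->
  (forall r, 0 <= r < R0 -> continuous m r) ->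
  (forall a b, 0 < a -> a <= b -> b < R0 -> ~ (a <= s0 <= b) -> m a = m b) ->
  forall r, 0 <= r < R0 -> m r = m 0.
Proof.
  intros Hs Hc Hm.
  assert (A : forall a b, 0 <= a -> a < b -> b < R0 -> ~ (a < s0 <= b) -> m a = m b).
  { intros a b Ha Hab Hb N. apply cont_adherent; [apply Hc; lra |].
    intros d Hd. exists (Rmin (a + d / 2) b).
    assert (a < Rmin (a + d / 2) b) by (apply Rmin_glb_lt; lra).
    pose proof (Rmin_l (a + d / 2) b). pose proof (Rmin_r (a + d / 2) b).
    split; [apply Rabs_def1; lra |]. apply Hm; lra. }
  assert (B : forall a b, 0 < a -> a < b -> b < R0 -> ~ (a <= s0 < b) -> m a = m b).
  { intros a b Ha Hab Hb N. symmetry. apply cont_adherent; [apply Hc; lra |].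
    intros d Hd. exists (Rmax (b - d / 2) a).
    assert (Rmax (b - d / 2) a < b) by (apply Rmax_lub_lt; lra).
    pose proof (Rmax_l (b - d / 2) a). pose proof (Rmax_r (b - d / 2) a).
    split; [apply Rabs_def1; lra |]. symmetry; apply Hm; lra. }
  assert (L : forall r, 0 <= r -> r < R0 -> r <= s0 -> m r = m 0).
  { intros r H0 H1 H2. destruct (Req_dec r 0) as [->|N]; [reflexivity |].
    transitivity (m (r / 2)).
    - symmetry; apply B; lra.
    - symmetry; apply A; lra. }
  intros r [H0 H1]. destruct (Rle_lt_dec r s0) as [D|D]; [apply L; assumption |].
  transitivity (m s0); [symmetry; apply A; lra | apply L; lra].
Qed.

(** The mean over circles is constant on annuli of differentiability; being
    continuous in the radius it does not change across an exceptional circle,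
    so F may be merely continuous at a point. *)
Lemma mean_value (F : C -> C) (rho s0 r : R) :
  0 <= s0 -> 0 <= r < rho ->
  (forall z, Cmod z < rho -> cts (U := C_UniformSpace) F z) ->
  (forall z, Cmod z < rho -> z <> 0%C -> Cmod z <> s0 -> exists d, cderiv F z d) ->
  Cmean (fun t => F (RtoC r * cis t)%C) = F 0%C.
Proof.
  intros Hs Hr Kc Kd.
  assert (Z : Cmean (fun t => F (RtoC 0 * cis t)%C) = F 0%C).
  { rewrite <- (Cmean_const (F 0%C)). apply Cmean_ext. intros t. f_equal. ring. }
  rewrite <- Z.
  assert (Q : forall a b, 0 < a -> a <= b -> b < rho -> ~ (a <= s0 <= b) ->
    Cmean (fun t => F (RtoC a * cis t)%C) = Cmean (fun t => F (RtoC b * cis t)%C)).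
  { intros a b Ha Hab Hb N. apply circle_const; [assumption | assumption |].
    intros z Hz. apply Kd; [lra | | lra].
    intros E. rewrite E, Cmod_0 in Hz. lra. }
  apply C_ext.
  - apply (mvp_comp (fun r => Rmean (fun t => Re (F (RtoC r * cis t)%C))) rho s0 Hs).
    + intros x Hx. apply (circle_param (fun z => Re (F z)) rho x).
      * rewrite Rabs_pos_eq; lra.
      * intros z Hz. apply (cts_re (U := C_UniformSpace) F), Kc, Hz.
    + intros a b Ha Hab Hb N. apply (f_equal Re (Q a b Ha Hab Hb N)).
    + exact Hr.
  - apply (mvp_comp (fun r => Rmean (fun t => Im (F (RtoC r * cis t)%C))) rho s0 Hs).
    + intros x Hx. apply (circle_param (fun z => Im (F z)) rho x).
      * rewrite Rabs_pos_eq; lra.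
      * intros z Hz. apply (cts_im (U := C_UniformSpace) F), Kc, Hz.
    + intros a b Ha Hab Hb N. apply (f_equal Im (Q a b Ha Hab Hb N)).
    + exact Hr.
Qed.

Lemma analytic_cts (F : C -> C) (rho : R) (z : C) :
  analytic rho F -> Cmod z < rho -> cts (U := C_UniformSpace) F z.
Proof. intros H K. destruct (H z K) as [d Hd]. apply (cderiv_cts _ _ _ Hd). Qed.

Lemma mean_value_unit (F : C -> C) (rho : R) :
  1 < rho -> analytic rho F -> Cmean (fun t => F (cis t)) = F 0%C.
Proof.
  intros Hr HF. rewrite <- (mean_value F rho 0 1).
  - apply Cmean_ext. intros t. f_equal. ring.
  - lra.
  - lra.
  - intros z Hz. apply (analytic_cts F rho); assumption.
  - intros z Hz _ _. apply HF, Hz.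
Qed.

Lemma analytic_plus F G rho : analytic rho F -> analytic rho G ->
  analytic rho (fun z => F z + G z)%C.
Proof.
  intros HF HG z Hz. destruct (HF z Hz) as [a Ha], (HG z Hz) as [b Hb].
  eexists. apply cderiv_plus; eassumption.
Qed.

Lemma analytic_mult F G rho : analytic rho F -> analytic rho G ->
  analytic rho (fun z => F z * G z)%C.
Proof.
  intros HF HG z Hz. destruct (HF z Hz) as [a Ha], (HG z Hz) as [b Hb].
  eexists. apply cderiv_mult; eassumption.
Qed.

Lemma analytic_const c rho : analytic rho (fun _ => c).
Proof. intros z Hz. eexists; apply cderiv_const. Qed.

Lemma analytic_id rho : analytic rho (fun z => z).
Proof. intros z Hz. eexists; apply cderiv_id. Qed.

Lemma analytic_pow n rho : analytic rho (fun z => Cpow z n).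
Proof. intros z Hz. eexists; apply cderiv_pow. Qed.

Lemma analytic_Cexp F rho : analytic rho F -> analytic rho (fun z => Cexp (F z)).
Proof.
  intros HF z Hz. destruct (HF z Hz) as [a Ha].
  eexists. apply (cderiv_comp Cexp F); [apply cderiv_Cexp | eassumption].
Qed.

Lemma analytic_scale F (c : C) rho sigma :
  (forall z, Cmod z < sigma -> Cmod (c * z) < rho) -> analytic rho F ->
  analytic sigma (fun z => F (c * z)%C).
Proof.
  intros K HF z Hz. destruct (HF (c * z)%C (K z Hz)) as [a Ha].
  eexists. apply (cderiv_comp F (fun z => c * z)%C); [eassumption |].
  apply cderiv_scal, cderiv_id.
Qed.

Lemma analytic_dilate F (r : R) rho : 0 < r -> analytic rho F ->
  analytic (rho / r) (fun z => F (RtoC r * z)%C).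
Proof.
  intros Hr. apply analytic_scale. intros z Hz.
  rewrite Cmod_mult, Cmod_R, Rabs_pos_eq by lra.
  apply (Rmult_lt_compat_l r) in Hz; [| lra].
  replace (r * (rho / r)) with rho in Hz by (field; lra). exact Hz.
Qed.

Lemma analytic_ccont (F : C -> C) (rho : R) :
  1 < rho -> analytic rho F -> ccont (fun t => F (cis t)).
Proof.
  intros Hr HF t. apply (cts_comp (V := C_UniformSpace) cis F); [apply ccont_cis1 |].
  apply (analytic_cts F rho); [exact HF | rewrite cis_mod; exact Hr].
Qed.

(** * Fourier and Taylor coefficients *)

Definition fcoef (g : R -> C) (k : Z) : C := Cmean (fun t => g t * cis (- IZR k * t))%C.

Definition coef (F : C -> C) (k : Z) : C := fcoef (fun t => F (cis t)) k.

Lemma fcoef_ext f g k : (forall t, f t = g t) -> fcoef f k = fcoef g k.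
Proof. intros H. apply Cmean_ext. intros; rewrite H; reflexivity. Qed.

Lemma coef_ext F G k : (forall z, Cmod z = 1 -> F z = G z) -> coef F k = coef G k.
Proof. intros H. apply fcoef_ext. intros; apply H, cis_mod. Qed.

Lemma ccont_mul_cis g (k : R) : ccont g -> ccont (fun t => g t * cis (k * t))%C.
Proof. intros H; apply ccont_mult; [exact H | apply ccont_cis]. Qed.

Lemma fcoef_plus f g k : ccont f -> ccont g ->
  fcoef (fun t => f t + g t)%C k = (fcoef f k + fcoef g k)%C.
Proof.
  intros Hf Hg. unfold fcoef. rewrite <- Cmean_plus by (apply ccont_mul_cis; assumption).
  apply Cmean_ext; intros; ring.
Qed.

Lemma fcoef_scal c g k : ccont g -> fcoef (fun t => c * g t)%C k = (c * fcoef g k)%C.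
Proof.
  intros Hg. unfold fcoef. rewrite <- Cmean_scal by (apply ccont_mul_cis; assumption).
  apply Cmean_ext; intros; ring.
Qed.

Lemma fcoef_minus f g k : ccont f -> ccont g ->
  fcoef (fun t => f t - g t)%C k = (fcoef f k - fcoef g k)%C.
Proof.
  intros Hf Hg. unfold fcoef. rewrite <- Cmean_minus by (apply ccont_mul_cis; assumption).
  apply Cmean_ext; intros; ring.
Qed.

Lemma fcoef_mod_le g k : ccont g -> Cmod (fcoef g k) <= Rmean (fun t => Cmod (g t)).
Proof.
  intros Hg. unfold fcoef.
  eapply Rle_trans; [apply Cmean_mod_le, ccont_mul_cis, Hg |].
  right. apply Rmean_ext. intros t. rewrite Cmod_mult, cis_mod. ring.
Qed.

Lemma fcoef_shift g (j k : Z) :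
  fcoef (fun t => cis (IZR j * t) * g t)%C k = fcoef g (k - j).
Proof.
  apply Cmean_ext. intros t. rewrite minus_IZR.
  replace (- (IZR k - IZR j) * t) with (IZR j * t + - IZR k * t) by ring.
  rewrite cis_plus. ring.
Qed.

Lemma Cmean_cis (k : Z) : k <> 0%Z -> Cmean (fun t => cis (IZR k * t)) = 0%C.
Proof.
  intros Hk. assert (Hk' : IZR k <> 0) by (intros E; apply Hk, eq_IZR, E).
  pose proof (f_equal Re (cis_Z k)) as Pc. pose proof (f_equal Im (cis_Z k)) as Ps.
  simpl in Pc, Ps.
  apply C_ext; simpl; unfold Rmean.
  - replace (RInt (fun t => cos (IZR k * t)) 0 (2 * PI)) with 0; [ring |].
    symmetry. apply is_RInt_unique.
    replace 0 with (minus ((fun t => sin (IZR k * t) / IZR k) (2 * PI))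
                          ((fun t => sin (IZR k * t) / IZR k) 0)) at 2.
    + apply (is_RInt_derive (fun t => sin (IZR k * t) / IZR k)).
      * intros x _. auto_derive; [trivial | field; exact Hk'].
      * intros x _. apply (continuous_Rfun cos); [| apply continuity_cos].
        apply continuous_Rmult; [apply continuous_const | apply continuous_id].
    + unfold minus, plus, opp; simpl. rewrite Ps, Rmult_0_r, sin_0. field; exact Hk'.
  - replace (RInt (fun t => sin (IZR k * t)) 0 (2 * PI)) with 0; [ring |].
    symmetry. apply is_RInt_unique.
    replace 0 with (minus ((fun t => - cos (IZR k * t) / IZR k) (2 * PI))
                          ((fun t => - cos (IZR k * t) / IZR k) 0)) at 2.
    + apply (is_RInt_derive (fun t => - cos (IZR k * t) / IZR k)).
      * intros x _. auto_derive; [trivial | field; exact Hk'].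
      * intros x _. apply (continuous_Rfun sin); [| apply continuity_sin].
        apply continuous_Rmult; [apply continuous_const | apply continuous_id].
    + unfold minus, plus, opp; simpl. rewrite Pc, Rmult_0_r, cos_0. field; exact Hk'.
Qed.

Lemma fcoef_cis (j k : Z) :
  fcoef (fun t => cis (IZR j * t)) k = if Z.eq_dec j k then 1%C else 0%C.
Proof.
  unfold fcoef.
  rewrite (Cmean_ext _ (fun t => cis (IZR (j - k) * t))).
  - destruct (Z.eq_dec j k) as [->|N].
    + rewrite (Cmean_ext _ (fun _ => 1%C)); [apply Cmean_const |].
      intros t. rewrite Z.sub_diag, Rmult_0_l. apply cis_0.
    + apply Cmean_cis. lia.
  - intros t. rewrite <- cis_plus. f_equal. rewrite minus_IZR. ring.
Qed.

Lemma coef_0 F rho : 1 < rho -> analytic rho F -> coef F 0 = F 0%C.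
Proof.
  intros Hr HF. rewrite <- (mean_value_unit F rho Hr HF).
  apply Cmean_ext. intros t. replace (- 0 * t) with 0 by ring. rewrite cis_0. ring.
Qed.

(** This is where analyticity enters: F z^n vanishes at the origin for n > 0. *)
Lemma coef_neg F rho k : 1 < rho -> analytic rho F -> (k < 0)%Z -> coef F k = 0%C.
Proof.
  intros Hr HF Hk.
  set (n := Z.to_nat (- k)).
  assert (En : IZR (- k) = INR n) by (unfold n; rewrite INR_IZR_INZ, Z2Nat.id by lia; reflexivity).
  transitivity (Cmean (fun t => (fun z => F z * Cpow z n)%C (cis t))).
  - apply Cmean_ext. intros t. simpl. rewrite cis_pow, <- En, opp_IZR. reflexivity.
  - rewrite (mean_value_unit (fun z => F z * Cpow z n)%C rho Hr).
    + destruct n as [|n'] eqn:E; [lia |]. simpl. ring.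
    + apply analytic_mult; [exact HF | apply analytic_pow].
Qed.

Lemma Cpow_neq_0 (z : C) n : z <> 0%C -> Cpow z n <> 0%C.
Proof.
  intros H. induction n; simpl.
  - intros E. apply RtoC_inj in E. lra.
  - apply Cmult_neq_0; assumption.
Qed.

Lemma cis_opp_pow (n : nat) (t : R) : cis (- IZR (Z.of_nat n) * t) = (/ Cpow (cis t) n)%C.
Proof.
  rewrite cis_pow, cis_inv. f_equal. rewrite <- INR_IZR_INZ. ring.
Qed.

Lemma RtoC_pow (r : R) n : Cpow (RtoC r) n = RtoC (r ^ n).
Proof. induction n; simpl; [reflexivity |]. rewrite IHn, RtoC_mult. reflexivity. Qed.

Lemma Cpow_mult_l (a b : C) n : Cpow (a * b) n = (Cpow a n * Cpow b n)%C.
Proof. induction n; simpl; [ring |]. rewrite IHn. ring. Qed.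

(** F / z^n is analytic off the origin, so its mean does not depend on the radius. *)
Lemma coef_dilate F rho (r : R) (n : nat) :
  1 < rho -> 0 < r < rho -> analytic rho F ->
  coef (fun z => F (RtoC r * z)%C) (Z.of_nat n) = (RtoC (r ^ n) * coef F (Z.of_nat n))%C.
Proof.
  intros Hr Hr1 HF.
  set (Q := fun z => (F z * / Cpow z n)%C).
  assert (DQ : forall z, 0 < Cmod z < rho -> exists d, cderiv Q z d).
  { intros z [H1 H2]. destruct (HF z H2) as [a Ha].
    eexists. apply cderiv_mult; [exact Ha |]. apply cderiv_inv; [apply cderiv_pow |].
    apply Cpow_neq_0. apply Cmod_gt_0, H1. }
  assert (E : Cmean (fun t => Q (RtoC r * cis t)%C) = Cmean (fun t => Q (RtoC 1 * cis t)%C)).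
  { destruct (Rle_lt_dec r 1).
    - apply circle_const; [lra | lra |]. intros z Hz. apply DQ; lra.
    - symmetry. apply circle_const; [lra | lra |]. intros z Hz. apply DQ; lra. }
  assert (Hrn : 0 < r ^ n) by (apply pow_lt; lra).
  assert (Hrn' : RtoC (r ^ n) <> 0%C) by (intros K; apply RtoC_inj in K; lra).
  transitivity (Cmean (fun t => RtoC (r ^ n) * Q (RtoC r * cis t))%C).
  - apply Cmean_ext. intros t. unfold Q. rewrite cis_opp_pow, Cpow_mult_l, RtoC_pow.
    field. split; [apply Cpow_neq_0, cis_neq_0 | exact Hrn'].
  - rewrite Cmean_scal.
    + f_equal. rewrite E. apply Cmean_ext. intros t. unfold Q.
      rewrite cis_opp_pow. rewrite !Cmult_1_l. reflexivity.
    + apply ccont_circle. intros z Hz. destruct (DQ z) as [d Hd].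
      * rewrite Hz, Rabs_pos_eq; lra.
      * apply (cderiv_cts _ _ _ Hd).
Qed.

Fixpoint csum (a : nat -> C) (n : nat) : C :=
  match n with O => 0%C | S k => (csum a k + a k)%C end.

Lemma csum_ext (a b : nat -> C) n : (forall k, (k < n)%nat -> a k = b k) -> csum a n = csum b n.
Proof.
  induction n as [|n IH]; intros H; simpl; [reflexivity |].
  rewrite IH, H by (intros; try apply H; lia). reflexivity.
Qed.

Lemma csum_scal c (a : nat -> C) n : csum (fun k => c * a k)%C n = (c * csum a n)%C.
Proof. induction n as [|n IH]; simpl; [ring | rewrite IH; ring]. Qed.

Lemma ccont_csum (a : nat -> R -> C) n :
  (forall k, ccont (a k)) -> ccont (fun t => csum (fun k => a k t) n).
Proof.
  intros H. induction n as [|n IH]; simpl; [apply ccont_const |].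
  apply ccont_plus; [exact IH | apply H].
Qed.

Lemma Cmean_csum (a : nat -> R -> C) n :
  (forall k, ccont (a k)) ->
  Cmean (fun t => csum (fun k => a k t) n) = csum (fun k => Cmean (a k)) n.
Proof.
  intros H. induction n as [|n IH]; simpl; [apply Cmean_const |].
  rewrite Cmean_plus, IH; [reflexivity | apply ccont_csum, H | apply H].
Qed.

Lemma cauchy_kernel_bound (w : C) t :
  Cmod w < 1 -> Cmod (cis t / (cis t - w)) <= / (1 - Cmod w) /\ (cis t - w)%C <> 0%C.
Proof.
  intros Hw.
  assert (B : 1 - Cmod w <= Cmod (cis t - w)).
  { assert (T := Cmod_triangle (cis t - w) w).
    replace (cis t - w + w)%C with (cis t) in T by ring. rewrite cis_mod in T. lra. }
  assert (N : (cis t - w)%C <> 0%C) by (intros E; rewrite E, Cmod_0 in B; lra).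
  split; [| exact N]. rewrite Cmod_div, cis_mod by exact N.
  unfold Rdiv. rewrite Rmult_1_l. apply Rinv_le_contravar; lra.
Qed.

Lemma ccont_kernel (w : C) : Cmod w < 1 -> ccont (fun t => cis t / (cis t - w))%C.
Proof.
  intros Hw t. apply cts_div; [apply ccont_cis1 | | apply cauchy_kernel_bound, Hw].
  apply cts_minus; [apply ccont_cis1 | apply cts_const].
Qed.

(** On the circle the conjugate of z / (z - w) is the value of an analytic
    function equal to 1 at the origin. *)
Lemma kernel_mean (w : C) : Cmod w < 1 -> Cmean (fun t => cis t / (cis t - w))%C = 1%C.
Proof.
  intros Hw.
  set (G := fun z => (/ (1 + - Cconj w * z))%C).
  assert (N : forall z, Cmod w * Cmod z < 1 -> (1 + - Cconj w * z)%C <> 0%C).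
  { intros z Hz E. assert (T := Cmod_triangle (1 + - Cconj w * z) (Cconj w * z)).
    replace (1 + - Cconj w * z + Cconj w * z)%C with (RtoC 1) in T by ring.
    rewrite E, Cmod_0, Cmod_1, Cmod_mult, Cmod_conj in T. lra. }
  assert (E : forall t, (cis t / (cis t - w))%C = Cconj (G (cis t))).
  { intros t. destruct (cauchy_kernel_bound w t Hw) as [_ K].
    assert (N1 := N (cis t)). rewrite cis_mod in N1. specialize (N1 (ltac:(lra))).
    unfold G. rewrite Cinv_conj by exact N1.
    rewrite Cplus_conj, Cmult_conj, Copp_conj, Cconj_conj, cis_conj.
    replace (Cconj 1) with (RtoC 1) by (apply C_ext; simpl; ring).
    replace (1 + - w * cis (- t))%C with ((cis t - w) / cis t)%C.
    - field. split; [apply cis_neq_0 | exact K].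
    - rewrite <- cis_inv. field. apply cis_neq_0. }
  rewrite (Cmean_ext _ _ E).
  set (rho := 2 / (1 + Cmod w)).
  pose proof (Cmod_ge_0 w).
  assert (Hrho : 1 < rho).
  { unfold rho. apply (Rmult_lt_reg_r (1 + Cmod w)); [lra |].
    unfold Rdiv. rewrite Rmult_assoc, Rinv_l by lra. lra. }
  assert (AG : analytic rho G).
  { intros z Hz. eexists. apply cderiv_inv.
    - apply cderiv_plus; [apply cderiv_const | apply cderiv_scal, cderiv_id].
    - apply N. apply Rle_lt_trans with (Cmod w * rho).
      + apply Rmult_le_compat_l; lra.
      + unfold rho. apply (Rmult_lt_reg_r (1 + Cmod w)); [lra |].
        replace (Cmod w * (2 / (1 + Cmod w)) * (1 + Cmod w)) with (2 * Cmod w) by (field; lra). lra. }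
  rewrite Cmean_conj by (apply (analytic_ccont G rho); assumption).
  rewrite (mean_value_unit G rho Hrho AG).
  unfold G. apply C_ext; simpl; field.
Qed.

(** The mean value property for z (F z - F w) / (z - w), which is only known to
    be continuous at w: the circle through w is the exceptional one. *)
Lemma cauchy_formula F rho (w : C) :
  1 < rho -> analytic rho F -> Cmod w < 1 ->
  Cmean (fun t => F (cis t) * (cis t / (cis t - w)))%C = F w.
Proof.
  intros Hr HF Hw.
  destruct (HF w (ltac:(lra))) as [d Hd].
  assert (AC := analytic_ccont F rho Hr HF). assert (KC := ccont_kernel w Hw).
  set (Q := fun z => (z * slope F w d z)%C).
  assert (DQ : forall z, Cmod z < rho -> z <> w -> exists e, cderiv Q z e).
  { intros z Hz N. destruct (HF z Hz) as [a Ha].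
    eexists. apply cderiv_mult; [apply cderiv_id |].
    apply (cderiv_ext_loc (fun u => (F u + - F w) * / (u + - w))%C).
    - apply locally_Cmod. exists (Cmod (z - w)). split.
      + apply Cmod_gt_0. intros E. apply N.
        replace z with ((z - w) + w)%C by ring. rewrite E. ring.
      + intros u Hu. rewrite slope_neq; [reflexivity |].
        intros ->. replace (w - z)%C with (- (z - w))%C in Hu by ring.
        rewrite Cmod_opp in Hu. lra.
    - apply cderiv_mult.
      + apply cderiv_plus; [exact Ha | apply cderiv_const].
      + apply cderiv_inv; [apply cderiv_plus; [apply cderiv_id | apply cderiv_const] |].
        intros E. apply N. replace z with ((z + - w) + w)%C by ring. rewrite E. ring. }
  assert (M := mean_value Q rho (Cmod w) 1 (Cmod_ge_0 w)).
  rewrite (Cmean_ext _ (fun t => Q (cis t) + F w * (cis t / (cis t - w)))%C).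
  - assert (CQ : ccont (fun t => Q (cis t))).
    { intros t. apply (cts_comp (V := C_UniformSpace) cis Q); [apply ccont_cis1 |].
      destruct (DQ (cis t)) as [e He]; [rewrite cis_mod; lra | | apply (cderiv_cts _ _ _ He)].
      intros E; rewrite <- E, cis_mod in Hw; lra. }
    rewrite (Cmean_plus (fun t => Q (cis t))); [| exact CQ |].
    2: { apply (ccont_mult (fun _ => F w)); [apply ccont_const | exact KC]. }
    rewrite Cmean_scal by exact KC. rewrite (kernel_mean w Hw).
    replace (Cmean (fun t => Q (cis t))) with (Q 0%C).
    + unfold Q. ring.
    + rewrite <- M.
      * apply Cmean_ext. intros t. rewrite Cmult_1_l. reflexivity.
      * lra.
      * intros z Hz. destruct (Req_dec (Cmod (z - w)) 0) as [E|N].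
        -- apply Cmod_eq_0 in E.
           replace z with w by (replace z with ((z - w) + w)%C by ring; rewrite E; ring).
           unfold Q. apply cts_mult; [apply cts_id | apply slope_cts, Hd].
        -- destruct (DQ z Hz) as [e He].
           ++ intros ->. apply N. replace (w - w)%C with (RtoC 0) by ring. apply Cmod_0.
           ++ apply (cderiv_cts _ _ _ He).
      * intros z Hz _ N. apply DQ; [exact Hz | intros ->; apply N; reflexivity].
  - intros t. destruct (cauchy_kernel_bound w t Hw) as [_ K].
    unfold Q. rewrite slope_neq.
    + field. exact K.
    + intros E. apply K. rewrite E. ring.
Qed.

Lemma geom_kernel (w z : C) n : z <> 0%C -> (z - w)%C <> 0%C ->
  (z / (z - w) = csum (fun k => Cpow w k * / Cpow z k) n
                 + Cpow w n * / Cpow z n * (z / (z - w)))%C.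
Proof.
  intros H K. induction n as [|n IH].
  - simpl. field. exact K.
  - rewrite IH at 1. simpl.
    assert (Cpow z n <> 0%C) by (apply Cpow_neq_0, H). field. auto.
Qed.

(** Expanding the Cauchy kernel as a geometric series. *)
Lemma taylor_remainder F rho (w : C) n :
  1 < rho -> analytic rho F -> Cmod w < 1 ->
  Cmod (F w - csum (fun k => coef F (Z.of_nat k) * Cpow w k)%C n) <=
  Cmod w ^ n * (Rmean (fun t => Cmod (F (cis t))) / (1 - Cmod w)).
Proof.
  intros Hr HF Hw.
  assert (AC := analytic_ccont F rho Hr HF). assert (KC := ccont_kernel w Hw).
  assert (Ck : forall k, ccont (fun t => F (cis t) * cis (- IZR (Z.of_nat k) * t))%C)
    by (intros; apply ccont_mul_cis, AC).
  set (E := fun t => (F (cis t) * cis (- IZR (Z.of_nat n) * t) * (cis t / (cis t - w)))%C).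
  assert (CE : ccont E) by (apply ccont_mult; [apply Ck | exact KC]).
  assert (Q : (F w - csum (fun k => coef F (Z.of_nat k) * Cpow w k) n = Cpow w n * Cmean E)%C).
  { rewrite <- (cauchy_formula F rho w Hr HF Hw).
    rewrite (Cmean_ext _ (fun t => csum (fun k => Cpow w k * (F (cis t) * cis (- IZR (Z.of_nat k) * t))) n
                             + Cpow w n * E t)%C).
    - rewrite Cmean_plus, Cmean_scal.
      + rewrite (Cmean_csum (fun k t => Cpow w k * (F (cis t) * cis (- IZR (Z.of_nat k) * t)))%C).
        * rewrite (csum_ext _ (fun k => coef F (Z.of_nat k) * Cpow w k)%C); [ring |].
          intros k _. rewrite Cmean_scal by apply Ck. unfold coef, fcoef. ring.
        * intros k. apply ccont_mult; [apply ccont_const | apply Ck].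
      + exact CE.
      + apply (ccont_csum (fun k t => Cpow w k * (F (cis t) * cis (- IZR (Z.of_nat k) * t)))%C).
        intros k. apply ccont_mult; [apply ccont_const | apply Ck].
      + apply ccont_mult; [apply ccont_const | exact CE].
    - intros t. destruct (cauchy_kernel_bound w t Hw) as [_ K].
      rewrite (geom_kernel w (cis t) n (cis_neq_0 t) K) at 1.
      rewrite (csum_ext (fun k => Cpow w k * (F (cis t) * cis (- IZR (Z.of_nat k) * t)))%C
                 (fun k => F (cis t) * (Cpow w k * / Cpow (cis t) k))%C).
      + rewrite csum_scal. unfold E. rewrite cis_opp_pow. ring.
      + intros k _. rewrite cis_opp_pow. ring. }
  rewrite Q, Cmod_mult, Cmod_pow. apply Rmult_le_compat_l; [apply pow_le, Cmod_ge_0 |].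
  eapply Rle_trans; [apply Cmean_mod_le, CE |].
  unfold Rdiv. rewrite Rmult_comm, <- Rmean_scal by (apply ccont_mod, AC).
  apply Rmean_le.
  - apply ccont_mod, CE.
  - intros t. apply continuous_Rmult; [apply continuous_const | apply continuous_Cmod, AC].
  - intros t. unfold E. rewrite !Cmod_mult, cis_mod, Rmult_1_r, Rmult_comm.
    apply Rmult_le_compat_r; [apply Cmod_ge_0 | apply cauchy_kernel_bound, Hw].
Qed.

(** Uniformity on the closed unit disc comes from integrating over a circle of
    radius (1 + rho) / 2 > 1. *)
Lemma taylor_unif F rho : 1 < rho -> analytic rho F ->
  exists M q, 0 <= q < 1 /\ 0 <= M /\ forall n z, Cmod z <= 1 ->
    Cmod (F z - csum (fun k => coef F (Z.of_nat k) * Cpow z k)%C n) <= M * q ^ n.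
Proof.
  intros Hr HF.
  set (r := (1 + rho) / 2). assert (Hr1 : 1 < r < rho) by (unfold r; lra).
  set (G := fun z => F (RtoC r * z)%C).
  assert (Hrr : 1 < rho / r).
  { apply (Rmult_lt_reg_r r); [lra |]. unfold Rdiv. rewrite Rmult_assoc, Rinv_l; lra. }
  assert (AG : analytic (rho / r) G) by (apply analytic_dilate; [lra | exact HF]).
  assert (Hq : 0 < / r < 1).
  { split; [apply Rinv_0_lt_compat; lra |]. rewrite <- Rinv_1. apply Rinv_lt_contravar; lra. }
  exists (Rmean (fun t => Cmod (G (cis t))) / (1 - / r)), (/ r).
  assert (M0 : 0 <= Rmean (fun t => Cmod (G (cis t)))).
  { apply Rmean_ge0; [apply ccont_mod, (analytic_ccont G (rho / r) Hrr AG) | intros; apply Cmod_ge_0]. }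
  split; [lra |]. split.
  { apply Rmult_le_pos; [exact M0 | left; apply Rinv_0_lt_compat; lra]. }
  intros n z Hz.
  set (w := (RtoC (/ r) * z)%C).
  assert (Ew : Cmod w = / r * Cmod z) by (unfold w; rewrite Cmod_mult, Cmod_R, Rabs_pos_eq; lra).
  pose proof (Cmod_ge_0 z).
  assert (Hw : Cmod w <= / r) by (rewrite Ew; nra).
  assert (T := taylor_remainder G (rho / r) w n Hrr AG (ltac:(lra))).
  assert (Zw : (RtoC r * w = z)%C).
  { unfold w. rewrite Cmult_assoc, <- RtoC_mult, Rinv_r by lra. ring. }
  unfold G at 1 in T. rewrite Zw in T.
  rewrite (csum_ext _ (fun k => coef F (Z.of_nat k) * Cpow z k)%C) in T.
  - eapply Rle_trans; [exact T |]. rewrite Rmult_comm. unfold Rdiv. apply Rmult_le_compat.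
    + apply Rmult_le_pos; [exact M0 |]. left; apply Rinv_0_lt_compat; lra.
    + apply pow_le, Cmod_ge_0.
    + apply Rmult_le_compat_l; [exact M0 |]. apply Rinv_le_contravar; lra.
    + apply pow_incr. split; [apply Cmod_ge_0 | exact Hw].
  - intros k _. unfold G. rewrite (coef_dilate F rho r k) by (try exact HF; lra).
    unfold w. rewrite Cpow_mult_l, RtoC_pow.
    assert (Y : (RtoC (r ^ k) * RtoC ((/ r) ^ k) = 1)%C).
    { rewrite <- RtoC_mult, <- Rpow_mult_distr, Rinv_r, pow1 by lra. reflexivity. }
    replace (RtoC (r ^ k) * coef F (Z.of_nat k) * (RtoC ((/ r) ^ k) * Cpow z k))%C
      with ((RtoC (r ^ k) * RtoC ((/ r) ^ k)) * (coef F (Z.of_nat k) * Cpow z k))%C by ring.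
    rewrite Y. ring.
Qed.

Lemma geom_small (M q x : R) (N : nat) : 0 <= q < 1 -> 0 <= M ->
  (forall n, (N <= n)%nat -> x <= M * q ^ n) -> x <= 0.
Proof.
  intros Hq HM H. apply Rnot_lt_le. intros Hx.
  destruct (pow_lt_1_zero q) with (y := x / (M + 1)) as [n Hn].
  - rewrite Rabs_pos_eq; lra.
  - apply Rdiv_lt_0_compat; lra.
  - specialize (Hn (max n N) (Nat.le_max_l _ _)). specialize (H (max n N) (Nat.le_max_r _ _)).
    rewrite Rabs_pos_eq in Hn by (apply pow_le; lra).
    apply (Rmult_lt_compat_r (M + 1)) in Hn; [| lra].
    unfold Rdiv in Hn. rewrite Rmult_assoc, Rinv_l in Hn by lra.
    assert (0 <= q ^ max n N) by (apply pow_le; lra). nra.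
Qed.

Lemma taylor_unique F G rho : 1 < rho -> analytic rho F -> analytic rho G ->
  (forall k : nat, coef F (Z.of_nat k) = coef G (Z.of_nat k)) ->
  forall z, Cmod z <= 1 -> F z = G z.
Proof.
  intros Hr HF HG E z Hz.
  destruct (taylor_unif F rho Hr HF) as [M1 [q1 [Q1 [P1 T1]]]].
  destruct (taylor_unif G rho Hr HG) as [M2 [q2 [Q2 [P2 T2]]]].
  set (q := Rmax q1 q2).
  assert (Hq : 0 <= q < 1) by (unfold q; split; [eapply Rle_trans; [apply Q1 | apply Rmax_l] | apply Rmax_lub_lt; lra]).
  assert (Z : Cmod (F z - G z) <= 0).
  { apply (geom_small (M1 + M2) q _ 0 Hq); [lra |]. intros n _.
    specialize (T1 n z Hz). specialize (T2 n z Hz).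
    rewrite (csum_ext _ (fun k => coef G (Z.of_nat k) * Cpow z k)%C) in T1
      by (intros; rewrite E; reflexivity).
    set (S := csum (fun k => coef G (Z.of_nat k) * Cpow z k)%C n) in *.
    replace (F z - G z)%C with ((F z - S) + - (G z - S))%C by ring.
    eapply Rle_trans; [apply Cmod_triangle |]. rewrite Cmod_opp.
    assert (q1 ^ n <= q ^ n) by (apply pow_incr; split; [lra | apply Rmax_l]).
    assert (q2 ^ n <= q ^ n) by (apply pow_incr; split; [lra | apply Rmax_r]).
    nra. }
  assert (Z2 : (F z - G z)%C = 0%C) by (apply Cmod_eq_0; pose proof (Cmod_ge_0 (F z - G z)); lra).
  replace (F z) with ((F z - G z) + G z)%C by ring. rewrite Z2. ring.
Qed.

(** The mean value property for (F z - F 0) / z, continuous at 0 with value d. *)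
Lemma coef_1 F rho d : 1 < rho -> analytic rho F -> cderiv F 0%C d -> coef F 1 = d.
Proof.
  intros Hr HF Hd.
  assert (DS : forall z, Cmod z < rho -> z <> 0%C -> exists e, cderiv (slope F 0%C d) z e).
  { intros z Hz N. destruct (HF z Hz) as [a Ha]. eexists.
    apply (cderiv_ext_loc (fun u => (F u + - F 0%C) * / u)%C).
    - apply locally_Cmod. exists (Cmod z). split; [apply Cmod_gt_0, N |].
      intros u Hu. rewrite slope_neq.
      + replace (u - 0)%C with u by ring. reflexivity.
      + intros ->. replace (0 - z)%C with (- z)%C in Hu by ring. rewrite Cmod_opp in Hu. lra.
    - apply cderiv_mult.
      + apply cderiv_plus; [exact Ha | apply cderiv_const].
      + apply (cderiv_inv (fun u => u)); [apply cderiv_id | exact N]. }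
  assert (CS : forall z, Cmod z < rho -> cts (U := C_UniformSpace) (slope F 0%C d) z).
  { intros z Hz. destruct (Req_dec (Cmod z) 0) as [E|N].
    - apply Cmod_eq_0 in E. rewrite E. apply slope_cts, Hd.
    - destruct (DS z Hz) as [e He]; [| apply (cderiv_cts _ _ _ He)].
      intros ->. apply N, Cmod_0. }
  assert (M := mean_value (slope F 0%C d) rho 0 1 (Rle_refl 0) (ltac:(lra)) CS
     (fun z Hz N _ => DS z Hz N)).
  rewrite slope_refl in M. rewrite <- M.
  unfold coef, fcoef.
  rewrite (Cmean_ext _ (fun t => slope F 0%C d (RtoC 1 * cis t) + F 0%C * cis (IZR (-1) * t))%C).
  - rewrite Cmean_plus, Cmean_scal, Cmean_cis; try lia.
    + ring.
    + apply ccont_cis.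
    + apply ccont_circle. intros z Hz. apply CS. rewrite Hz, Rabs_R1. exact Hr.
    + apply ccont_mult; [apply ccont_const | apply ccont_cis].
  - intros t. rewrite Cmult_1_l. rewrite slope_neq by apply cis_neq_0.
    replace (- (1) * t) with (- t) by ring. replace (-1 * t) with (- t) by ring.
    rewrite <- cis_inv. field. apply cis_neq_0.
Qed.

Lemma fcoef_csum (a : nat -> R -> C) n m :
  (forall k, ccont (a k)) ->
  fcoef (fun t => csum (fun k => a k t) n) m = csum (fun k => fcoef (a k) m) n.
Proof.
  intros H. unfold fcoef.
  rewrite <- (Cmean_csum (fun k t => a k t * cis (- IZR m * t))%C).
  - apply Cmean_ext. intros t. rewrite Cmult_comm, <- csum_scal.
    apply csum_ext. intros; ring.
  - intros k. apply ccont_mul_cis, H.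
Qed.

Lemma Zof_nat_cis (k : nat) t : Cpow (cis t) k = cis (IZR (Z.of_nat k) * t).
Proof. rewrite cis_pow, INR_IZR_INZ. reflexivity. Qed.

Lemma csum_tail (a : nat -> C) n N : (n <= N)%nat -> (forall k, (n <= k)%nat -> a k = 0%C) ->
  csum a N = csum a n.
Proof.
  intros H Z. induction H as [|N H IH]; [reflexivity |].
  simpl. rewrite IH, Z by exact H. ring.
Qed.

(** Replace F by a Taylor polynomial: the error is geometrically small, and the
    coefficients of the polynomial times G are computed by shifts. *)
Lemma coef_mult F G rho (n : nat) : 1 < rho -> analytic rho F -> analytic rho G ->
  coef (fun z => F z * G z)%C (Z.of_nat n) =
  csum (fun k => coef F (Z.of_nat k) * coef G (Z.of_nat (n - k)))%C (S n).
Proof.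
  intros Hr HF HG.
  assert (CF := analytic_ccont F rho Hr HF). assert (CG := analytic_ccont G rho Hr HG).
  destruct (taylor_unif F rho Hr HF) as [M [q [Hq [HM T]]]].
  set (S0 := csum (fun k => coef F (Z.of_nat k) * coef G (Z.of_nat (n - k)))%C (S n)).
  set (B := Rmean (fun t => Cmod (G (cis t)))).
  assert (HB : 0 <= B) by (apply Rmean_ge0; [apply ccont_mod, CG | intros; apply Cmod_ge_0]).
  assert (Z : Cmod (coef (fun z => F z * G z)%C (Z.of_nat n) - S0) <= 0).
  { apply (geom_small (M * B) q _ (S n) Hq); [apply Rmult_le_pos; assumption |].
    intros N HN.
    set (P := fun t => csum (fun k => coef F (Z.of_nat k) * (cis (IZR (Z.of_nat k) * t) * G (cis t)))%C N).
    assert (Ck : forall k, ccont (fun t => coef F (Z.of_nat k) * (cis (IZR (Z.of_nat k) * t) * G (cis t)))%C).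
    { intros k. apply ccont_mult; [apply ccont_const |]. apply ccont_mult; [apply ccont_cis | exact CG]. }
    assert (CP : ccont P) by (apply ccont_csum, Ck).
    assert (EP : fcoef P (Z.of_nat n) = S0).
    { unfold P. rewrite fcoef_csum by exact Ck.
      rewrite (csum_ext _ (fun k => coef F (Z.of_nat k) * coef G (Z.of_nat n - Z.of_nat k))%C).
      - rewrite (csum_tail (fun k => coef F (Z.of_nat k) * coef G (Z.of_nat n - Z.of_nat k))%C (S n) N HN).
        + apply csum_ext. intros k Hk. rewrite Nat2Z.inj_sub by lia. reflexivity.
        + intros k Hk. rewrite (coef_neg G rho (Z.of_nat n - Z.of_nat k) Hr HG) by lia. ring.
      - intros k _.
        rewrite fcoef_scal by (apply ccont_mult; [apply ccont_cis | exact CG]).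
        rewrite fcoef_shift. reflexivity. }
    rewrite <- EP. unfold coef.
    rewrite <- fcoef_minus by (try exact CP; apply ccont_mult; assumption).
    eapply Rle_trans; [apply fcoef_mod_le, ccont_minus; [apply ccont_mult; assumption | exact CP] |].
    replace (M * B * q ^ N) with ((M * q ^ N) * B) by ring. unfold B.
    rewrite <- Rmean_scal by (apply ccont_mod, CG).
    apply Rmean_le.
    - apply ccont_mod, ccont_minus; [apply ccont_mult; assumption | exact CP].
    - intros t. apply continuous_Rmult; [apply continuous_const | apply (ccont_mod _ CG)].
    - intros t.
      replace (P t) with (csum (fun k => coef F (Z.of_nat k) * Cpow (cis t) k) N * G (cis t))%C.
      + replace (F (cis t) * G (cis t) - csum (fun k => coef F (Z.of_nat k) * Cpow (cis t) k) N * G (cis t))%C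
          with ((F (cis t) - csum (fun k => coef F (Z.of_nat k) * Cpow (cis t) k) N) * G (cis t))%C by ring.
        rewrite Cmod_mult. apply Rmult_le_compat_r; [apply Cmod_ge_0 |].
        apply T. rewrite cis_mod. lra.
      + unfold P. rewrite Cmult_comm, <- csum_scal. apply csum_ext. intros k _.
        rewrite Zof_nat_cis. ring. }
  assert (Z2 : (coef (fun z => F z * G z)%C (Z.of_nat n) - S0 = 0)%C)
    by (apply Cmod_eq_0; pose proof (Cmod_ge_0 (coef (fun z => F z * G z)%C (Z.of_nat n) - S0)); lra).
  replace (coef (fun z => F z * G z)%C (Z.of_nat n))
    with ((coef (fun z => F z * G z)%C (Z.of_nat n) - S0) + S0)%C by ring.
  rewrite Z2. ring.
Qed.

(** The chain rule along curves is reduced to composition of complex functions: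
    the circle is the image of the real line under t |-> exp(i t). *)
Lemma derive_real_line (F : C -> C) (t : R) (d : C) :
  cderiv F (RtoC t) d ->
  is_derive (fun s => Re (F (RtoC s))) t (Re d) /\
  is_derive (fun s => Im (F (RtoC s))) t (Im d).
Proof.
  intros H.
  assert (K : forall (part : C -> R), (forall z, Rabs (part z) <= Cmod z) ->
     (forall a b s, part (a - b - d * RtoC s)%C = part a - part b - part d * s) ->
     is_derive (fun s => part (F (RtoC s))) t (part d)).
  { intros part H1 H2. apply is_derive_Reals. intros e He.
    assert (L := proj1 (cderiv_eps _ _ _) H (e / 2) (ltac:(lra))).
    apply locally_Cmod in L. destruct L as [dl [Hd L]].
    exists (mkposreal dl Hd). intros h Hh Hd'. simpl in Hd'.
    specialize (L (RtoC (t + h))).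
    replace (RtoC (t + h) - RtoC t)%C with (RtoC h) in L by (rewrite RtoC_plus; ring).
    rewrite Cmod_R in L. specialize (L Hd').
    replace ((part (F (RtoC (t + h))) - part (F (RtoC t))) / h - part d)
      with (part (F (RtoC (t + h)) - F (RtoC t) - d * RtoC h)%C / h)
      by (rewrite H2; field; exact Hh).
    unfold Rdiv. rewrite Rabs_mult, Rabs_inv.
    assert (P : 0 < Rabs h) by (apply Rabs_pos_lt, Hh).
    apply Rle_lt_trans with (e / 2 * Rabs h * / Rabs h).
    - apply Rmult_le_compat_r; [left; apply Rinv_0_lt_compat, P |].
      eapply Rle_trans; [apply H1 | exact L].
    - rewrite Rmult_assoc, Rinv_r by lra. lra. }
  split; apply K.
  - apply re_le_Cmod.
  - intros [a1 a2] [b1 b2] s. clear. destruct d; simpl; ring.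
  - apply im_le_Cmod.
  - intros [a1 a2] [b1 b2] s. clear. destruct d; simpl; ring.
Qed.

(** Integration by parts along the circle, whose tangent at z is i z. *)
Lemma coef_deriv (F F1 : C -> C) (k : Z) :
  (forall z, Cmod z = 1 -> cderiv F z (F1 z)) -> ccont (fun t => F1 (cis t)) ->
  coef (fun z => z * F1 z)%C k = (RtoC (IZR k) * coef F k)%C.
Proof.
  intros HD C1.
  assert (CF : ccont (fun t => F (cis t))).
  { intros t. apply (cts_comp (V := C_UniformSpace) cis F); [apply ccont_cis1 |].
    apply (cderiv_cts _ _ (F1 (cis t))), HD, cis_mod. }
  set (E := fun t : R => (Ci * (cis t * F1 (cis t) * cis (- IZR k * t)
                     - IZR k * (F (cis t) * cis (- IZR k * t))))%C).
  assert (C2 : ccont (fun t => cis t * F1 (cis t))%C) by (apply ccont_mult; [apply ccont_cis1 | exact C1]).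
  assert (C3 := ccont_mul_cis _ (- IZR k) C2). assert (C4 := ccont_mul_cis _ (- IZR k) CF).
  assert (C5 : ccont (fun t => IZR k * (F (cis t) * cis (- IZR k * t)))%C)
    by (apply ccont_mult; [apply ccont_const | exact C4]).
  assert (CE : ccont E).
  { apply ccont_mult; [apply ccont_const |]. apply ccont_minus; assumption. }
  assert (Q : Cmean E = 0%C).
  { set (phi := fun z => (F (Cexp (Ci * z)) * Cexp (- (IZR k * Ci) * z))%C).
    assert (EX : forall s t, Cexp (Ci * (RtoC s * RtoC t)) = cis (s * t)).
    { intros s t. unfold Cexp. simpl.
      replace (0 * (s * t - 0 * 0) - 1 * (s * 0 + 0 * t)) with 0 by ring.
      replace (0 * (s * 0 + 0 * t) + 1 * (s * t - 0 * 0)) with (s * t) by ring.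
      rewrite exp_0. ring. }
    assert (EX1 : forall t, Cexp (Ci * RtoC t) = cis t).
    { intros t. replace (RtoC t) with (RtoC 1 * RtoC t)%C by ring. rewrite EX, Rmult_1_l. reflexivity. }
    assert (EXk : forall t, Cexp (- (IZR k * Ci) * RtoC t) = cis (- IZR k * t)).
    { intros t. rewrite <- EX. f_equal. rewrite RtoC_opp. ring. }
    assert (PV : forall t, phi (RtoC t) = (F (cis t) * cis (- IZR k * t))%C).
    { intros t. unfold phi. rewrite EX1, EXk. reflexivity. }
    assert (D : forall t, cderiv phi (RtoC t) (E t)).
    { intros t.
      assert (D1 : cderiv (fun z => F (Cexp (Ci * z))) (RtoC t) (F1 (cis t) * (cis t * (Ci * 1)))%C).
      { apply (cderiv_comp F (fun z => Cexp (Ci * z))).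
        - rewrite EX1. apply HD, cis_mod.
        - rewrite <- (EX1 t). apply (cderiv_comp Cexp (fun z => Ci * z)%C); [apply cderiv_Cexp |].
          apply cderiv_scal, cderiv_id. }
      assert (D2 : cderiv (fun z => Cexp (- (IZR k * Ci) * z)) (RtoC t)
                 (cis (- IZR k * t) * (- (IZR k * Ci) * 1))%C).
      { rewrite <- (EXk t). apply (cderiv_comp Cexp (fun z => - (IZR k * Ci) * z)%C); [apply cderiv_Cexp |].
        apply cderiv_scal, cderiv_id. }
      assert (D3 := cderiv_mult _ _ _ _ _ D1 D2). cbv beta in D3.
      rewrite EX1, EXk in D3.
      replace (E t) with (F1 (cis t) * (cis t * (Ci * 1)) * cis (- IZR k * t)
         + F (cis t) * (cis (- IZR k * t) * (- (IZR k * Ci) * 1)))%C; [exact D3 |].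
      unfold E. ring. }
    assert (Per : phi (RtoC (2 * PI)) = phi (RtoC 0)).
    { rewrite !PV. replace (cis (2 * PI)) with (cis 0) by (rewrite <- (cis_2PI 0), Rplus_0_l; reflexivity).
      f_equal. rewrite <- opp_IZR, cis_Z, Rmult_0_r, cis_0. reflexivity. }
    apply C_ext; [change (Rmean (fun t => Re (E t)) = 0) | change (Rmean (fun t => Im (E t)) = 0)]; unfold Rmean.
    - replace (RInt (fun t => Re (E t)) 0 (2 * PI)) with 0; [ring |].
      symmetry. apply is_RInt_unique.
      replace 0 with (minus (Re (phi (RtoC (2 * PI)))) (Re (phi (RtoC 0)))) at 2.
      + apply (is_RInt_derive (fun t => Re (phi (RtoC t)))).
        * intros t _. apply derive_real_line, D.
        * intros t _. apply (ccont_re _ CE).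
      + rewrite Per. apply (minus_eq_zero (G := R_AbelianGroup)).
    - replace (RInt (fun t => Im (E t)) 0 (2 * PI)) with 0; [ring |].
      symmetry. apply is_RInt_unique.
      replace 0 with (minus (Im (phi (RtoC (2 * PI)))) (Im (phi (RtoC 0)))) at 2.
      + apply (is_RInt_derive (fun t => Im (phi (RtoC t)))).
        * intros t _. apply derive_real_line, D.
        * intros t _. apply (ccont_im _ CE).
      + rewrite Per. apply (minus_eq_zero (G := R_AbelianGroup)). }
  unfold E in Q. rewrite Cmean_scal in Q by (apply ccont_minus; assumption).
  rewrite Cmean_minus in Q by assumption.
  rewrite (Cmean_scal (IZR k)) in Q by exact C4.
  fold (fcoef (fun t => cis t * F1 (cis t))%C k) in Q. fold (fcoef (fun t => F (cis t)) k) in Q.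
  fold (coef F k) in Q. change (fcoef (fun t => cis t * F1 (cis t))%C k) with (coef (fun z => z * F1 z)%C k) in Q.
  set (a := coef (fun z => z * F1 z)%C k) in *. set (b := (IZR k * coef F k)%C) in *.
  assert (Z : (a - b = 0)%C).
  { replace (a - b)%C with (- Ci * (Ci * (a - b)))%C.
    - rewrite Q. ring.
    - replace (- Ci * (Ci * (a - b)))%C with (- (Ci * Ci) * (a - b))%C by ring.
      replace (Ci * Ci)%C with (- (1))%C by (apply C_ext; simpl; ring). ring. }
  replace a with ((a - b) + b)%C by ring. rewrite Z. ring.
Qed.

(** ** Bessel's inequality *)

Definition msq (g : R -> C) : R := Rmean (fun t => Cmod (g t) ^ 2).

Lemma rcont_sq g : ccont g -> rcont (fun t => Cmod (g t) ^ 2).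
Proof. intros H t. apply (continuous_sqr (fun t => Cmod (g t))), ccont_mod, H. Qed.

Lemma msq_ge0 g : ccont g -> 0 <= msq g.
Proof. intros H. apply Rmean_ge0; [apply rcont_sq, H | intros; apply pow2_ge_0]. Qed.

(** Removing a Fourier component is an orthogonal projection. *)
Lemma msq_split g k : ccont g ->
  msq g = Cmod (fcoef g k) ^ 2 + msq (fun t => g t - fcoef g k * cis (IZR k * t))%C.
Proof.
  intros Hg. set (a := fcoef g k).
  assert (C1 : ccont (fun t => g t * cis (- IZR k * t))%C) by (apply ccont_mul_cis, Hg).
  assert (C2 : ccont (fun t => Cconj a * (g t * cis (- IZR k * t)))%C)
    by (apply ccont_mult; [apply ccont_const | exact C1]).
  assert (P : forall z : C, Cmod z ^ 2 = Re (z * Cconj z)%C).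
  { intros z. rewrite Cmod2_alt. destruct z; simpl; ring. }
  unfold msq at 2.
  rewrite (Rmean_ext _ (fun t => (Cmod (g t) ^ 2 - 2 * Re (Cconj a * (g t * cis (- IZR k * t)))%C) + Cmod a ^ 2)).
  - rewrite (Rmean_plus (fun t => Cmod (g t) ^ 2 - 2 * Re (Cconj a * (g t * cis (- IZR k * t)))%C) (fun _ => Cmod a ^ 2)).
    + rewrite (Rmean_minus (fun t => Cmod (g t) ^ 2) (fun t => 2 * Re (Cconj a * (g t * cis (- IZR k * t)))%C)).
      * rewrite (Rmean_scal 2 (fun t => Re (Cconj a * (g t * cis (- IZR k * t)))%C)) by (apply (ccont_re _ C2)).
        rewrite Rmean_const. fold (msq g).
        rewrite <- Cmean_re, Cmean_scal by exact C1. fold (fcoef g k). fold a.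
        rewrite (P a). rewrite (Cmult_comm a). ring.
      * apply rcont_sq, Hg.
      * intros t; apply continuous_Rmult; [apply continuous_const | apply (ccont_re _ C2)].
    + intros t. apply continuous_Rminus; [apply (rcont_sq _ Hg) |].
      apply continuous_Rmult; [apply continuous_const | apply (ccont_re _ C2)].
    + intros t; apply continuous_const.
  - intros t. replace (- IZR k * t) with (- (IZR k * t)) by ring. rewrite <- cis_conj.
    assert (N : Cmod (cis (IZR k * t)) ^ 2 = 1) by (rewrite cis_mod; ring).
    rewrite Cmod2_alt in N. rewrite !Cmod2_alt.
    destruct (g t) as [x y], a as [u v], (cis (IZR k * t)) as [c s]. simpl in *.
    replace (u * u) with (u * u * 1) by ring. nra.
Qed.

Lemma fcoef_remove g (j k : Z) c : ccont g -> j <> k ->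
  fcoef (fun t => g t - c * cis (IZR k * t))%C j = fcoef g j.
Proof.
  intros Hg N. 
  rewrite fcoef_minus, fcoef_scal, fcoef_cis;
    [| apply ccont_cis | exact Hg | apply ccont_mult; [apply ccont_const | apply ccont_cis]].
  destruct (Z.eq_dec k j) as [E|_]; [congruence | ring].
Qed.

Lemma ccont_remove g (k : Z) c : ccont g -> ccont (fun t => g t - c * cis (IZR k * t))%C.
Proof.
  intros Hg. apply ccont_minus; [exact Hg |]. apply ccont_mult; [apply ccont_const | apply ccont_cis].
Qed.

Lemma bessel1 g k : ccont g -> Cmod (fcoef g k) ^ 2 <= msq g.
Proof.
  intros Hg. rewrite (msq_split g k Hg).
  pose proof (msq_ge0 _ (ccont_remove g k (fcoef g k) Hg)). lra.
Qed.

Lemma bessel2 g j k : ccont g -> j <> k ->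
  Cmod (fcoef g j) ^ 2 + Cmod (fcoef g k) ^ 2 <= msq g.
Proof.
  intros Hg N. rewrite (msq_split g j Hg).
  pose proof (bessel1 _ k (ccont_remove g j (fcoef g j) Hg)) as B.
  rewrite fcoef_remove in B by auto. lra.
Qed.

Lemma bessel3 g i j k : ccont g -> i <> j -> i <> k -> j <> k ->
  Cmod (fcoef g i) ^ 2 + Cmod (fcoef g j) ^ 2 + Cmod (fcoef g k) ^ 2 <= msq g.
Proof.
  intros Hg N1 N2 N3. rewrite (msq_split g i Hg).
  pose proof (bessel2 _ j k (ccont_remove g i (fcoef g i) Hg) N3) as B.
  rewrite !fcoef_remove in B by auto. lra.
Qed.

Lemma msq_affine (a b : C) : msq (fun t => a + b * cis t)%C = Cmod a ^ 2 + Cmod b ^ 2.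
Proof.
  set (g := fun t => (a * cis (IZR 0 * t) + b * cis (IZR 1 * t))%C).
  assert (C0 : forall c (j : Z), ccont (fun t => c * cis (IZR j * t))%C)
    by (intros; apply ccont_mult; [apply ccont_const | apply ccont_cis]).
  assert (Cg : ccont g) by (apply ccont_plus; apply C0).
  assert (E : msq (fun t => a + b * cis t)%C = msq g).
  { apply Rmean_ext. intros t. unfold g.
    replace (IZR 0 * t) with 0 by (simpl; ring). replace (IZR 1 * t) with t by (simpl; ring).
    rewrite cis_0, Cmult_1_r. reflexivity. }
  assert (F : forall k, fcoef g k = ((if Z.eq_dec 0 k then a else 0) + (if Z.eq_dec 1 k then b else 0))%C).
  { intros k. unfold g.
    rewrite (fcoef_plus (fun t => a * cis (IZR 0 * t))%C (fun t => b * cis (IZR 1 * t))%C) by apply C0.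
    rewrite !fcoef_scal by apply ccont_cis. rewrite !fcoef_cis.
    destruct (Z.eq_dec 0 k), (Z.eq_dec 1 k); ring. }
  assert (F0 : fcoef g 0 = a) by (rewrite F; simpl; ring).
  assert (F1 : fcoef g 1 = b) by (rewrite F; simpl; ring).
  rewrite E, (msq_split g 0 Cg), F0.
  rewrite (msq_split _ 1 (ccont_remove g 0 a Cg)), fcoef_remove, F1 by (try exact Cg; lia).
  replace (msq _) with 0; [ring |].
  symmetry. transitivity (Rmean (fun _ => 0)); [| apply Rmean_const].
  apply Rmean_ext. intros t. unfold g.
  set (u := (a * cis (IZR 0 * t))%C). set (v := (b * cis (IZR 1 * t))%C).
  replace (u + v - u - v)%C with (RtoC 0) by ring.
  rewrite Cmod_0. ring.
Qed.

(** * Real powers *)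

Lemma rpow_0 p : rpow 0 p = 0.
Proof. unfold rpow. destruct (Req_EM_T 0 0); [reflexivity | lra]. Qed.

Lemma rpow_pos x p : 0 < x -> rpow x p = Rpower x p.
Proof. intros H. unfold rpow. destruct (Req_EM_T x 0); [lra | reflexivity]. Qed.

Lemma rpow_gt0 x p : 0 < x -> 0 < rpow x p.
Proof. intros H. rewrite rpow_pos by exact H. apply exp_pos. Qed.

Lemma rpow_ge0 x p : 0 <= x -> 0 <= rpow x p.
Proof.
  intros [H | <-]; [left; apply rpow_gt0, H | rewrite rpow_0; lra].
Qed.

Lemma rpow_1_l p : rpow 1 p = 1.
Proof. rewrite rpow_pos by lra. unfold Rpower. rewrite ln_1, Rmult_0_r. apply exp_0. Qed.

Lemma rpow_1_r x : 0 <= x -> rpow x 1 = x.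
Proof. intros [H | <-]; [rewrite rpow_pos by exact H; apply Rpower_1, H | apply rpow_0]. Qed.

Lemma rpow_mult x y p : 0 <= x -> 0 <= y -> rpow (x * y) p = rpow x p * rpow y p.
Proof.
  intros [Hx | <-] [Hy | <-]; rewrite ?Rmult_0_l, ?Rmult_0_r, ?rpow_0; try ring.
  rewrite !rpow_pos by (try apply Rmult_lt_0_compat; assumption).
  symmetry. apply Rpower_mult_distr; assumption.
Qed.

Lemma rpow_lt x y p : 0 < p -> 0 <= x -> x < y -> rpow x p < rpow y p.
Proof.
  intros Hp [Hx | <-] H.
  - rewrite !rpow_pos by lra. unfold Rpower. apply exp_increasing.
    apply Rmult_lt_compat_l; [exact Hp | apply ln_increasing; assumption].
  - rewrite rpow_0. apply rpow_gt0, H.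
Qed.

Lemma rpow_le x y p : 0 < p -> 0 <= x -> x <= y -> rpow x p <= rpow y p.
Proof.
  intros Hp Hx [H | ->]; [left; apply rpow_lt; assumption | lra].
Qed.

Lemma rpow_comp x p q : 0 <= x -> rpow (rpow x p) q = rpow x (p * q).
Proof.
  intros [H | <-]; [| rewrite !rpow_0; reflexivity].
  rewrite (rpow_pos x p), (rpow_pos x (p * q)), rpow_pos by (try apply exp_pos; exact H).
  apply Rpower_mult.
Qed.

(** Continuity holds at zeros of f as well, since 0 ^ p = 0. *)
Lemma continuous_rpow_Cmod {U : UniformSpace} (f : U -> C) (x : U) p :
  0 < p -> cts f x -> continuous (fun y => rpow (Cmod (f y)) p) x.
Proof.
  intros Hp Hf. destruct (Req_dec (Cmod (f x)) 0) as [E|N].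
  - apply Cmod_eq_0 in E. intros P [e He].
    assert (K := proj1 (cts_eps f x) Hf (rpow e (/ p)) (rpow_gt0 _ _ (cond_pos e))).
    unfold filtermap. revert K. apply filter_imp. intros y Hy. apply He.
    rewrite E, Cmod_0, rpow_0. rewrite E in Hy. replace (f y - 0)%C with (f y) in Hy by ring.
    change (Rabs (rpow (Cmod (f y)) p - 0) < e).
    rewrite Rminus_0_r, Rabs_pos_eq by (apply rpow_ge0, Cmod_ge_0).
    apply (rpow_lt _ _ p Hp (Cmod_ge_0 _)) in Hy.
    rewrite rpow_comp in Hy by (left; apply cond_pos).
    rewrite Rinv_l, rpow_1_r in Hy; [exact Hy | left; apply cond_pos | lra].
  - assert (P : 0 < Cmod (f x)) by (pose proof (Cmod_ge_0 (f x)); lra).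
    apply (continuous_ext_loc (T := U) (fun y => rpow (Cmod (f y)) p) (fun y => Rpower (Cmod (f y)) p)).
    + assert (K := proj1 (cts_eps f x) Hf (Cmod (f x)) P). revert K. apply filter_imp.
      intros y Hy. symmetry. apply rpow_pos.
      assert (T := Cmod_triangle (f x - f y) (f y)).
      replace (f x - f y + f y)%C with (f x) in T by ring.
      replace (f y - f x)%C with (- (f x - f y))%C in Hy by ring.
      rewrite Cmod_opp in Hy. lra.
    + unfold Rpower. apply (continuous_Rfun exp).
      * apply continuous_Rmult; [apply continuous_const |].
        apply (continuous_Rfun ln); [apply continuous_Cmod, Hf |].
        apply derivable_continuous_pt. exists (/ Cmod (f x)). apply derivable_pt_lim_ln, P.
      * apply derivable_continuous_pt, derivable_pt_exp.
Qed.

Lemma exp_ge u : 1 + u <= exp u.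
Proof. destruct (Req_dec u 0) as [->|N]; [rewrite exp_0; lra | left; apply exp_ineq1, N]. Qed.

Lemma ln_le_sub1 x : 0 < x -> ln x <= x - 1.
Proof. intros H. pose proof (exp_ge (ln x)) as K. rewrite exp_ln in K by exact H. lra. Qed.

(** Bernoulli's inequality: x ^ p = x * x ^ (p - 1) >= x (1 + (p - 1) ln x)
    and ln x >= 1 - 1 / x. *)
Lemma bernoulli x p : 0 <= x -> 1 <= p -> 1 + p * (x - 1) <= rpow x p.
Proof.
  intros [H | <-] Hp; [| rewrite rpow_0; lra].
  rewrite rpow_pos by exact H.
  assert (L : 1 - / x <= ln x).
  { pose proof (ln_le_sub1 (/ x) (Rinv_0_lt_compat _ H)) as K. rewrite ln_Rinv in K by exact H. lra. }
  replace p with (1 + (p - 1)) at 2 by ring.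
  rewrite Rpower_plus, Rpower_1 by exact H. unfold Rpower.
  pose proof (exp_ge ((p - 1) * ln x)) as K.
  assert (K2 : 1 + (p - 1) * (1 - / x) <= exp ((p - 1) * ln x)) by nra.
  apply (Rmult_le_compat_l x) in K2; [| lra].
  replace (x * (1 + (p - 1) * (1 - / x))) with (1 + p * (x - 1)) in K2 by (field; lra). exact K2.
Qed.

Lemma bernoulli_eq x p : 0 <= x -> 1 < p -> rpow x p <= 1 + p * (x - 1) -> x = 1.
Proof.
  intros [H | <-] Hp; [| rewrite rpow_0; lra].
  intros E. rewrite rpow_pos in E by exact H.
  destruct (Req_dec x 1) as [|N]; [assumption | exfalso].
  assert (L : 1 - / x <= ln x).
  { pose proof (ln_le_sub1 (/ x) (Rinv_0_lt_compat _ H)) as K. rewrite ln_Rinv in K by exact H. lra. }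
  replace p with (1 + (p - 1)) in E at 1 by ring.
  rewrite Rpower_plus, Rpower_1 in E by exact H. unfold Rpower in E.
  assert (N2 : (p - 1) * ln x <> 0).
  { apply Rmult_integral_contrapositive_currified; [lra |].
    intros Z. apply N. rewrite <- ln_1 in Z. apply ln_inv in Z; lra. }
  pose proof (exp_ineq1 _ N2) as K.
  assert (K2 : 1 + (p - 1) * (1 - / x) < exp ((p - 1) * ln x)) by nra.
  apply (Rmult_lt_compat_l x) in K2; [| lra].
  replace (x * (1 + (p - 1) * (1 - / x))) with (1 + p * (x - 1)) in K2 by (field; lra). lra.
Qed.

Lemma left_limit_le (phi : R -> R) K : continuous phi 1 ->
  (forall r, 0 < r < 1 -> phi r <= K) -> phi 1 <= K.
Proof.
  intros Hc H. apply Rnot_lt_le. intros L.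
  destruct (Hc (fun y => K < y)) as [d Hd].
  { exists (mkposreal (phi 1 - K) (ltac:(lra))). intros y Hy.
    change (Rabs (y - phi 1) < phi 1 - K) in Hy. apply Rabs_def2 in Hy. lra. }
  set (r := Rmax (1 / 2) (1 - d / 2)).
  pose proof (cond_pos d).
  assert (1 / 2 <= r) by apply Rmax_l. assert (1 - d / 2 <= r) by apply Rmax_r.
  assert (r < 1) by (apply Rmax_lub_lt; lra).
  assert (K < phi r).
  { apply Hd. change (Rabs (r - 1) < d). apply Rabs_def1; lra. }
  specialize (H r (ltac:(lra))). lra.
Qed.

(** * The unit sphere of H^p *)

Definition Mp (p : R) (f : C -> C) (r : R) : R :=
  Rmean (fun t => rpow (Cmod (f (RtoC r * cis t)%C)) p).

Definition unit_norm (p : R) (f : C -> C) : Prop :=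
  analytic 1 f /\ Hp_norm_pow p f = Finite 1.

Lemma disc_circle_ccont f r : analytic 1 f -> 0 <= r < 1 -> ccont (fun t => f (RtoC r * cis t)%C).
Proof.
  intros Hf Hr. apply ccont_circle. intros z Hz. apply (analytic_cts f 1 z Hf).
  rewrite Hz, Rabs_pos_eq; lra.
Qed.

Lemma rcont_rpow_mod g p : 0 < p -> ccont g -> rcont (fun t => rpow (Cmod (g t)) p).
Proof. intros Hp Hg t. apply continuous_rpow_Cmod; [exact Hp | apply Hg]. Qed.

Lemma Mp_ge0 p f r : 0 < p -> analytic 1 f -> 0 <= r < 1 -> 0 <= Mp p f r.
Proof.
  intros Hp Hf Hr. apply Rmean_ge0.
  - apply (rcont_rpow_mod (fun t => f (RtoC r * cis t)%C) p Hp), disc_circle_ccont; assumption.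
  - intros t. apply rpow_ge0, Cmod_ge_0.
Qed.

Lemma Hp_pow_lub p f : is_lub_Rbar (fun x => exists r, 0 < r < 1 /\ x = Mp p f r) (Hp_norm_pow p f).
Proof. apply Lub_Rbar_correct. Qed.

Lemma unit_norm_iff p f : 0 < p ->
  (in_Hp p f /\ Hp_norm p f = 1) <-> unit_norm p f.
Proof.
  intros Hp. split.
  - intros [[Hf Hlt] Hn]. apply analytic_on_disc_iff in Hf. split; [exact Hf |].
    destruct (Hp_pow_lub p f) as [Hub _].
    assert (H0 : Rbar_le (Mp p f (1 / 2)) (Hp_norm_pow p f)).
    { apply Hub. exists (1 / 2). split; [lra | reflexivity]. }
    pose proof (Mp_ge0 p f (1 / 2) Hp Hf (ltac:(lra))) as H1.
    unfold Hp_norm in Hn. destruct (Hp_norm_pow p f) as [x| |]; simpl in *; try contradiction.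
    f_equal. assert (Hx : 0 <= x) by lra.
    apply (f_equal (fun y => rpow y p)) in Hn.
    rewrite rpow_comp, Rinv_l, rpow_1_r, rpow_1_l in Hn by lra. exact Hn.
  - intros [Hf E]. split; [split |].
    + apply analytic_on_disc_iff, Hf.
    + rewrite E. exact I.
    + unfold Hp_norm. rewrite E. apply rpow_1_l.
Qed.

Lemma unit_norm_Mp_le p f r : unit_norm p f -> 0 < r < 1 -> Mp p f r <= 1.
Proof.
  intros [_ E] Hr. destruct (Hp_pow_lub p f) as [Hub _]. rewrite E in Hub.
  apply (Hub (Mp p f r)). exists r; split; [exact Hr | reflexivity].
Qed.

Lemma unit_norm_intro p f : analytic 1 f ->
  (forall r, 0 < r < 1 -> Mp p f r <= 1) ->
  (forall e, 0 < e -> exists r, 0 < r < 1 /\ 1 - e < Mp p f r) -> unit_norm p f.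
Proof.
  intros Hf Hub Hl. split; [exact Hf |].
  apply is_lub_Rbar_unique. split.
  - intros x [r [Hr ->]]. apply (Hub r Hr).
  - intros b Hb. destruct b as [b| |]; simpl; try exact I.
    + apply Rnot_lt_le. intros H. destruct (Hl (1 - b)) as [r [Hr H1]]; [lra |].
      assert (K := Hb (Mp p f r)). simpl in K.
      assert (Mp p f r <= b) by (apply K; exists r; split; [exact Hr | reflexivity]). lra.
    + apply (Hb (Mp p f (1 / 2))). exists (1 / 2). split; [lra | reflexivity].
Qed.

Lemma C_derive_cderiv f z d : cderiv f z d -> C_derive f z = d.
Proof. intros H. apply is_C_derive_unique, cderiv_is_derive, H. Qed.

Lemma analytic_derive0 f : analytic 1 f -> cderiv f 0%C (C_derive f 0%C).
Proof.
  intros Hf. destruct (Hf 0%C) as [d Hd]; [rewrite Cmod_0; lra |].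
  rewrite (C_derive_cderiv _ _ _ Hd). exact Hd.
Qed.

Lemma extremal_problem p (K : R) (f0 : C -> C) : 0 < p ->
  unit_norm p f0 -> Cmod (C_derive f0 0%C) = K ->
  (forall f, unit_norm p f -> Cmod (C_derive f 0%C) <= K) ->
  const_C1 p = Finite K /\
  forall f, extremal p f <-> unit_norm p f /\ Cmod (C_derive f 0%C) = K.
Proof.
  intros Hp H0 HK Hub.
  assert (E : const_C1 p = Finite K).
  { apply is_lub_Rbar_unique. split.
    - intros x [f [H1 [H2 ->]]]. apply Hub, unit_norm_iff; auto.
    - intros b Hb. apply (Hb K). exists f0. apply unit_norm_iff in H0; [| exact Hp].
      destruct H0 as [A B]. repeat split; [apply A | apply A | exact B | symmetry; exact HK]. }
  split; [exact E |]. intros f. unfold extremal. rewrite E, <- (unit_norm_iff p f Hp).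
  split.
  - intros [A [B D]]. injection D as D. auto.
  - intros [[A B] D]. rewrite D. auto.
Qed.

Lemma Mp_ext p f g r : 0 <= r < 1 -> (forall z, Cmod z < 1 -> f z = g z) -> Mp p f r = Mp p g r.
Proof.
  intros Hr H. apply Rmean_ext. intros t. rewrite H; [reflexivity |].
  rewrite Cmod_mult, cis_mod, Cmod_R, Rabs_pos_eq; lra.
Qed.

Lemma Mp_rotate p f a b r : 0 < p -> analytic 1 f -> 0 <= r < 1 ->
  Mp p (fun z => cis a * f (cis b * z))%C r = Mp p f r.
Proof.
  intros Hp Hf Hr. unfold Mp.
  rewrite <- (Rmean_shift (fun t => rpow (Cmod (f (RtoC r * cis t)%C)) p) b).
  - apply Rmean_ext. intros t. rewrite Cmod_mult, cis_mod, Rmult_1_l.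
    rewrite cis_plus. replace (r * (cis t * cis b))%C with (cis b * (r * cis t))%C by ring. reflexivity.
  - apply (rcont_rpow_mod (fun t => f (RtoC r * cis t)%C) p Hp), disc_circle_ccont; assumption.
  - intros t. rewrite cis_2PI. reflexivity.
Qed.

Lemma disc_open z : Cmod z < 1 -> locally (T := C_UniformSpace) z (fun w => Cmod w < 1).
Proof.
  intros H. apply locally_Cmod. exists (1 - Cmod z). split; [lra |]. intros w Hw.
  assert (T := Cmod_triangle (w - z) z). replace (w - z + z)%C with w in T by ring. lra.
Qed.

Lemma cderiv_rotate f a b z d : cderiv f (cis b * z)%C d ->
  cderiv (fun w => cis a * f (cis b * w))%C z (cis a * (d * cis b))%C.
Proof.
  intros H. apply (cderiv_scal (cis a) (fun w => f (cis b * w)%C)).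
  replace (d * cis b)%C with (d * (cis b * 1))%C by ring.
  apply (cderiv_comp f (fun w => cis b * w)%C); [exact H |].
  apply cderiv_scal, cderiv_id.
Qed.

Lemma trivial_modification_invariant p f g : 0 < p -> trivial_modification g f ->
  unit_norm p g ->
  unit_norm p f /\ Cmod (C_derive f 0%C) = Cmod (C_derive g 0%C).
Proof.
  intros Hp [a [b E]] Hg.
  assert (D : forall z d, Cmod z < 1 -> cderiv g (cis b * z)%C d ->
     cderiv f z (cis a * (d * cis b))%C).
  { intros z d Hz Hd. apply (cderiv_ext_loc (fun w => cis a * g (cis b * w))%C).
    - generalize (disc_open z Hz). apply locally_imp. intros w Hw. symmetry. apply E, Hw.
    - apply cderiv_rotate, Hd. }
  assert (Ag := proj1 Hg).
  assert (Af : analytic 1 f).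
  { intros z Hz. destruct (Ag (cis b * z)%C) as [d Hd].
    - rewrite Cmod_mult, cis_mod. lra.
    - exists (cis a * (d * cis b))%C. apply D; assumption. }
  split.
  - split; [exact Af |]. rewrite <- (proj2 Hg).
    unfold Hp_norm_pow. apply Lub_Rbar_eqset. intros x.
    assert (Q : forall r, 0 < r < 1 -> Mp p f r = Mp p g r).
    { intros r Hr. rewrite <- (Mp_rotate p g a b r Hp Ag (ltac:(lra))).
      apply Mp_ext; [lra | exact E]. }
    split; intros [r [Hr ->]]; exists r; (split; [exact Hr |]);
    [apply (Q r Hr) | symmetry; apply (Q r Hr)].
  - rewrite (C_derive_cderiv f 0%C (cis a * (C_derive g 0%C * cis b))%C).
    + rewrite !Cmod_mult, !cis_mod. ring.
    + apply D; [rewrite Cmod_0; lra |].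
      replace (cis b * 0)%C with (RtoC 0) by ring. apply analytic_derive0, Ag.
Qed.

(** * Taylor coefficients on the unit disc *)

(** The radius 1/2 of the circle of integration is arbitrary, see [tc_coef]. *)
Definition tc (f : C -> C) (k : nat) : C :=
  (RtoC (2 ^ k) * coef (fun z => f (RtoC (1 / 2) * z)%C) (Z.of_nat k))%C.

Lemma disc_dilate f r : analytic 1 f -> 0 < r < 1 ->
  1 < 1 / r /\ analytic (1 / r) (fun z => f (RtoC r * z)%C).
Proof.
  intros Hf Hr. split.
  - apply (Rmult_lt_reg_r r); [lra |]. unfold Rdiv. rewrite Rmult_assoc, Rinv_l; lra.
  - apply analytic_dilate; [lra | exact Hf].
Qed.

Lemma tc_coef f r k : analytic 1 f -> 0 < r < 1 ->
  coef (fun z => f (RtoC r * z)%C) (Z.of_nat k) = (RtoC (r ^ k) * tc f k)%C.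
Proof.
  intros Hf Hr.
  destruct (disc_dilate f (1 / 2) Hf) as [H1 H2]; [lra |].
  unfold tc. rewrite Cmult_assoc, <- RtoC_mult, <- Rpow_mult_distr.
  rewrite <- (coef_dilate _ (1 / (1 / 2)) (r * 2) k H1).
  - apply coef_ext. intros z _. f_equal. rewrite Cmult_assoc, <- RtoC_mult. f_equal. f_equal. field.
  - replace (1 / (1 / 2)) with 2 by field. lra.
  - exact H2.
Qed.

Lemma tc_unique f g : analytic 1 f -> analytic 1 g ->
  (forall k, tc f k = tc g k) -> forall z, Cmod z < 1 -> f z = g z.
Proof.
  intros Hf Hg E z Hz. set (r := (1 + Cmod z) / 2). pose proof (Cmod_ge_0 z).
  assert (Hr : 0 < r < 1) by (unfold r; lra).
  destruct (disc_dilate f r Hf Hr) as [H1 H2]. destruct (disc_dilate g r Hg Hr) as [_ H3].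
  assert (T := taylor_unique _ _ (1 / r) H1 H2 H3).
  specialize (T (fun k => eq_trans (tc_coef f r k Hf Hr)
     (eq_trans (f_equal (fun a => RtoC (r ^ k) * a)%C (E k)) (eq_sym (tc_coef g r k Hg Hr))))).
  specialize (T (RtoC (/ r) * z)%C). cbv beta in T.
  rewrite Cmult_assoc, <- RtoC_mult, Rinv_r, Cmult_1_l in T by lra.
  apply T. rewrite Cmod_mult, Cmod_R, Rabs_pos_eq by (left; apply Rinv_0_lt_compat; lra).
  apply (Rmult_le_reg_l r); [lra |]. rewrite <- Rmult_assoc, Rinv_r by lra. unfold r; lra.
Qed.

Lemma tc_0 f : analytic 1 f -> tc f 0 = f 0%C.
Proof.
  intros Hf. destruct (disc_dilate f (1 / 2) Hf) as [H1 H2]; [lra |].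
  unfold tc. simpl Z.of_nat. rewrite (coef_0 _ _ H1 H2).
  simpl pow. replace (RtoC (1 / 2) * 0)%C with (RtoC 0) by ring. ring.
Qed.

Lemma tc_1 f d : analytic 1 f -> cderiv f 0%C d -> tc f 1 = d.
Proof.
  intros Hf Hd. destruct (disc_dilate f (1 / 2) Hf) as [H1 H2]; [lra |].
  unfold tc. change (Z.of_nat 1) with 1%Z. rewrite (coef_1 _ _ (d * (RtoC (1 / 2) * 1))%C H1 H2).
  - replace (RtoC (2 ^ 1) * (d * (RtoC (1 / 2) * 1)))%C with (RtoC (2 ^ 1) * RtoC (1 / 2) * d)%C by ring.
    rewrite <- RtoC_mult. replace (2 ^ 1 * (1 / 2)) with 1 by field. ring.
  - apply (cderiv_comp f (fun z => RtoC (1 / 2) * z)%C).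
    + replace (RtoC (1 / 2) * 0)%C with (RtoC 0) by ring. exact Hd.
    + apply cderiv_scal, cderiv_id.
Qed.

(** * The case p >= 1 *)

(** Bernoulli's inequality takes the place of Hoelder's, the norm being 1. *)
Lemma mean_mod_le_1 p f r : 1 <= p -> unit_norm p f -> 0 < r < 1 ->
  Rmean (fun t => Cmod (f (RtoC r * cis t)%C)) <= 1.
Proof.
  intros Hp Hf Hr. assert (Cf := disc_circle_ccont f r (proj1 Hf) (ltac:(lra))).
  assert (Cm := ccont_mod _ Cf). assert (Cr := rcont_rpow_mod _ p (ltac:(lra)) Cf).
  assert (H := unit_norm_Mp_le p f r Hf Hr). unfold Mp in H.
  assert (B : Rmean (fun t => (1 - p) + p * Cmod (f (RtoC r * cis t)%C)) <=
     Rmean (fun t => rpow (Cmod (f (RtoC r * cis t)%C)) p)).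
  { apply Rmean_le.
    - intros t. apply continuous_Rplus; [apply continuous_const |].
      apply continuous_Rmult; [apply continuous_const | apply Cm].
    - exact Cr.
    - intros t. pose proof (bernoulli (Cmod (f (RtoC r * cis t)%C)) p (Cmod_ge_0 _) Hp). lra. }
  rewrite (Rmean_plus (fun _ => 1 - p)), Rmean_const, Rmean_scal in B;
    [| exact Cm | intros t; apply continuous_const |
       intros t; apply continuous_Rmult; [apply continuous_const | apply Cm]].
  nra.
Qed.

(** r f'(0) is the first Fourier coefficient of f on the circle of radius r. *)
Lemma derive_mod_le p f r : 1 <= p -> unit_norm p f -> 0 < r < 1 ->
  r * Cmod (C_derive f 0%C) <= Rmean (fun t => Cmod (f (RtoC r * cis t)%C)).
Proof.
  intros Hp Hf Hr. assert (Cf := disc_circle_ccont f r (proj1 Hf) (ltac:(lra))).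
  assert (T := tc_coef f r 1 (proj1 Hf) Hr).
  rewrite (tc_1 f _ (proj1 Hf) (analytic_derive0 f (proj1 Hf))) in T.
  assert (L := fcoef_mod_le _ (Z.of_nat 1) Cf).
  change (fcoef (fun t => f (RtoC r * cis t)%C) (Z.of_nat 1))
    with (coef (fun z => f (RtoC r * z)%C) (Z.of_nat 1)) in L.
  rewrite T, Cmod_mult, Cmod_R in L. rewrite Rabs_pos_eq in L by (simpl; lra).
  simpl pow in L. rewrite Rmult_1_r in L. exact L.
Qed.

Lemma derive_le_1 p f : 1 <= p -> unit_norm p f -> Cmod (C_derive f 0%C) <= 1.
Proof.
  intros Hp Hf.
  replace (Cmod (C_derive f 0%C)) with (1 * Cmod (C_derive f 0%C)) by ring.
  apply (left_limit_le (fun r => r * Cmod (C_derive f 0%C))).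
  - apply continuous_Rmult; [apply continuous_id | apply continuous_const].
  - intros r Hr. eapply Rle_trans; [apply (derive_mod_le p f r Hp Hf Hr) |].
    apply (mean_mod_le_1 p); assumption.
Qed.

(** |Im u|^2 = (|u| - Re u) (|u| + Re u) <= 2 |u| (|u| - Re u), then the
    arithmetic-geometric mean inequality.  In the mean, almost equality of |u|
    and Re u thus makes Im u small. *)
Lemma Cmod_re_im_bound (u : C) tau : 0 < tau ->
  Rabs (Im u) <= tau * Cmod u + (Cmod u - Re u) / (2 * tau).
Proof.
  intros Ht. pose proof (re_le_Cmod u) as H1. pose proof (Cmod2 u) as H2.
  pose proof (Rle_abs (Re u)). pose proof (Cmod_ge_0 u).
  set (A := Cmod u) in *. set (B := (A - Re u) / (2 * tau)).
  assert (HB : A - Re u = 2 * tau * B) by (unfold B; field; lra).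
  assert (B0 : 0 <= B) by (unfold B; apply Rmult_le_pos; [lra | left; apply Rinv_0_lt_compat; lra]).
  assert (TA : 0 <= tau * A) by (apply Rmult_le_pos; lra).
  apply Rsqr_incr_0_var; [| lra].
  rewrite <- Rsqr_abs. unfold Rsqr.
  assert (Im u * Im u = (A - Re u) * (A + Re u)) by lra.
  assert ((A - Re u) * (A + Re u) <= (A - Re u) * (2 * A)) by (apply Rmult_le_compat_l; lra).
  assert (P : 0 <= (tau * A - B) * (tau * A - B)) by apply Rle_0_sqr.
  assert (Q : (A - Re u) * (2 * A) = 4 * (tau * A * B)) by (rewrite HB; ring).
  assert (S : (tau * A + B) * (tau * A + B) = (tau * A - B) * (tau * A - B) + 4 * (tau * A * B)) by ring.
  lra.
Qed.

(** On the unit circle [quadratic a z] is z times the real number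
    1 + 2 Re (a / z). *)
Definition quadratic (a z : C) : C := (a + z + Cconj a * (z * z))%C.

Lemma analytic_quadratic a rho : analytic rho (quadratic a).
Proof.
  apply analytic_plus; [apply analytic_plus; [apply analytic_const | apply analytic_id] |].
  apply analytic_mult; [apply analytic_const | apply analytic_mult; apply analytic_id].
Qed.

Lemma tc_quadratic a k : tc (quadratic a) k =
  match k with O => a | 1%nat => 1%C | 2%nat => Cconj a | _ => 0%C end.
Proof.
  unfold tc, coef.
  rewrite (fcoef_ext _ (fun t => a * cis (IZR 0 * t) + RtoC (1 / 2) * cis (IZR 1 * t)
      + (Cconj a * RtoC (1 / 4)) * cis (IZR 2 * t))%C).
  - assert (Cc : forall c (j : Z), ccont (fun t => c * cis (IZR j * t))%C)
      by (intros; apply ccont_mult; [apply ccont_const | apply ccont_cis]).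
    rewrite (fcoef_plus (fun t => a * cis (IZR 0 * t) + RtoC (1 / 2) * cis (IZR 1 * t))%C
      (fun t => (Cconj a * RtoC (1 / 4)) * cis (IZR 2 * t))%C);
      [| apply ccont_plus; apply Cc | apply Cc].
    rewrite (fcoef_plus (fun t => a * cis (IZR 0 * t))%C (fun t => RtoC (1 / 2) * cis (IZR 1 * t))%C);
      [| apply Cc | apply Cc].
    rewrite !fcoef_scal by apply ccont_cis. rewrite !fcoef_cis.
    destruct (Z.eq_dec 0 (Z.of_nat k)), (Z.eq_dec 1 (Z.of_nat k)), (Z.eq_dec 2 (Z.of_nat k));
      try lia; destruct k as [|[|[|k]]]; try lia.
    + simpl pow. ring.
    + simpl pow. replace (RtoC (2 * 1)) with (RtoC 2) by (f_equal; ring).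
      replace (2 * (a * 0 + RtoC (1 / 2) * 1 + Cconj a * RtoC (1 / 4) * 0))%C with (2 * RtoC (1 / 2))%C by ring.
      rewrite <- RtoC_mult. f_equal. field.
    + simpl pow. replace (2 * (2 * 1)) with 4 by ring.
      replace (4 * (a * 0 + RtoC (1 / 2) * 0 + Cconj a * RtoC (1 / 4) * 1))%C with (4 * RtoC (1 / 4) * Cconj a)%C by ring.
      rewrite <- RtoC_mult. replace (4 * (1 / 4)) with 1 by field. ring.
    + ring.
  - intros t. unfold quadratic.
    replace (IZR 0 * t) with 0 by (simpl; ring). replace (IZR 1 * t) with t by (simpl; ring).
    replace (IZR 2 * t) with (t + t) by (simpl; ring). rewrite cis_0, cis_plus.
    replace (RtoC (1 / 4)) with (RtoC (1 / 2) * RtoC (1 / 2))%C by (rewrite <- RtoC_mult; f_equal; field).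
    ring.
Qed.

(** Equality in |f'(0)| <= ||f||_1 forces f(z) / z to be almost real and
    nonnegative on circles of radius close to 1, so the coefficients of f are
    symmetric about the first. *)
Lemma extremal_quadratic f : analytic 1 f -> cderiv f 0%C 1%C ->
  (forall r, 0 < r < 1 -> Rmean (fun t => Cmod (f (RtoC r * cis t)%C)) <= 1) ->
  forall z, Cmod z < 1 -> f z = quadratic (f 0%C) z.
Proof.
  intros Hf Hd HM.
  assert (T0 := tc_0 f Hf). assert (T1 := tc_1 f _ Hf Hd).
  assert (Main : forall m r tau, (1 <= m)%Z -> 0 < r < 1 -> 0 < tau ->
     Cmod (coef (fun z => f (RtoC r * z)%C) (m + 1) - Cconj (coef (fun z => f (RtoC r * z)%C) (1 - m)))
     <= 2 * tau + (1 - r) / tau).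
  { intros m r tau Hm Hr Ht.
    assert (Cf := disc_circle_ccont f r Hf (ltac:(lra))).
    set (u := fun t => (f (RtoC r * cis t) * cis (- IZR 1 * t))%C).
    assert (Cu : ccont u) by (apply ccont_mul_cis, Cf).
    assert (Cuc : ccont (fun t => Cconj (u t))) by (intros t; apply cts_conj, Cu).
    assert (Fu : forall j, fcoef u j = coef (fun z => f (RtoC r * z)%C) (j + 1)).
    { intros j. unfold coef, fcoef, u. apply Cmean_ext. intros t.
      rewrite plus_IZR. replace (- (IZR j + 1) * t) with (- IZR 1 * t + - IZR j * t) by ring.
      rewrite cis_plus. ring. }
    assert (Fc : fcoef (fun t => Cconj (u t)) m = Cconj (fcoef u (- m))).
    { unfold fcoef. rewrite <- Cmean_conj by (apply ccont_mul_cis, Cu).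
      apply Cmean_ext. intros t. rewrite Cmult_conj, cis_conj. f_equal. f_equal.
      rewrite opp_IZR. ring. }
    rewrite <- (Fu m). replace (1 - m)%Z with (- m + 1)%Z by ring. rewrite <- (Fu (- m)%Z), <- Fc.
    rewrite <- fcoef_minus by assumption.
    eapply Rle_trans; [apply fcoef_mod_le, ccont_minus; assumption |].
    assert (Cm := ccont_mod _ Cu). assert (Cre := ccont_re _ Cu).
    assert (M1 : Rmean (fun t => Cmod (u t)) <= 1).
    { eapply Rle_trans; [| apply (HM r Hr)]. right. apply Rmean_ext. intros t.
      unfold u. rewrite Cmod_mult, cis_mod. ring. }
    assert (M2 : Rmean (fun t => Re (u t)) = r).
    { rewrite <- Cmean_re. change (Cmean u) with (coef (fun z => f (RtoC r * z)%C) (Z.of_nat 1)).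
      rewrite (tc_coef f r 1 Hf Hr), T1. simpl. ring. }
    apply Rle_trans with (Rmean (fun t => (2 * tau) * Cmod (u t) + / tau * (Cmod (u t) - Re (u t)))).
    - apply Rmean_le.
      + apply ccont_mod, ccont_minus; assumption.
      + intros t. apply continuous_Rplus; apply continuous_Rmult; try apply continuous_const; [apply Cm |].
        apply continuous_Rminus; [apply Cm | apply Cre].
      + intros t. pose proof (Cmod_re_im_bound (u t) tau Ht) as B.
        replace (u t - Cconj (u t))%C with (RtoC (2 * Im (u t)) * Ci)%C
          by (destruct (u t); apply C_ext; simpl; ring).
        rewrite Cmod_mult, Cmod_Ci, Cmod_R, Rabs_mult, (Rabs_pos_eq 2) by lra.
        replace ((Cmod (u t) - Re (u t)) / (2 * tau)) with (/ tau * (Cmod (u t) - Re (u t)) / 2) in B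
          by (field; lra). lra.
    - rewrite (Rmean_plus (fun t => 2 * tau * Cmod (u t)) (fun t => / tau * (Cmod (u t) - Re (u t)))).
      + rewrite Rmean_scal by exact Cm.
        rewrite (Rmean_scal (/ tau)) by (intros t; apply continuous_Rminus; [apply Cm | apply Cre]).
        rewrite Rmean_minus by assumption. rewrite M2.
        assert (0 < / tau) by (apply Rinv_0_lt_compat, Ht). unfold Rdiv. nra.
      + intros t. apply continuous_Rmult; [apply continuous_const | apply Cm].
      + intros t. apply continuous_Rmult; [apply continuous_const |].
        apply continuous_Rminus; [apply Cm | apply Cre]. }
  assert (Lim : forall phi : R -> R, continuous phi 1 -> 
     (forall r tau, 0 < r < 1 -> 0 < tau -> phi r <= 2 * tau + (1 - r) / tau) -> phi 1 <= 0).
  { intros phi Hc H. apply Rnot_lt_le. intros L.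
    set (tau := phi 1 / 4). assert (Ht : 0 < tau) by (unfold tau; lra).
    assert (K : phi 1 - (1 - 1) / tau <= 2 * tau).
    { apply (left_limit_le (fun r => phi r - (1 - r) / tau)).
      - apply continuous_Rminus; [exact Hc |].
        apply continuous_Rmult; [| apply continuous_const].
        apply continuous_Rminus; [apply continuous_const | apply continuous_id].
      - intros r Hr. specialize (H r tau Hr Ht). lra. }
    unfold Rdiv in K. rewrite Rminus_diag, Rmult_0_l in K. unfold tau in K. lra. }
  assert (Cpw : forall n, continuous (fun r : R => r ^ n) 1).
  { intros n. apply (continuous_Rfun (fun y => y ^ n) (fun r => r)); [apply continuous_id |].
    apply derivable_continuous_pt, derivable_pt_pow. }
  assert (T2 : tc f 2 = Cconj (f 0%C)).
  { assert (Z : Cmod (RtoC (1 ^ 2) * tc f 2 - Cconj (f 0%C)) <= 0).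
    { apply (Lim (fun r => Cmod (RtoC (r ^ 2) * tc f 2 - Cconj (f 0%C)))).
      - apply continuous_Cmod. apply cts_minus; [| apply cts_const].
        apply cts_mult; [apply cts_RtoC, Cpw | apply cts_const].
      - intros r tau Hr Ht. pose proof (Main 1%Z r tau (Z.le_refl 1) Hr Ht) as M.
        change (1 + 1)%Z with (Z.of_nat 2) in M. change (1 - 1)%Z with (Z.of_nat 0) in M.
        rewrite !tc_coef, T0 in M by assumption. simpl (r ^ 0) in M.
        rewrite Cmult_1_l in M. exact M. }
    rewrite pow1 in Z.
    assert (Z2 : (RtoC 1 * tc f 2 - Cconj (f 0%C) = 0)%C)
      by (apply Cmod_eq_0; pose proof (Cmod_ge_0 (RtoC 1 * tc f 2 - Cconj (f 0%C))); lra).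
    replace (tc f 2) with ((RtoC 1 * tc f 2 - Cconj (f 0%C)) + Cconj (f 0%C))%C by ring.
    rewrite Z2. ring. }
  assert (T3 : forall k, tc f (S (S (S k))) = 0%C).
  { intros k. set (n := S (S (S k))).
    assert (Z : Cmod (RtoC (1 ^ n) * tc f n) <= 0).
    { apply (Lim (fun r => Cmod (RtoC (r ^ n) * tc f n))).
      - apply continuous_Cmod. apply cts_mult; [apply cts_RtoC, Cpw | apply cts_const].
      - intros r tau Hr Ht. pose proof (Main (Z.of_nat n - 1)%Z r tau (ltac:(lia)) Hr Ht) as M.
        replace (Z.of_nat n - 1 + 1)%Z with (Z.of_nat n) in M by ring.
        destruct (disc_dilate f r Hf Hr) as [D1 D2].
        rewrite (coef_neg _ _ (1 - (Z.of_nat n - 1))%Z D1 D2) in M by lia.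
        rewrite tc_coef in M by assumption.
        replace (RtoC (r ^ n) * tc f n - Cconj 0)%C with (RtoC (r ^ n) * tc f n)%C in M; [exact M |].
        replace (Cconj 0) with (RtoC 0) by (apply C_ext; simpl; ring). ring. }
    rewrite pow1, Cmult_1_l in Z. apply Cmod_eq_0. pose proof (Cmod_ge_0 (tc f n)). lra. }
  apply tc_unique; [exact Hf | apply analytic_quadratic |].
  intros k. rewrite tc_quadratic. destruct k as [|[|[|k]]]; auto.
Qed.

Lemma quadratic_on_circle a t :
  (quadratic a (cis t) * cis (- t))%C = RtoC (1 + 2 * Re (a * cis (- t))%C).
Proof.
  unfold quadratic.
  replace ((a + cis t + Cconj a * (cis t * cis t)) * cis (- t))%C
    with (a * cis (- t) + (cis t * cis (- t)) + Cconj a * cis t * (cis t * cis (- t)))%C by ring.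
  rewrite cis_mult_opp.
  replace (Cconj a * cis t * 1)%C with (Cconj (a * cis (- t)))%C.
  - set (w := (a * cis (- t))%C). destruct w as [x y]; apply C_ext; simpl; ring.
  - rewrite Cmult_conj, cis_conj, Ropp_involutive. ring.
Qed.

Lemma cts_quadratic a z : cts (U := C_UniformSpace) (quadratic a) z.
Proof.
  apply (analytic_cts _ (Cmod z + 1)); [apply analytic_quadratic | lra].
Qed.

Lemma quadratic_mean_re a r : 0 < r < 1 ->
  r <= Rmean (fun t => Cmod (quadratic a (RtoC r * cis t)%C)).
Proof.
  intros Hr.
  assert (Cq : ccont (fun t => quadratic a (RtoC r * cis t)%C))
    by (apply ccont_circle; intros; apply cts_quadratic).
  assert (L := fcoef_mod_le _ (Z.of_nat 1) Cq).
  change (fcoef (fun t => quadratic a (RtoC r * cis t)%C) (Z.of_nat 1))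
    with (coef (fun z => quadratic a (RtoC r * z)%C) (Z.of_nat 1)) in L.
  rewrite (tc_coef _ r 1 (analytic_quadratic a 1) Hr), tc_quadratic, Cmod_mult, Cmod_R, Cmod_1 in L.
  rewrite Rabs_pos_eq in L by (simpl; lra). simpl pow in L. lra.
Qed.

Lemma circle_mean_limit (h : C -> R) K :
  (forall z, continuous (h : C_UniformSpace -> R) z) ->
  (forall r, 0 < r < 1 -> Rmean (fun t => h (RtoC r * cis t)%C) <= K) ->
  Rmean (fun t => h (cis t)) <= K.
Proof.
  intros Hc H.
  rewrite (Rmean_ext _ (fun t => h (RtoC 1 * cis t)%C)) by (intros; rewrite Cmult_1_l; reflexivity).
  apply (left_limit_le (fun r => Rmean (fun t => h (RtoC r * cis t)%C))); [| exact H].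
  apply (circle_param h 2); [rewrite Rabs_R1; lra | intros; apply Hc].
Qed.

(** The factorization of a nonnegative trigonometric polynomial of degree 1
    comes down to this equation. *)
Lemma fejer_riesz_parameter m : 0 <= m <= 1 / 2 ->
  exists a, 0 <= a <= 1 /\ a * sqrt (1 - a ^ 2) = m.
Proof.
  intros Hm.
  set (q := (1 - sqrt (1 - 4 * m ^ 2)) / 2).
  assert (S0 : 0 <= sqrt (1 - 4 * m ^ 2)) by apply sqrt_pos.
  assert (S2 : sqrt (1 - 4 * m ^ 2) * sqrt (1 - 4 * m ^ 2) = 1 - 4 * m ^ 2) by (apply sqrt_sqrt; nra).
  assert (S1 : sqrt (1 - 4 * m ^ 2) <= 1) by nra.
  assert (Hq : 0 <= q <= 1) by (unfold q; lra).
  assert (Qq : q * (1 - q) = m ^ 2) by (unfold q; nra).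
  exists (sqrt q). split.
  - split; [apply sqrt_pos |]. rewrite <- sqrt_1. apply sqrt_le_1; lra.
  - replace (sqrt q ^ 2) with q by (simpl; rewrite Rmult_1_r, sqrt_sqrt; lra).
    rewrite <- sqrt_mult by lra. rewrite Qq. apply sqrt_pow2. lra.
Qed.

(** An extremal function for p >= 1 has mean modulus at most 1 on circles, so it
    is quadratic; the limit r -> 1 then restricts the parameter. *)
Lemma extremal_form p f : 1 <= p -> unit_norm p f -> Cmod (C_derive f 0%C) = 1 ->
  exists alpha a, (forall z, Cmod z < 1 -> f z = (cis alpha * quadratic a z)%C) /\
    Cmod a <= 1 / 2 /\ (1 < p -> a = 0%C).
Proof.
  intros Hp Hf H1.
  destruct (polar (C_derive f 0%C)) as [al Eal]. rewrite H1, Cmult_1_l in Eal.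
  set (g := fun z => (cis (- al) * f z)%C).
  assert (Ag : analytic 1 g) by (apply analytic_mult; [apply analytic_const | apply Hf]).
  assert (Dg : cderiv g 0%C 1%C).
  { replace (RtoC 1) with (cis (- al) * C_derive f 0%C)%C.
    - apply cderiv_scal, analytic_derive0, Hf.
    - rewrite Eal, Cmult_comm. apply cis_mult_opp. }
  assert (Mg : forall z, Cmod (g z) = Cmod (f z))
    by (intros z; unfold g; rewrite Cmod_mult, cis_mod; ring).
  assert (Eg := extremal_quadratic g Ag Dg).
  specialize (Eg (fun r Hr => Rle_trans _ _ _
    (Req_le _ _ (Rmean_ext _ _ (fun t => Mg _))) (mean_mod_le_1 p f r Hp Hf Hr))).
  set (a := g 0%C) in *.
  assert (Ef : forall z, Cmod z < 1 -> f z = (cis al * quadratic a z)%C).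
  { intros z Hz. rewrite <- (Eg z Hz). unfold g.
    replace (cis al * (cis (- al) * f z))%C with ((cis al * cis (- al)) * f z)%C by ring.
    rewrite cis_mult_opp. ring. }
  assert (Qf : forall r t, 0 < r < 1 -> Cmod (quadratic a (RtoC r * cis t)) = Cmod (f (RtoC r * cis t)%C)).
  { intros r t Hr. rewrite Ef; [rewrite Cmod_mult, cis_mod; ring |].
    rewrite Cmod_mult, cis_mod, Cmod_R, Rabs_pos_eq; lra. }
  assert (Cq1 : ccont (fun t => quadratic a (cis t))).
  { intros t. apply (cts_comp (V := C_UniformSpace) cis (quadratic a)); [apply ccont_cis1 | apply cts_quadratic]. }
  assert (Cqr : forall r, ccont (fun t => quadratic a (RtoC r * cis t)%C))
    by (intros r; apply ccont_circle; intros; apply cts_quadratic).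
  assert (Cm := ccont_mod _ Cq1).
  assert (Per : forall t, cis (t + 2 * PI) = cis t) by apply cis_2PI.
  set (w := fun t => 1 + 2 * Re (a * cis (- t))%C).
  assert (Ww : forall t, Cmod (quadratic a (cis t)) = Rabs (w t)).
  { intros t. unfold w. rewrite <- Cmod_R, <- quadratic_on_circle, Cmod_mult, cis_mod. ring. }
  destruct (polar a) as [be Ebe].
  assert (Wv : forall t, w t = 1 + 2 * Cmod a * cos (be - t)).
  { intros t. unfold w. rewrite Ebe at 1. rewrite <- Cmult_assoc, <- cis_plus. simpl.
    replace (be + - t) with (be - t) by ring. ring. }
  exists al, a. split; [exact Ef |]. split.
  (* w is nonnegative on the circle because its mean is 1 and that of |w| at most 1. *)
  - assert (Cw : rcont w).
    { intros t. apply continuous_Rplus; [apply continuous_const |].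
      apply continuous_Rmult; [apply continuous_const |].
      apply (cts_re (fun t => a * cis (- t))%C). apply cts_mult; [apply cts_const |].
      apply cts_cis. apply (continuous_opp (fun t : R => t)), continuous_id. }
    assert (M1 : Rmean (fun t => Cmod (quadratic a (cis t))) <= 1).
    { apply (circle_mean_limit (fun z => Cmod (quadratic a z))).
      - intros z. apply continuous_Cmod, cts_quadratic.
      - intros r Hr. eapply Rle_trans; [| apply (mean_mod_le_1 p f r Hp Hf Hr)].
        right. apply Rmean_ext. intros t. apply Qf, Hr. }
    assert (M2 : Rmean w = 1).
    { assert (K : Cmean (fun t => a * cis (IZR (-1) * t))%C = 0%C).
      { rewrite Cmean_scal, Cmean_cis by (try lia; apply ccont_cis). ring. }
      apply (f_equal Re) in K. rewrite Cmean_re in K.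
      unfold w. rewrite (Rmean_plus (fun _ => 1)), Rmean_const, Rmean_scal.
      - replace (Rmean (fun t => Re (a * cis (- t))%C)) with 0; [ring |].
        symmetry. etransitivity; [| exact K]. apply Rmean_ext. intros t.
        replace (IZR (-1) * t) with (- t) by (simpl; ring). reflexivity.
      - intros t. apply (cts_re (fun t => a * cis (- t))%C). apply cts_mult; [apply cts_const |].
        apply cts_cis. apply (continuous_opp (fun t : R => t)), continuous_id.
      - intros t; apply continuous_const.
      - intros t. apply continuous_Rmult; [apply continuous_const |].
        apply (cts_re (fun t => a * cis (- t))%C). apply cts_mult; [apply cts_const |].
        apply cts_cis. apply (continuous_opp (fun t : R => t)), continuous_id. }
    assert (Z := Rmean_zero (fun t => Cmod (quadratic a (cis t)) - w t)).
    assert (Zt : Cmod (quadratic a (cis (be + PI))) - w (be + PI) = 0).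
    { apply Z.
      - intros t. apply continuous_Rminus; [apply Cm | apply Cw].
      - intros t. rewrite Per, !Wv. replace (be - (t + 2 * PI)) with ((be - t) - 2 * PI) by ring.
        rewrite (cos_minus (be - t)), cos_2PI, sin_2PI. ring.
      - intros t. rewrite Ww. pose proof (Rle_abs (w t)). lra.
      - rewrite Rmean_minus by (try exact Cw; exact Cm). lra. }
    pose proof (Cmod_ge_0 (quadratic a (cis (be + PI)))) as P0.
    rewrite Wv in Zt. replace (be - (be + PI)) with (- PI) in Zt by ring.
    rewrite cos_neg, cos_PI in Zt. lra.
  (* For p > 1 the defect in Bernoulli's inequality vanishes on the unit circle,
     so w is 1 or -1 there; at the maximum of w this gives a = 0. *)
  - intros Hp1.
    set (h := fun z => rpow (Cmod (quadratic a z)) p - (1 + p * (Cmod (quadratic a z) - 1))).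
    assert (Hh : forall z, 0 <= h z).
    { intros z. pose proof (bernoulli (Cmod (quadratic a z)) p (Cmod_ge_0 _) Hp). unfold h; lra. }
    assert (Ch : forall (U : UniformSpace) (g : U -> C) x, cts g x -> continuous (fun y => h (g y)) x).
    { intros U g0 x Hg0.
      assert (Cg : cts (fun y => quadratic a (g0 y)) x).
      { apply (cts_comp (V := C_UniformSpace) g0 (quadratic a)); [exact Hg0 | apply cts_quadratic]. }
      apply continuous_Rminus.
      - apply (continuous_rpow_Cmod (fun y => quadratic a (g0 y))); [lra | exact Cg].
      - apply continuous_Rplus; [apply continuous_const |].
        apply continuous_Rmult; [apply continuous_const |].
        apply continuous_Rminus; [apply continuous_Cmod, Cg | apply continuous_const]. }
    assert (Mh : Rmean (fun t => h (cis t)) <= 0).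
    { apply Rle_trans with (Rmean (fun t => h (cis t)) + p * (1 - 1)); [lra |].
      rewrite (Rmean_ext (fun t => h (cis t)) (fun t => h (RtoC 1 * cis t)%C))
        by (intros; rewrite Cmult_1_l; reflexivity).
      replace (Rmean (fun t => h (RtoC 1 * cis t)%C) + p * (1 - 1))
        with (Rmean (fun t => h (RtoC 1 * cis t)%C) - p * (1 - 1)) by ring.
      apply (left_limit_le (fun r => Rmean (fun t => h (RtoC r * cis t)%C) - p * (1 - r))).
      - apply continuous_Rminus.
        + apply (circle_param h 2); [rewrite Rabs_R1; lra |].
          intros z _. apply (Ch C_UniformSpace (fun y => y)), cts_id.
        + apply continuous_Rmult; [apply continuous_const |].
          apply continuous_Rminus; [apply continuous_const | apply continuous_id].
      - intros r Hr. unfold h.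
        assert (Cmr := ccont_mod _ (Cqr r)).
        assert (Cpr := rcont_rpow_mod _ p (ltac:(lra)) (Cqr r)).
        assert (C1 : rcont (fun t => p * (Cmod (quadratic a (RtoC r * cis t)) - 1))).
        { intros t. apply continuous_Rmult; [apply continuous_const |].
          apply continuous_Rminus; [apply Cmr | apply continuous_const]. }
        rewrite (Rmean_minus (fun t => rpow (Cmod (quadratic a (RtoC r * cis t))) p)
                  (fun t => 1 + p * (Cmod (quadratic a (RtoC r * cis t)) - 1)));
          [| exact Cpr | intros t; apply continuous_Rplus; [apply continuous_const | apply C1]].
        rewrite (Rmean_plus (fun _ => 1)), Rmean_const, Rmean_scal, Rmean_minus, Rmean_const;
          [| exact Cmr | intros t; apply continuous_const
           | intros t; apply continuous_Rminus; [apply Cmr | apply continuous_const]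
           | intros t; apply continuous_const | exact C1].
        assert (M1 : Rmean (fun t => rpow (Cmod (quadratic a (RtoC r * cis t))) p) <= 1).
        { eapply Rle_trans; [| apply (unit_norm_Mp_le p f r Hf Hr)].
          right. apply Rmean_ext. intros t. rewrite Qf by exact Hr. reflexivity. }
        pose proof (quadratic_mean_re a r Hr). nra. }
    assert (Z : h (cis be) = 0).
    { apply (Rmean_zero (fun t => h (cis t))).
      - intros t. apply (Ch R_UniformSpace cis), ccont_cis1.
      - intros t. rewrite Per. reflexivity.
      - intros t. apply Hh.
      - exact Mh. }
    assert (E1 : Cmod (quadratic a (cis be)) = 1).
    { apply (bernoulli_eq _ p); [apply Cmod_ge_0 | exact Hp1 | unfold h in Z; lra]. }
    rewrite Ww, Wv in E1. rewrite Rminus_diag, cos_0 in E1.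
    pose proof (Cmod_ge_0 a). rewrite Rabs_pos_eq in E1 by lra.
    apply Cmod_eq_0. lra.
Qed.

Lemma unit_norm_id p : 1 <= p -> unit_norm p f_gt1 /\ Cmod (C_derive f_gt1 0%C) = 1.
Proof.
  intros Hp.
  assert (E : forall r, 0 < r < 1 -> Mp p f_gt1 r = rpow r p).
  { intros r Hr. unfold Mp. rewrite (Rmean_ext _ (fun _ => rpow r p)); [apply Rmean_const |].
    intros t. unfold f_gt1. rewrite Cmod_mult, cis_mod, Cmod_R, Rabs_pos_eq, Rmult_1_r by lra. reflexivity. }
  split.
  - apply unit_norm_intro.
    + apply analytic_id.
    + intros r Hr. rewrite E by exact Hr. rewrite <- (rpow_1_l p). apply rpow_le; lra.
    + intros e He. set (d := Rmin (e / (2 * p)) (1 / 2)).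
      assert (0 < d) by (apply Rmin_pos; [apply Rdiv_lt_0_compat; lra | lra]).
      assert (d <= 1 / 2) by apply Rmin_r.
      assert (D : d <= e / (2 * p)) by apply Rmin_l.
      exists (1 - d). split; [lra |]. rewrite E by lra.
      eapply Rlt_le_trans; [| apply bernoulli; lra].
      apply (Rmult_le_compat_l p) in D; [| lra].
      replace (p * (e / (2 * p))) with (e / 2) in D by (field; lra). lra.
  - rewrite (C_derive_cderiv f_gt1 0%C 1%C); [apply Cmod_1 | apply cderiv_id].
Qed.

Lemma f_eq1_quadratic a z : 0 <= a <= 1 ->
  f_eq1 a z = (RtoC (a * sqrt (1 - a ^ 2)) + z + RtoC (a * sqrt (1 - a ^ 2)) * (z * z))%C.
Proof.
  intros Ha. unfold f_eq1. set (b := sqrt (1 - a ^ 2)).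
  assert (B2 : b * b = 1 - a ^ 2) by (apply sqrt_sqrt; nra).
  assert (E : (RtoC a * RtoC a + RtoC b * RtoC b = 1)%C).
  { rewrite <- !RtoC_mult, <- RtoC_plus. f_equal. rewrite B2. ring. }
  rewrite RtoC_mult.
  transitivity (RtoC a * RtoC b + (RtoC a * RtoC a + RtoC b * RtoC b) * z + RtoC a * RtoC b * (z * z))%C;
    [ring | rewrite E; ring].
Qed.

(** |f_a| = |a + b z| |b + a z| is at most the mean of the two squares. *)
Lemma unit_norm_f_eq1 a : 0 <= a <= 1 ->
  unit_norm 1 (f_eq1 a) /\ Cmod (C_derive (f_eq1 a) 0%C) = 1.
Proof.
  intros Ha. set (b := sqrt (1 - a ^ 2)).
  assert (B2 : b * b = 1 - a ^ 2) by (apply sqrt_sqrt; nra).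
  assert (B0 : 0 <= b) by apply sqrt_pos.
  set (q := RtoC (a * b)).
  assert (Eq : forall z, quadratic q z = f_eq1 a z).
  { intros z. rewrite (f_eq1_quadratic a z Ha). unfold quadratic.
    replace (Cconj q) with q by (unfold q; apply C_ext; simpl; ring). reflexivity. }
  assert (Eq' : forall r, Mp 1 (f_eq1 a) r = Rmean (fun t => Cmod (quadratic q (RtoC r * cis t)%C))).
  { intros r. apply Rmean_ext. intros t. rewrite rpow_1_r by apply Cmod_ge_0. rewrite Eq. reflexivity. }
  split.
  - apply unit_norm_intro.
    + intros z Hz. destruct (analytic_quadratic q 1 z Hz) as [d Hd].
      exists d. apply (cderiv_ext (quadratic q)); [exact Eq | exact Hd].
    + intros r Hr. rewrite Eq'.
      set (g1 := fun t => (RtoC a + RtoC (b * r) * cis t)%C).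
      set (g2 := fun t => (RtoC b + RtoC (a * r) * cis t)%C).
      assert (C1 : ccont g1) by (apply ccont_plus; [apply ccont_const | apply ccont_mult; [apply ccont_const | apply ccont_cis1]]).
      assert (C2 : ccont g2) by (apply ccont_plus; [apply ccont_const | apply ccont_mult; [apply ccont_const | apply ccont_cis1]]).
      apply Rle_trans with (Rmean (fun t => / 2 * (Cmod (g1 t) ^ 2 + Cmod (g2 t) ^ 2))).
      * apply Rmean_le.
        -- apply ccont_mod, ccont_circle. intros; apply cts_quadratic.
        -- intros t. apply continuous_Rmult; [apply continuous_const |].
           apply continuous_Rplus; [apply (rcont_sq _ C1) | apply (rcont_sq _ C2)].
        -- intros t. rewrite Eq. unfold f_eq1. fold b.
           replace ((a + b * (r * cis t)) * (b + a * (r * cis t)))%C with (g1 t * g2 t)%C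
             by (unfold g1, g2; rewrite !RtoC_mult; ring).
           rewrite Cmod_mult. pose proof (Rle_0_sqr (Cmod (g1 t) - Cmod (g2 t))) as K.
           unfold Rsqr in K. simpl. lra.
      * rewrite Rmean_scal by (intros t; apply continuous_Rplus; [apply (rcont_sq _ C1) | apply (rcont_sq _ C2)]).
        rewrite (Rmean_plus (fun t => Cmod (g1 t) ^ 2)) by (apply rcont_sq; assumption).
        fold (msq g1) (msq g2). unfold g1, g2. rewrite !msq_affine, !Cmod_R, !RPow_abs.
        rewrite !Rabs_pos_eq by apply pow2_ge_0.
        assert (r * r <= 1) by nra. 
        assert (Hab : a * a + b * b = 1) by (rewrite B2; ring).
        replace (a ^ 2 + (b * r) ^ 2 + (b ^ 2 + (a * r) ^ 2)) with ((a * a + b * b) * (1 + r * r)) by ring.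
        rewrite Hab. lra.
    + intros e He. exists (Rmax (1 / 2) (1 - e / 2)).
      assert (1 / 2 <= Rmax (1 / 2) (1 - e / 2)) by apply Rmax_l.
      assert (1 - e / 2 <= Rmax (1 / 2) (1 - e / 2)) by apply Rmax_r.
      assert (Rmax (1 / 2) (1 - e / 2) < 1) by (apply Rmax_lub_lt; lra).
      split; [lra |]. rewrite Eq'.
      eapply Rlt_le_trans; [| apply quadratic_mean_re; lra]. lra.
  - rewrite (C_derive_cderiv _ 0%C (0 + 1 + (0 * (0 * 0) + Cconj q * (1 * 0 + 0 * 1)))%C).
    + replace (0 + 1 + (0 * (0 * 0) + Cconj q * (1 * 0 + 0 * 1)))%C with (RtoC 1) by ring. apply Cmod_1.
    + apply (cderiv_ext (quadratic q)); [exact Eq |].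
      apply (cderiv_plus (fun z => q + z)%C (fun z => Cconj q * (z * z))%C).
      * apply cderiv_plus; [apply cderiv_const | apply cderiv_id].
      * apply (cderiv_mult (fun _ => Cconj q) (fun z => z * z)%C); [apply cderiv_const |].
        apply (cderiv_mult (fun z => z) (fun z => z)); apply cderiv_id.
Qed.

Lemma case_ge_1 p : 1 <= p ->
  const_C1 p = Finite 1 /\
  forall f, (1 < p -> (extremal p f <-> trivial_modification f_gt1 f)) /\
    (p = 1 -> (extremal p f <-> exists a, 0 <= a <= 1 /\ trivial_modification (f_eq1 a) f)).
Proof.
  intros Hp. destruct (unit_norm_id p Hp) as [U1 D1].
  destruct (extremal_problem p 1 f_gt1 (ltac:(lra)) U1 D1) as [E1 E2].
  { intros f Hf. apply (derive_le_1 p); assumption. }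
  split; [exact E1 |]. intros f. split.
  - intros Hp1. rewrite E2. split.
    + intros [Hf Hd]. destruct (extremal_form p f Hp Hf Hd) as [al [a [Ef [_ Ha]]]].
      specialize (Ha Hp1). subst a. exists al, 0. intros z Hz. rewrite (Ef z Hz).
      unfold quadratic, f_gt1. rewrite cis_0.
      replace (Cconj 0) with (RtoC 0) by (apply C_ext; simpl; ring). ring.
    + intros T. destruct (trivial_modification_invariant p f f_gt1 (ltac:(lra)) T U1) as [A B].
      split; [exact A | rewrite B; exact D1].
  - intros ->. rewrite E2. split.
    + intros [Hf Hd]. destruct (extremal_form 1 f Hp Hf Hd) as [al [q [Ef [Hq _]]]].
      destruct (fejer_riesz_parameter (Cmod q)) as [a [Ha Eab]].
      { split; [apply Cmod_ge_0 | exact Hq]. }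
      destruct (polar q) as [be Ebe].
      exists a. split; [exact Ha |]. exists (al + be), (- be).
      intros z Hz. change (Cmod z < 1) in Hz. rewrite (Ef z Hz), (f_eq1_quadratic a _ Ha), Eab.
      unfold quadratic. rewrite Ebe at 1 2. rewrite Cmult_conj, cis_conj.
      replace (Cconj (RtoC (Cmod q))) with (RtoC (Cmod q)) by (apply C_ext; simpl; ring).
      rewrite cis_plus.
      transitivity (cis al * (Cmod q * cis be + (cis be * cis (- be)) * z
        + Cmod q * ((cis be * cis (- be)) * cis (- be)) * (z * z)))%C; [| ring].
      rewrite cis_mult_opp. ring.
    + intros [a [Ha T]]. destruct (unit_norm_f_eq1 a Ha) as [U2 D2].
      destruct (trivial_modification_invariant 1 f (f_eq1 a) (ltac:(lra)) T U2) as [A B].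
      split; [exact A | rewrite B; exact D2].
Qed.

(** * Approximation by real parts of polynomials *)

Lemma reduce_mod_2PI (x y : R) : exists k : Z, - PI <= x + IZR k * (2 * PI) - y <= PI.
Proof.
  pose proof PI_RGT_0.
  exists (- Int_part ((x - y) / (2 * PI) + 1 / 2))%Z.
  destruct (base_Int_part ((x - y) / (2 * PI) + 1 / 2)) as [A B].
  rewrite opp_IZR. set (m := IZR (Int_part ((x - y) / (2 * PI) + 1 / 2))) in *.
  assert (E : x - y = (x - y) / (2 * PI) * (2 * PI)) by (field; lra).
  set (q := (x - y) / (2 * PI)) in *. nra.
Qed.

Lemma cis_chord (x : R) : Cmod (1 - cis x) ^ 2 = 2 - 2 * cos x.
Proof.
  rewrite Cmod2_alt. unfold cis; simpl. pose proof (sin2_cos2 x) as K. unfold Rsqr in K. lra.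
Qed.

(** The modulus of continuity of a periodic function in a form that can be
    integrated against the Poisson kernel, whose denominator |1 - rho e^(i x)|^2
    is at least rho |1 - e^(i x)|^2. *)
Lemma chord_modulus (u : R -> R) (e : R) : rcont u -> (forall t, u (t + 2 * PI) = u t) -> 0 < e ->
  exists A M, 0 <= A /\ 0 <= M /\ (forall t, Rabs (u t) <= M) /\
    forall s t, Rabs (u s - u t) <= e + A * Cmod (1 - cis (t - s)) ^ 2.
Proof.
  intros Hu Per He. pose proof PI_RGT_0.
  destruct (bounded_continuity u (- PI) PI) as [M HM]; [intros; apply Hu |].
  destruct (unifcont_normed_1d u (- (2 * PI)) (2 * PI)) with (eps := mkposreal e He) as [d Hd];
    [intros; apply Hu |].
  assert (BM : forall t, Rabs (u t) <= M).
  { intros t. destruct (reduce_mod_2PI t 0) as [k Hk].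
    rewrite <- (periodic_Z u Per k t). left. apply HM. lra. }
  assert (M0 : 0 <= M) by (eapply Rle_trans; [apply (Rabs_pos (u 0)) | apply BM]).
  set (dl := Rmin d PI).
  assert (D0 : 0 < dl) by (apply Rmin_pos; [apply cond_pos | lra]).
  assert (D1 : dl <= d) by apply Rmin_l. assert (D2 : dl <= PI) by apply Rmin_r.
  set (eta := 2 - 2 * cos dl).
  assert (He0 : 0 < eta).
  { unfold eta. assert (cos dl < cos 0) by (apply cos_decreasing_1; lra). rewrite cos_0 in *. lra. }
  exists (2 * M / eta), M. split; [| split; [exact M0 | split; [exact BM |]]].
  { apply Rmult_le_pos; [lra | left; apply Rinv_0_lt_compat, He0]. }
  intros s t.
  destruct (reduce_mod_2PI s 0) as [j Hj].
  set (s' := s + IZR j * (2 * PI)) in *.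
  destruct (reduce_mod_2PI t s') as [k Hk].
  set (t' := t + IZR k * (2 * PI)) in *.
  assert (Es : u s = u s') by (symmetry; apply periodic_Z, Per).
  assert (Et : u t = u t') by (symmetry; apply periodic_Z, Per).
  assert (Ec : cis (t - s) = cis (t' - s')).
  { unfold t', s'. replace (t + IZR k * (2 * PI) - (s + IZR j * (2 * PI)))
      with ((t - s) + IZR (k - j) * (2 * PI)) by (rewrite minus_IZR; ring).
    symmetry. apply (periodic_Z cis cis_2PI). }
  rewrite Es, Et, Ec. clear Es Et Ec.
  destruct (Rlt_le_dec (Rabs (s' - t')) dl) as [L|L].
  - assert (K : Rabs (u s' - u t') < e).
    { apply (Hd t' s'); [lra | lra |]. change (Rabs (s' - t') < d). lra. }
    assert (0 <= 2 * M / eta * Cmod (1 - cis (t' - s')) ^ 2).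
    { apply Rmult_le_pos; [| apply pow2_ge_0].
      apply Rmult_le_pos; [lra | left; apply Rinv_0_lt_compat, He0]. }
    lra.
  - assert (K : eta <= Cmod (1 - cis (t' - s')) ^ 2).
    { rewrite cis_chord. unfold eta.
      assert (cos (t' - s') <= cos dl); [| lra].
      replace (cos (t' - s')) with (cos (Rabs (s' - t'))).
      - destruct L as [L | <-]; [| lra]. left.
        assert (Rabs (s' - t') <= PI) by (apply Rabs_le; lra).
        apply cos_decreasing_1; lra.
      - unfold Rabs. destruct (Rcase_abs (s' - t')).
        + f_equal. ring.
        + rewrite <- cos_neg. f_equal. ring. }
    assert (T : Rabs (u s' - u t') <= 2 * M).
    { unfold Rminus. eapply Rle_trans; [apply Rabs_triang |]. rewrite Rabs_Ropp.
      pose proof (BM s'); pose proof (BM t'). lra. }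
    assert (2 * M <= 2 * M / eta * Cmod (1 - cis (t' - s')) ^ 2).
    { replace (2 * M) with (2 * M / eta * eta) at 1 by (field; lra).
      apply Rmult_le_compat_l; [| exact K].
      apply Rmult_le_pos; [lra | left; apply Rinv_0_lt_compat, He0]. }
    lra.
Qed.

(** Partial sums of (1 + rho z) / (1 - rho z), whose real part on the circle is
    the Poisson kernel. *)
Definition pcoef (rho : R) (k : nat) : R := match k with O => 1 | _ => 2 * rho ^ k end.

Definition pker (rho : R) (n : nat) (x : R) : C :=
  csum (fun k => RtoC (pcoef rho k) * cis (INR k * x))%C n.

Lemma pker_closed rho n x :
  (pker rho (S n) x * (1 - RtoC rho * cis x) =
   1 + RtoC rho * cis x - 2 * RtoC (rho ^ S n) * cis (INR (S n) * x))%C.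
Proof.
  induction n as [|n IH].
  - unfold pker. simpl. rewrite Rmult_0_l, Rmult_1_l, cis_0. rewrite Rmult_1_r. ring.
  - unfold pker in *.
    change (csum (fun k => RtoC (pcoef rho k) * cis (INR k * x))%C (S (S n)))
      with (csum (fun k => RtoC (pcoef rho k) * cis (INR k * x)) (S n)
        + RtoC (2 * rho ^ S n) * cis (INR (S n) * x))%C.
    rewrite Cmult_plus_distr_r, IH.
    rewrite (S_INR (S n)), Rmult_plus_distr_r, Rmult_1_l, cis_plus.
    replace (rho ^ S (S n)) with (rho ^ S n * rho) by (simpl; ring).
    rewrite !RtoC_mult. ring.
Qed.

Definition poisson (rho x : R) : R := (1 - rho ^ 2) / Cmod (1 - RtoC rho * cis x) ^ 2.

Lemma one_minus_rho_cis rho x : 0 < rho < 1 ->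
  1 - rho <= Cmod (1 - RtoC rho * cis x) /\
  rho * Cmod (1 - cis x) ^ 2 <= Cmod (1 - RtoC rho * cis x) ^ 2.
Proof.
  intros H.
  assert (E : Cmod (1 - RtoC rho * cis x) ^ 2 = (1 - rho) ^ 2 + rho * Cmod (1 - cis x) ^ 2).
  { rewrite cis_chord, Cmod2_alt. unfold cis; simpl.
    pose proof (sin2_cos2 x) as K. unfold Rsqr in K.
    replace (sin x * sin x) with (1 - cos x * cos x) in K by lra.
    assert (S : sin x * sin x = 1 - cos x * cos x) by (pose proof (sin2_cos2 x) as K2; unfold Rsqr in K2; lra).
    transitivity ((1 - rho * cos x) * (1 - rho * cos x) + rho * rho * (sin x * sin x)); [ring |].
    rewrite S. ring. }
  assert (0 <= rho * Cmod (1 - cis x) ^ 2) by (apply Rmult_le_pos; [lra | apply pow2_ge_0]).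
  split; [| rewrite E; pose proof (pow2_ge_0 (1 - rho)); lra].
  apply Rsqr_incr_0_var; [| apply Cmod_ge_0]. rewrite !Rsqr_pow2. lra.
Qed.

Lemma Re_div (a b : C) : b <> 0%C -> Re (a / b) = (Re a * Re b + Im a * Im b) / Cmod b ^ 2.
Proof.
  intros H. pose proof (Cnz_mod2 b H) as P. rewrite Cmod2_alt. destruct a, b; simpl in *. field. nra.
Qed.

Lemma pker_poisson rho n x : 0 < rho < 1 ->
  Rabs (Re (pker rho (S n) x) - poisson rho x) <= 2 * rho ^ S n / (1 - rho).
Proof.
  intros H. destruct (one_minus_rho_cis rho x H) as [L _].
  set (w := (1 - RtoC rho * cis x)%C) in *.
  assert (Hw : w <> 0%C) by (intros E; rewrite E, Cmod_0 in L; lra).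
  assert (E : (pker rho (S n) x = (1 + RtoC rho * cis x) / w
     - 2 * RtoC (rho ^ S n) * cis (INR (S n) * x) / w)%C).
  { replace (pker rho (S n) x) with (pker rho (S n) x * w / w)%C by (field; exact Hw).
    unfold w at 1. rewrite pker_closed. field. exact Hw. }
  assert (P : Re ((1 + RtoC rho * cis x) / w) = poisson rho x).
  { rewrite Re_div by exact Hw. unfold poisson. fold w. f_equal.
    unfold w, cis; simpl. pose proof (sin2_cos2 x) as K. unfold Rsqr in K.
    transitivity (1 - rho * rho * (sin x * sin x + cos x * cos x)); [ring | rewrite K; ring]. }
  rewrite E.
  match goal with |- Rabs (Re (?a - ?b)%C - _) <= _ => change (Re (a - b)%C) with (Re a - Re b) end.
  rewrite P. match goal with |- Rabs (?p - ?q - ?p) <= _ => replace (p - q - p) with (- q) by ring end.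
  rewrite Rabs_Ropp. eapply Rle_trans; [apply re_le_Cmod |].
  rewrite Cmod_div, !Cmod_mult, cis_mod, !Cmod_R by exact Hw.
  assert (0 < rho ^ S n) by (apply pow_lt; lra).
  rewrite !Rabs_pos_eq by lra. rewrite Rmult_1_r.
  apply Rmult_le_compat_l; [lra |]. apply Rinv_le_contravar; lra.
Qed.

Lemma ccont_pker_shift rho n t : ccont (fun s => pker rho n (t - s)).
Proof.
  unfold pker. apply (ccont_csum (fun k s => RtoC (pcoef rho k) * cis (INR k * (t - s)))%C).
  intros k. apply ccont_mult; [apply ccont_const |].
  intros s. apply cts_cis. apply continuous_Rmult; [apply continuous_const |].
  apply continuous_Rminus; [apply continuous_const | apply continuous_id].
Qed.

Definition cpoly (c : nat -> C) (n : nat) (z : C) : C := csum (fun k => c k * Cpow z k)%C n.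

Definition poisson_coef (rho : R) (u : R -> R) (k : nat) : C :=
  (RtoC (pcoef rho k) * fcoef (fun s => RtoC (u s)) (Z.of_nat k))%C.

(** Each term of the kernel at t - s is a function of t times a function of s. *)
Lemma poisson_poly rho (u : R -> R) n t : rcont u ->
  Re (cpoly (poisson_coef rho u) n (cis t)) = Rmean (fun s => u s * Re (pker rho n (t - s))).
Proof.
  intros Hu.
  assert (CU : ccont (fun s => RtoC (u s))) by (intros s; apply cts_RtoC, Hu).
  assert (E : cpoly (poisson_coef rho u) n (cis t) = Cmean (fun s => RtoC (u s) * pker rho n (t - s))%C).
  { rewrite (Cmean_ext _ (fun s => csum (fun k => (RtoC (pcoef rho k) * cis (INR k * t))
      * (RtoC (u s) * cis (- IZR (Z.of_nat k) * s))) n)%C).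
    - rewrite (Cmean_csum (fun k s => (RtoC (pcoef rho k) * cis (INR k * t))
      * (RtoC (u s) * cis (- IZR (Z.of_nat k) * s)))%C).
      + apply csum_ext. intros k _. rewrite Cmean_scal by (apply ccont_mul_cis, CU).
        unfold poisson_coef, fcoef. rewrite cis_pow. ring.
      + intros k. apply ccont_mult; [apply ccont_const | apply ccont_mul_cis, CU].
    - intros s. unfold pker. rewrite <- csum_scal. apply csum_ext. intros k _.
      rewrite <- INR_IZR_INZ. replace (INR k * (t - s)) with (INR k * t + - INR k * s) by ring.
      rewrite cis_plus. ring. }
  rewrite E, Cmean_re. apply Rmean_ext. intros s.
  set (w := pker rho n (t - s)). destruct w as [x y]. simpl. ring.
Qed.

(** The constant function 1 reproduces itself under [poisson_poly]. *)
Lemma pker_mean rho n t : Rmean (fun s => Re (pker rho (S n) (t - s))) = 1.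
Proof.
  transitivity (Rmean (fun s => (fun _ => 1) s * Re (pker rho (S n) (t - s)))).
  { apply Rmean_ext. intros; ring. }
  rewrite <- (poisson_poly rho (fun _ => 1)) by (intros s; apply continuous_const).
  unfold cpoly. replace (csum _ (S n)) with (RtoC 1); [reflexivity |].
  symmetry.
  assert (F : forall k, fcoef (fun _ => RtoC 1) (Z.of_nat k) = if Z.eq_dec 0 (Z.of_nat k) then 1%C else 0%C).
  { intros k. rewrite <- fcoef_cis. apply fcoef_ext. intros s.
    replace (IZR 0 * s) with 0 by (simpl; ring). rewrite cis_0. reflexivity. }
  induction n as [|n IH].
  - simpl. unfold poisson_coef. rewrite F. simpl. ring.
  - change (csum (fun k => poisson_coef rho (fun _ => 1) k * Cpow (cis t) k)%C (S (S n)))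
      with (csum (fun k => poisson_coef rho (fun _ => 1) k * Cpow (cis t) k) (S n)
         + poisson_coef rho (fun _ => 1) (S n) * Cpow (cis t) (S n))%C.
    rewrite IH. unfold poisson_coef. rewrite F.
    destruct (Z.eq_dec 0 (Z.of_nat (S n))); [lia | ring].
Qed.

(** Convolution with the Poisson kernel for rho close to 1, truncated late. *)
Lemma real_part_approx (u : R -> R) (e : R) :
  rcont u -> (forall t, u (t + 2 * PI) = u t) -> 0 < e ->
  exists n c, Im (c O) = 0 /\
    forall t, Rabs (Re (cpoly c n (cis t)) - u t) <= e.
Proof.
  intros Hu Per He.
  destruct (chord_modulus u (e / 4) Hu Per) as [A [M [HA [HM [BM Mod]]]]]; [lra |].
  (* d = 1 - rho controls the concentration of the kernel, m its truncation. *)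
  set (d := Rmin (1 / 2) (e / (16 * (A + 1)))).
  assert (Hd0 : 0 < d) by (apply Rmin_pos; [lra | apply Rdiv_lt_0_compat; lra]).
  assert (Hd1 : d <= 1 / 2) by apply Rmin_l.
  assert (Hd2 : d <= e / (16 * (A + 1))) by apply Rmin_r.
  set (rho := 1 - d). assert (Hr : 0 < rho < 1) by (unfold rho; lra).
  set (m := Rmin 1 (e / (8 * (M + 1)))).
  assert (Hm0 : 0 < m) by (apply Rmin_pos; [lra | apply Rdiv_lt_0_compat; lra]).
  assert (Hm1 : m <= 1) by apply Rmin_l.
  assert (Hm2 : m <= e / (8 * (M + 1))) by apply Rmin_r.
  destruct (pow_lt_1_zero rho) with (y := m * d / 2) as [N HN].
  { rewrite Rabs_pos_eq; lra. }
  { assert (0 < m * d) by (apply Rmult_lt_0_compat; assumption). lra. }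
  set (dn := 2 * rho ^ S N / (1 - rho)).
  assert (Hdn : 0 <= dn <= m).
  { specialize (HN (S N) (Nat.le_succ_diag_r N)).
    assert (0 < rho ^ S N) by (apply pow_lt; lra).
    rewrite Rabs_pos_eq in HN by lra. unfold dn. replace (1 - rho) with d by (unfold rho; ring).
    split; [apply Rmult_le_pos; [lra | left; apply Rinv_0_lt_compat, Hd0] |].
    apply (Rmult_le_reg_r d); [exact Hd0 |].
    unfold Rdiv. rewrite Rmult_assoc, Rinv_l by lra. lra. }
  exists (S N), (poisson_coef rho u). split.
  { unfold poisson_coef, fcoef. simpl.
    assert (Z : Rmean (fun s => u s * sin (- 0 * s) + 0 * cos (- 0 * s)) = 0).
    { transitivity (Rmean (fun _ => 0)); [| apply Rmean_const]. apply Rmean_ext. intros s.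
      replace (- 0 * s) with 0 by ring. rewrite sin_0. ring. }
    simpl. rewrite Z. ring. }
  intros t. rewrite poisson_poly by exact Hu.
  assert (CK : rcont (fun s => Re (pker rho (S N) (t - s)))) by (apply ccont_re, ccont_pker_shift).
  assert (CuK : rcont (fun s => u s * Re (pker rho (S N) (t - s))))
    by (intros s; apply continuous_Rmult; [apply Hu | apply CK]).
  assert (Cd : rcont (fun s => (u s - u t) * Re (pker rho (S N) (t - s)))).
  { intros s; apply continuous_Rmult; [apply continuous_Rminus; [apply Hu | apply continuous_const] | apply CK]. }
  replace (Rmean (fun s => u s * Re (pker rho (S N) (t - s))) - u t)
    with (Rmean (fun s => (u s - u t) * Re (pker rho (S N) (t - s)))).
  2: { rewrite (Rmean_ext _ (fun s => u s * Re (pker rho (S N) (t - s)) - u t * Re (pker rho (S N) (t - s))))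
         by (intros; ring).
       rewrite Rmean_minus, Rmean_scal, pker_mean; [ring | exact CK | exact CuK |].
       intros s; apply continuous_Rmult; [apply continuous_const | apply CK]. }
  set (b := e / 4 + A * (4 * d) + 2 * M * dn).
  (* Pointwise: the kernel differs from a nonnegative one by at most dn. *)
  assert (Pt : forall s, Rabs ((u s - u t) * Re (pker rho (S N) (t - s))) <=
     e / 4 * Re (pker rho (S N) (t - s)) + (e / 4 * dn + A * (4 * d) + 2 * M * dn)).
  { intros s. set (K := Re (pker rho (S N) (t - s))).
    pose proof (pker_poisson rho N (t - s) Hr) as PK. fold dn in PK. fold K in PK.
    destruct (one_minus_rho_cis rho (t - s) Hr) as [L1 L2].
    set (Q := Cmod (1 - RtoC rho * cis (t - s))) in *.
    assert (Q0 : 0 < Q) by lra. assert (Q2 : 0 < Q ^ 2) by (apply pow_lt, Q0).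
    set (P := poisson rho (t - s)) in *.
    assert (P0 : 0 <= P).
    { unfold P, poisson. fold Q. apply Rmult_le_pos; [nra | left; apply Rinv_0_lt_compat, Q2]. }
    assert (PQ : P * Cmod (1 - cis (t - s)) ^ 2 <= 4 * d).
    { unfold P, poisson. fold Q.
      apply (Rmult_le_reg_r (Q ^ 2)); [exact Q2 |].
      replace ((1 - rho ^ 2) / Q ^ 2 * Cmod (1 - cis (t - s)) ^ 2 * Q ^ 2)
        with ((1 - rho ^ 2) * Cmod (1 - cis (t - s)) ^ 2) by (field; lra).
      set (X := Cmod (1 - cis (t - s)) ^ 2) in *.
      assert (X0 : 0 <= X) by apply pow2_ge_0.
      assert (1 - rho ^ 2 <= 4 * d * rho) by (unfold rho; nra).
      apply Rle_trans with (4 * d * rho * X); [apply Rmult_le_compat_r; assumption |].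
      rewrite Rmult_assoc. apply Rmult_le_compat_l; [lra | exact L2]. }
    specialize (Mod s t).
    assert (Bd : Rabs (u s - u t) <= 2 * M).
    { unfold Rminus. eapply Rle_trans; [apply Rabs_triang |]. rewrite Rabs_Ropp.
      pose proof (BM s); pose proof (BM t). lra. }
    rewrite Rabs_mult.
    assert (KP : Rabs K <= P + dn).
    { replace K with ((K - P) + P) by ring. eapply Rle_trans; [apply Rabs_triang |].
      rewrite (Rabs_pos_eq P) by exact P0. lra. }
    assert (PK2 : P <= K + dn) by (apply Rabs_le_between in PK; lra).
    pose proof (Rabs_pos (u s - u t)) as U0.
    apply Rle_trans with (Rabs (u s - u t) * P + Rabs (u s - u t) * dn).
    { rewrite <- Rmult_plus_distr_l. apply Rmult_le_compat_l; assumption. }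
    assert (T1 : Rabs (u s - u t) * P <= (e / 4 + A * Cmod (1 - cis (t - s)) ^ 2) * P)
      by (apply Rmult_le_compat_r; assumption).
    assert (T2 : Rabs (u s - u t) * dn <= 2 * M * dn) by (apply Rmult_le_compat_r; lra).
    assert (T3 : A * (P * Cmod (1 - cis (t - s)) ^ 2) <= A * (4 * d)) by (apply Rmult_le_compat_l; assumption).
    assert (T4 : e / 4 * P <= e / 4 * (K + dn)) by (apply Rmult_le_compat_l; lra).
    lra. }
  apply Rle_trans with (Rmean (fun s => e / 4 * Re (pker rho (S N) (t - s)) + (e / 4 * dn + A * (4 * d) + 2 * M * dn))).
  - assert (CR : rcont (fun s => e / 4 * Re (pker rho (S N) (t - s)) + (e / 4 * dn + A * (4 * d) + 2 * M * dn))).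
    { intros s; apply continuous_Rplus; [| apply continuous_const].
      apply continuous_Rmult; [apply continuous_const | apply CK]. }
    apply Rabs_le. split.
    + apply Ropp_le_cancel. rewrite Ropp_involutive.
      replace (- Rmean (fun s => (u s - u t) * Re (pker rho (S N) (t - s))))
        with ((-1) * Rmean (fun s => (u s - u t) * Re (pker rho (S N) (t - s)))) by ring.
      rewrite <- Rmean_scal by exact Cd. apply Rmean_le.
      * intros s; apply continuous_Rmult; [apply continuous_const | apply Cd].
      * exact CR.
      * intros s. specialize (Pt s). apply Rabs_le_between in Pt. lra.
    + apply Rmean_le; [exact Cd | exact CR |].
      intros s. specialize (Pt s). apply Rabs_le_between in Pt. lra.
  - rewrite (Rmean_plus (fun s => e / 4 * Re (pker rho (S N) (t - s)))), Rmean_const, Rmean_scal, pker_mean;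
      [| exact CK | intros s; apply continuous_Rmult; [apply continuous_const | apply CK]
       | intros s; apply continuous_const].
    assert (A * d <= e / 16).
    { apply Rle_trans with ((A + 1) * (e / (16 * (A + 1)))); [apply Rmult_le_compat; lra |].
      right. field. lra. }
    assert (M * dn <= e / 8).
    { apply Rle_trans with ((M + 1) * (e / (8 * (M + 1)))); [apply Rmult_le_compat; lra |].
      right. field. lra. }
    assert (e / 4 * dn <= e / 4 * 1) by (apply Rmult_le_compat_l; lra).
    lra.
Qed.

(** The exponential of L plays the role of the outer factor of F.  Adding a
    constant to |F|^p makes its logarithm continuous at the zeros of F. *)
Lemma outer_majorant (F : C -> C) (rho p : R) :
  0 < p -> 1 < rho -> analytic rho F -> Rmean (fun t => rpow (Cmod (F (cis t))) p) < 1 ->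
  exists n c, Im (c O) = 0 /\
    (forall t, rpow (Cmod (F (cis t))) p <= exp (2 * Re (cpoly c n (cis t)))) /\
    Rmean (fun t => exp (2 * Re (cpoly c n (cis t)))) <= 1.
Proof.
  intros Hp Hrho HF HN.
  assert (CF := analytic_ccont F rho Hrho HF).
  assert (CP := rcont_rpow_mod _ p Hp CF).
  set (N := Rmean (fun t => rpow (Cmod (F (cis t))) p)) in *.
  assert (N0 : 0 <= N) by (apply Rmean_ge0; [exact CP | intros; apply rpow_ge0, Cmod_ge_0]).
  set (eta := (1 - N) / 2).
  set (w := fun t => rpow (Cmod (F (cis t))) p + eta).
  assert (W0 : forall t, 0 < w t).
  { intros t. pose proof (rpow_ge0 (Cmod (F (cis t))) p (Cmod_ge_0 _)). unfold w, eta. lra. }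
  assert (Cw : rcont w) by (intros t; apply continuous_Rplus; [apply CP | apply continuous_const]).
  assert (Mw : Rmean w = N + eta).
  { unfold w. rewrite (Rmean_plus (fun t => rpow (Cmod (F (cis t))) p)), Rmean_const;
      [reflexivity | exact CP | intros t; apply continuous_const]. }
  assert (Hq : 0 < N + eta < 1) by (unfold eta; lra).
  (* The approximation loses a factor exp(2 e), which the gap N + eta < 1 absorbs. *)
  set (e := - ln (N + eta) / 2).
  assert (He : 0 < e).
  { unfold e. assert (ln (N + eta) < ln 1) by (apply ln_increasing; lra). rewrite ln_1 in *. lra. }
  destruct (real_part_approx (fun t => / 2 * (ln (w t) + e)) (e / 2)) as [n [c [Hc Happ]]].
  - intros t. apply continuous_Rmult; [apply continuous_const |].
    apply continuous_Rplus; [| apply continuous_const].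
    apply (continuous_Rfun ln); [apply Cw |].
    apply derivable_continuous_pt. exists (/ w t). apply derivable_pt_lim_ln, W0.
  - intros t. unfold w. rewrite cis_2PI. reflexivity.
  - lra.
  - exists n, c. split; [exact Hc |].
    assert (Low : forall t, ln (w t) <= 2 * Re (cpoly c n (cis t)) <= ln (w t) + 2 * e).
    { intros t. specialize (Happ t). apply Rabs_le_between in Happ. lra. }
    split.
    + intros t. apply Rle_trans with (w t).
      * unfold w, eta. lra.
      * rewrite <- (exp_ln (w t)) at 1 by apply W0.
        destruct (Low t) as [[L | L] _]; [left; apply exp_increasing, L | rewrite L; lra].
    + assert (E2 : (N + eta) * exp (2 * e) = 1).
      { rewrite <- (exp_ln (N + eta)) at 1 by lra. rewrite <- exp_plus.
        replace (ln (N + eta) + 2 * e) with 0 by (unfold e; field). apply exp_0. }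
      rewrite <- E2, <- Mw, Rmult_comm, <- Rmean_scal by exact Cw.
      apply Rmean_le.
      * intros t. apply (continuous_Rfun exp).
        -- apply continuous_Rmult; [apply continuous_const |].
           apply (cts_re (fun t => cpoly c n (cis t))).
           apply (ccont_csum (fun k t => c k * Cpow (cis t) k)%C).
           intros k. apply ccont_mult; [apply ccont_const |].
           intros x. apply (continuous_ext (fun t => cis (INR k * t))).
           ++ intros y. rewrite cis_pow. reflexivity.
           ++ apply ccont_cis.
        -- apply derivable_continuous_pt, derivable_pt_exp.
      * intros t. apply continuous_Rmult; [apply continuous_const | apply Cw].
      * intros t. rewrite <- (exp_ln (w t)) by apply W0. rewrite <- exp_plus.
        destruct (Low t) as [_ [L | L]]; [left; apply exp_increasing; lra | rewrite L; right; f_equal; ring].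
Qed.

(** * Factorization and the resulting coefficient inequalities *)

(** Schwarz-Pick at the origin, from Bessel's inequality for B(z) (1 + lam z): the choice
    lam = conj(b0) b1 / (1 - |b0|^2) is the optimal one. *)
Lemma schwarz_pick (B : C -> C) (rho : R) : 1 < rho -> analytic rho B ->
  (forall t, Cmod (B (cis t)) <= 1) ->
  Cmod (coef B 1) <= 1 - Cmod (coef B 0) ^ 2.
Proof.
  intros Hrho HB Hle.
  assert (CB := analytic_ccont B rho Hrho HB).
  set (b0 := coef B 0). set (b1 := coef B 1).
  assert (Bes : forall lam : C, Cmod b0 ^ 2 + Cmod (b1 + lam * b0)%C ^ 2 <= 1 + Cmod lam ^ 2).
  { intros lam.
    set (g := fun t => (B (cis t) + lam * (cis (IZR 1 * t) * B (cis t)))%C).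
    assert (C1 : ccont (fun t => cis (IZR 1 * t) * B (cis t))%C) by (apply ccont_mult; [apply ccont_cis | exact CB]).
    assert (C2 : ccont (fun t => lam * (cis (IZR 1 * t) * B (cis t)))%C) by (apply ccont_mult; [apply ccont_const | exact C1]).
    assert (Cg : ccont g) by (apply ccont_plus; assumption).
    assert (Fg : forall k, fcoef g k = (coef B k + lam * coef B (k - 1))%C).
    { intros k. unfold g. rewrite (fcoef_plus (fun t => B (cis t))) by assumption.
      rewrite fcoef_scal by exact C1. rewrite fcoef_shift. reflexivity. }
    assert (F0 : fcoef g 0 = b0).
    { rewrite Fg. rewrite (coef_neg B rho (0 - 1) Hrho HB) by lia. unfold b0. ring. }
    assert (F1 : fcoef g 1 = (b1 + lam * b0)%C) by (rewrite Fg; reflexivity).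
    pose proof (bessel2 g 0 1 Cg (ltac:(lia))) as K. rewrite F0, F1 in K.
    eapply Rle_trans; [exact K |].
    assert (C3 : ccont (fun t => 1 + lam * cis t)%C)
      by (apply ccont_plus; [apply ccont_const | apply ccont_mult; [apply ccont_const | apply ccont_cis1]]).
    apply Rle_trans with (Rmean (fun t => Cmod (1 + lam * cis t)%C ^ 2)).
    - apply Rmean_le; [apply rcont_sq, Cg | apply (rcont_sq _ C3) |].
      intros t. unfold g. replace (IZR 1 * t) with t by (simpl; ring).
      replace (B (cis t) + lam * (cis t * B (cis t)))%C with ((1 + lam * cis t) * B (cis t))%C by ring.
      rewrite Cmod_mult. apply pow_incr. split; [apply Rmult_le_pos; apply Cmod_ge_0 |].
      specialize (Hle t). pose proof (Cmod_ge_0 (1 + lam * cis t)).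
      rewrite <- (Rmult_1_r (Cmod (1 + lam * cis t))) at 2. apply Rmult_le_compat_l; assumption.
    - change (Rmean (fun t => Cmod (1 + lam * cis t)%C ^ 2)) with (msq (fun t => 1 + lam * cis t)%C).
      rewrite msq_affine, Cmod_1. lra. }
  set (q := Cmod b0 ^ 2) in *. set (x := Cmod b1).
  assert (Q0 : 0 <= q) by apply pow2_ge_0. assert (X0 : 0 <= x) by apply Cmod_ge_0.
  assert (K : forall tau, q + x ^ 2 * (1 + tau * q) ^ 2 <= 1 + tau ^ 2 * q * x ^ 2).
  { intros tau. specialize (Bes (RtoC tau * (Cconj b0 * b1))%C).
    replace (b1 + tau * (Cconj b0 * b1) * b0)%C with (b1 * RtoC (1 + tau * q))%C in Bes.
    - rewrite !Cmod_mult, !Cmod_R, Cmod_conj, !Rpow_mult_distr, !RPow_abs in Bes.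
      rewrite !(Rabs_pos_eq (_ ^ 2)) in Bes by apply pow2_ge_0. fold q x in Bes. lra.
    - rewrite RtoC_plus, RtoC_mult. unfold q.
      replace (RtoC (Cmod b0 ^ 2)) with (b0 * Cconj b0)%C by (symmetry; apply Cmod2_conj). ring. }
  assert (Q1 : q <= 1).
  { specialize (K 0). rewrite Rmult_0_l in K. pose proof (pow2_ge_0 x).
    replace (0 ^ 2 * q * x ^ 2) with 0 in K by (simpl; ring). nra. }
  destruct (Rle_lt_or_eq_dec q 1 Q1) as [L | E].
  - specialize (K (/ (1 - q))).
    assert (E1 : 1 + / (1 - q) * q = / (1 - q)) by (field; lra).
    rewrite E1 in K.
    assert (E2 : x ^ 2 * (/ (1 - q)) ^ 2 - (/ (1 - q)) ^ 2 * q * x ^ 2 = x ^ 2 / (1 - q)) by (field; lra).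
    assert (K2 : x ^ 2 / (1 - q) <= 1 - q) by lra.
    apply Rle_div_l in K2; [| lra].
    apply Rsqr_incr_0_var; [| lra]. rewrite !Rsqr_pow2. lra.
  - specialize (K 0). rewrite E, Rmult_0_l in K. 
    replace (0 ^ 2 * 1 * x ^ 2) with 0 in K by (simpl; ring).
    assert (x ^ 2 <= 0) by nra. assert (x = 0) by nra. lra.
Qed.

(** Coefficients of F = B G, G = h^s, with B bounded by 1 and h in the unit
    ball of H^2; the last clause is z G' h = s z G h'. *)
Record factored (s : R) (F b g h : nat -> C) (c : R) : Prop := {
  fac_prod : forall k, F k = csum (fun j => b j * g (k - j)%nat)%C (S k);
  fac_h0 : h O = RtoC c;
  fac_c : 0 < c;
  fac_g0 : g O = RtoC (Rpower c s);
  fac_b1 : Cmod (b 1%nat) <= 1 - Cmod (b O) ^ 2;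
  fac_bk : forall k, (1 <= k)%nat -> Cmod (b O) ^ 2 + Cmod (b k) ^ 2 <= 1;
  fac_h1 : c ^ 2 + Cmod (h 1%nat) ^ 2 <= 1;
  fac_hk : forall k, (2 <= k)%nat -> c ^ 2 + Cmod (h 1%nat) ^ 2 + Cmod (h k) ^ 2 <= 1;
  fac_ode : forall k, csum (fun j => RtoC (INR j) * g j * h (k - j)%nat)%C (S k) =
     csum (fun j => RtoC s * g j * (RtoC (INR (k - j)) * h (k - j)%nat))%C (S k)
}.

Lemma cpoly_derive (c : nat -> C) n : exists D, (forall rho, analytic rho D) /\
  forall z, cderiv (cpoly c n) z (D z).
Proof.
  induction n as [|n [D [AD HD]]].
  - exists (fun _ => 0%C). split; [intros; apply analytic_const | intros z; apply cderiv_const].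
  - exists (fun z => D z + c n * (INR n * Cpow z (pred n)))%C. split.
    + intros rho. apply analytic_plus; [apply AD |].
      apply analytic_mult; [apply analytic_const |].
      apply analytic_mult; [apply analytic_const | apply analytic_pow].
    + intros z. apply (cderiv_plus (cpoly c n) (fun z => c n * Cpow z n)%C); [apply HD |].
      apply cderiv_scal, cderiv_pow.
Qed.

Lemma cpoly_0 c n : cpoly c n 0%C = match n with O => 0%C | _ => c O end.
Proof.
  destruct n as [|n]; [reflexivity |]. induction n as [|n IH].
  - unfold cpoly; simpl. ring.
  - change (cpoly c (S (S n)) 0%C) with (cpoly c (S n) 0 + c (S n) * Cpow 0 (S n))%C.
    rewrite IH. simpl. ring.
Qed.

Lemma Re_scal (a : R) (z : C) : Re (RtoC a * z) = a * Re z.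
Proof. destruct z; simpl; ring. Qed.

Lemma coef_nat_S (k : nat) : IZR (Z.of_nat k) = INR k.
Proof. symmetry. apply INR_IZR_INZ. Qed.

(** With L from [outer_majorant]: h = exp L, G = exp(s L) and B = F / G. *)
Lemma factorization (F : C -> C) (rho p : R) :
  0 < p -> 1 < rho -> analytic rho F -> Rmean (fun t => rpow (Cmod (F (cis t))) p) < 1 ->
  exists b g h c, factored (2 / p) (fun k => coef F (Z.of_nat k)) b g h c.
Proof.
  intros Hp Hrho HF HM.
  destruct (outer_majorant F rho p Hp Hrho HF HM) as [n [cc [Hc [Dom Mean]]]].
  set (s := 2 / p). set (L := cpoly cc n) in *.
  destruct (cpoly_derive cc n) as [D [AD HD]]. fold L in HD.
  assert (AL : analytic rho L) by (intros z _; exists (D z); apply HD).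
  set (h := fun z => Cexp (L z)).
  set (G := fun z => Cexp (RtoC s * L z)).
  set (B := fun z => (F z * Cexp (RtoC (- s) * L z))%C).
  assert (Ah : analytic rho h) by (apply analytic_Cexp, AL).
  assert (AG : analytic rho G) by (apply analytic_Cexp, analytic_mult; [apply analytic_const | exact AL]).
  assert (AB : analytic rho B)
    by (apply analytic_mult; [exact HF |]; apply analytic_Cexp, analytic_mult; [apply analytic_const | exact AL]).
  assert (Ch := analytic_ccont h rho Hrho Ah). assert (CB := analytic_ccont B rho Hrho AB).
  set (h1 := fun z => (h z * D z)%C). set (G1 := fun z => (G z * (RtoC s * D z))%C).
  assert (Dh : forall z, cderiv h z (h1 z)) by (intros z; apply (cderiv_comp Cexp L); [apply cderiv_Cexp | apply HD]).
  assert (DG : forall z, cderiv G z (G1 z))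
    by (intros z; apply (cderiv_comp Cexp (fun z => RtoC s * L z)%C); [apply cderiv_Cexp | apply cderiv_scal, HD]).
  assert (Ah1 : analytic rho h1) by (apply analytic_mult; [exact Ah | apply AD]).
  assert (AG1 : analytic rho G1)
    by (apply analytic_mult; [exact AG | apply analytic_mult; [apply analytic_const | apply AD]]).
  assert (FBG : forall z, F z = (B z * G z)%C).
  { intros z. unfold B, G. rewrite RtoC_opp.
    replace (- s * L z)%C with (- (s * L z))%C by ring.
    rewrite <- Cmult_assoc, (Cmult_comm (Cexp (- (s * L z)))), Cexp_opp. ring. }
  assert (B1 : forall t, Cmod (B (cis t)) <= 1).
  { intros t. unfold B. rewrite Cmod_mult, Cexp_mod.
    replace (Re (RtoC (- s) * L (cis t))%C) with (- (s * Re (L (cis t)))) by (rewrite Re_scal; ring).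
    rewrite exp_Ropp. pose proof (exp_pos (s * Re (L (cis t)))) as E0.
    apply (Rmult_le_reg_r (exp (s * Re (L (cis t))))); [exact E0 |].
    rewrite Rmult_assoc, Rinv_l, Rmult_1_r, Rmult_1_l by lra.
    assert (K := rpow_le _ _ (/ p) (Rinv_0_lt_compat _ Hp) (rpow_ge0 _ p (Cmod_ge_0 _)) (Dom t)).
    rewrite rpow_comp, Rinv_r, rpow_1_r in K by (try apply Cmod_ge_0; lra).
    rewrite rpow_pos in K by apply exp_pos. unfold Rpower in K. rewrite ln_exp in K.
    replace (/ p * (2 * Re (L (cis t)))) with (s * Re (L (cis t))) in K by (unfold s; field; lra).
    exact K. }
  assert (Mh : msq (fun t => h (cis t)) <= 1).
  { eapply Rle_trans; [| exact Mean]. right. apply Rmean_ext. intros t.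
    unfold h. rewrite Cexp_mod. simpl. rewrite Rmult_1_r, <- exp_plus. f_equal. ring. }
  assert (MB : msq (fun t => B (cis t)) <= 1).
  { rewrite <- (Rmean_const 1). apply Rmean_le; [apply rcont_sq, CB | intros t; apply continuous_const |].
    intros t. specialize (B1 t). pose proof (Cmod_ge_0 (B (cis t))). simpl. nra. }
  assert (L0 : exists x, L 0%C = RtoC x).
  { unfold L. rewrite cpoly_0. destruct n as [|n'].
    - exists 0. reflexivity.
    - exists (Re (cc O)). apply C_ext; [reflexivity | exact Hc]. }
  destruct L0 as [l0 L0].
  set (c := exp l0).
  assert (H0 : coef h 0 = RtoC c).
  { rewrite (coef_0 h rho Hrho Ah). unfold h. rewrite L0, Cexp_R. reflexivity. }
  exists (fun k => coef B (Z.of_nat k)), (fun k => coef G (Z.of_nat k)), (fun k => coef h (Z.of_nat k)), c.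
  assert (NZ : forall k : nat, (1 <= k)%nat -> 0%Z <> Z.of_nat k) by (intros; lia).
  split.
  - intros k. rewrite (coef_ext F (fun z => B z * G z)%C) by (intros; apply FBG).
    apply (coef_mult B G rho k Hrho AB AG).
  - exact H0.
  - apply exp_pos.
  - simpl Z.of_nat. rewrite (coef_0 G rho Hrho AG). unfold G.
    rewrite L0, <- RtoC_mult, Cexp_R. unfold Rpower, c. rewrite ln_exp. reflexivity.
  - apply (schwarz_pick B rho Hrho AB B1).
  - intros k Hk. eapply Rle_trans; [| exact MB].
    apply (bessel2 (fun t => B (cis t)) 0 (Z.of_nat k) CB (NZ k Hk)).
  - eapply Rle_trans; [| exact Mh].
    pose proof (bessel2 (fun t => h (cis t)) 0 1 Ch (ltac:(lia))) as K.
    fold (coef h 0) in K. rewrite H0, Cmod_R, Rabs_pos_eq in K by (left; apply exp_pos). exact K.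
  - intros k Hk. eapply Rle_trans; [| exact Mh].
    pose proof (bessel3 (fun t => h (cis t)) 0 1 (Z.of_nat k) Ch (ltac:(lia)) (ltac:(lia)) (ltac:(lia))) as K.
    fold (coef h 0) in K. rewrite H0, Cmod_R, Rabs_pos_eq in K by (left; apply exp_pos). exact K.
  - intros k.
    assert (KG : forall j : nat, coef (fun z => z * G1 z)%C (Z.of_nat j) = (RtoC (INR j) * coef G (Z.of_nat j))%C).
    { intros j. rewrite <- coef_nat_S. apply coef_deriv; [intros z _; apply DG |].
      apply (analytic_ccont G1 rho Hrho AG1). }
    assert (Kh : forall j : nat, coef (fun z => z * h1 z)%C (Z.of_nat j) = (RtoC (INR j) * coef h (Z.of_nat j))%C).
    { intros j. rewrite <- coef_nat_S. apply coef_deriv; [intros z _; apply Dh |].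
      apply (analytic_ccont h1 rho Hrho Ah1). }
    assert (AzG : analytic rho (fun z => z * G1 z)%C) by (apply analytic_mult; [apply analytic_id | exact AG1]).
    assert (Azh : analytic rho (fun z => z * h1 z)%C) by (apply analytic_mult; [apply analytic_id | exact Ah1]).
    assert (AsG : analytic rho (fun z => RtoC s * G z)%C) by (apply analytic_mult; [apply analytic_const | exact AG]).
    assert (E1 := coef_mult _ _ rho k Hrho AzG Ah).
    assert (E2 := coef_mult _ _ rho k Hrho AsG Azh).
    rewrite (coef_ext _ (fun z => RtoC s * G z * (z * h1 z))%C) in E1
      by (intros z _; unfold G1, h1; ring).
    rewrite (csum_ext _ (fun j => coef (fun z => z * G1 z)%C (Z.of_nat j) * coef h (Z.of_nat (k - j)))%C)
      by (intros j _; rewrite KG; ring).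
    rewrite <- E1, E2. apply csum_ext. intros j _. rewrite Kh. f_equal.
    unfold coef at 1. rewrite fcoef_scal by (apply (analytic_ccont G rho Hrho AG)). reflexivity.
Qed.

(** * The extremal problem in the coefficients *)

(** F_1 = b_0 g_1 + b_1 g_0, where |g_1| = s c^(s-1) |h_1| by the differential
    equation and |b_1| by Schwarz-Pick. *)
Lemma factored_derive_bound s F b g h c : 0 <= s -> factored s F b g h c ->
  Cmod (F 1%nat) <= (1 - Cmod (b O) ^ 2) * Rpower c s
     + Cmod (b O) * (s * Rpower c (s - 1) * Cmod (h 1%nat)).
Proof.
  intros Hs [P H0 Hc G0 B1 _ _ _ Ode].
  specialize (P 1%nat). specialize (Ode 1%nat). simpl in P, Ode.
  rewrite H0 in Ode.
  assert (Cn : RtoC c <> 0%C) by (intros E; apply RtoC_inj in E; lra).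
  assert (E : g 1%nat = (RtoC (s * Rpower c (s - 1)) * h 1%nat)%C).
  { replace (g 1%nat) with (g 1%nat * RtoC c / RtoC c)%C by (field; exact Cn).
    replace (g 1%nat * RtoC c)%C with (RtoC s * g O * h 1%nat)%C.
    - rewrite G0. replace s with ((s - 1) + 1) at 2 by ring.
      rewrite Rpower_plus, Rpower_1, !RtoC_mult by exact Hc. field. exact Cn.
    - transitivity (0 + RtoC s * g O * (1 * h 1%nat) + RtoC s * g 1%nat * (0 * RtoC c))%C; [ring |].
      rewrite <- Ode. ring. }
  rewrite P, E, G0.
  assert (R0 : 0 < Rpower c s) by apply exp_pos. assert (R1 : 0 < Rpower c (s - 1)) by apply exp_pos.
  replace (0 + b O * (RtoC (s * Rpower c (s - 1)) * h 1%nat) + b 1%nat * RtoC (Rpower c s))%C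
    with (b 1%nat * RtoC (Rpower c s) + b O * (RtoC (s * Rpower c (s - 1)) * h 1%nat))%C by ring.
  eapply Rle_trans; [apply Cmod_triangle |]. rewrite !Cmod_mult, !Cmod_R.
  rewrite (Rabs_pos_eq (Rpower c s)), (Rabs_pos_eq (s * Rpower c (s - 1))) by (try apply Rmult_le_pos; lra).
  apply Rplus_le_compat_r. apply Rmult_le_compat_r; lra.
Qed.

(** * The maximization in real variables *)

(** The maximizer (cstar, xstar) of s c^(s-1) x on c^2 + x^2 <= 1 and the
    maximum [Cstar]; s stands for 2 / p. *)
Definition cstar (s : R) : R := sqrt (1 - / s).
Definition xstar (s : R) : R := sqrt (/ s).
Definition Cstar (s : R) : R := s * Rpower (cstar s) (s - 1) * xstar s.

Lemma star_facts s : 1 < s ->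
  0 < cstar s /\ 0 < xstar s /\ 0 < Cstar s /\
  cstar s ^ 2 = 1 - / s /\ xstar s ^ 2 = / s.
Proof.
  intros Hs.
  assert (0 < / s < 1).
  { split; [apply Rinv_0_lt_compat; lra |]. rewrite <- Rinv_1. apply Rinv_lt_contravar; lra. }
  assert (C0 : 0 < cstar s) by (apply sqrt_lt_R0; lra).
  assert (X0 : 0 < xstar s) by (apply sqrt_lt_R0; lra).
  repeat split; try assumption.
  - apply Rmult_lt_0_compat; [| exact X0]. apply Rmult_lt_0_compat; [lra | apply exp_pos].
  - unfold cstar. simpl. rewrite Rmult_1_r, sqrt_sqrt; lra.
  - unfold xstar. simpl. rewrite Rmult_1_r, sqrt_sqrt; lra.
Qed.

(** Weighted arithmetic-geometric mean inequality with a quadratic remainder,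
    from ln u <= u - 1 and 2 (u - 1) = u^2 - 1 - (u - 1)^2. *)
Lemma amgm_stable s c x : 1 < s -> 0 < c -> 0 <= x -> c ^ 2 + x ^ 2 <= 1 ->
  (s * Rpower c (s - 1) * x) ^ 2 *
    (1 + ((s - 1) * (c / cstar s - 1) ^ 2 + (x / xstar s - 1) ^ 2)) <= Cstar s ^ 2.
Proof.
  intros Hs Hc [Hx | <-] H.
  2: { rewrite Rmult_0_r. replace (0 ^ 2) with 0 by (simpl; ring). rewrite Rmult_0_l. apply pow2_ge_0. }
  destruct (star_facts s Hs) as [C0 [X0 [K0 [C2 X2]]]].
  set (u := c / cstar s). set (v := x / xstar s).
  assert (Hu : 0 < u) by (apply Rdiv_lt_0_compat; assumption).
  assert (Hv : 0 < v) by (apply Rdiv_lt_0_compat; assumption).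
  assert (Ec : c = cstar s * u) by (unfold u; field; lra).
  assert (Ex : x = xstar s * v) by (unfold v; field; lra).
  set (q := (s - 1) * (u - 1) ^ 2 + (v - 1) ^ 2).
  assert (Q0 : 0 <= q).
  { unfold q. apply Rplus_le_le_0_compat; [| apply pow2_ge_0].
    apply Rmult_le_pos; [lra | apply pow2_ge_0]. }
  assert (EA : s * Rpower c (s - 1) * x = Cstar s * (Rpower u (s - 1) * v)).
  { rewrite Ec, Ex at 1. rewrite <- Rpower_mult_distr by assumption. unfold Cstar. ring. }
  assert (Con : (s - 1) * u ^ 2 + v ^ 2 <= s).
  { rewrite Ec, Ex, !Rpow_mult_distr, C2, X2 in H.
    apply (Rmult_le_compat_l s) in H; [| lra].
    replace (s * ((1 - / s) * u ^ 2 + / s * v ^ 2)) with ((s - 1) * u ^ 2 + v ^ 2) in H by (field; lra).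
    lra. }
  assert (W : (Rpower u (s - 1) * v) ^ 2 <= exp (- q)).
  { rewrite <- (exp_ln v Hv) at 1. unfold Rpower. rewrite <- exp_plus. simpl. rewrite Rmult_1_r, <- exp_plus.
    assert (Lu := ln_le_sub1 u Hu). assert (Lv := ln_le_sub1 v Hv).
    assert (Lu2 : (s - 1) * ln u <= (s - 1) * (u - 1)) by (apply Rmult_le_compat_l; lra).
    assert (D : (s - 1) * ln u + ln v + ((s - 1) * ln u + ln v) <= - q).
    { unfold q. simpl in Con |- *. nra. }
    destruct D as [D | D]; [left; apply exp_increasing, D | rewrite D; lra]. }
  assert (W2 : (Rpower u (s - 1) * v) ^ 2 * (1 + q) <= 1).
  { pose proof (exp_ge q) as E. pose proof (exp_pos q). rewrite exp_Ropp in W.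
    apply Rle_trans with (/ exp q * exp q); [| right; field; lra].
    apply Rmult_le_compat; [apply pow2_ge_0 | lra | exact W | exact E]. }
  rewrite EA. fold q. rewrite Rpow_mult_distr, Rmult_assoc.
  rewrite <- (Rmult_1_r (Cstar s ^ 2)) at 2. apply Rmult_le_compat_l; [apply pow2_ge_0 | exact W2].
Qed.

(** The value of c^2 at which the conditions s x = 2 c and c^2 + x^2 = 1 meet. *)
Definition ythr (s : R) : R := s ^ 2 / (s ^ 2 + 4).

(** Away from the case |b0| = 1 the maximum over |b0| is interior; its value
    stays below that of the admissible point with c^2 = s^2 / (s^2 + 4), which
    is not the maximizer. *)
Lemma interior_bound s : 2 < s -> exists K, K < Cstar s /\
  forall c x, 0 < c -> 0 <= x -> c ^ 2 + x ^ 2 <= 1 -> s * x <= 2 * c ->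
    Rpower c (s - 2) * (c ^ 2 + s ^ 2 / 4 * x ^ 2) <= K.
Proof.
  intros Hs.
  assert (S4 : 0 < s ^ 2 + 4) by (pose proof (pow2_ge_0 s); lra).
  set (y0 := ythr s).
  assert (S2 : 4 < s ^ 2) by (simpl; nra).
  assert (Y0 : 0 < y0 < 1).
  { unfold y0, ythr. split; [apply Rdiv_lt_0_compat; lra |].
    apply (Rmult_lt_reg_r (s ^ 2 + 4)); [exact S4 |]. unfold Rdiv. rewrite Rmult_assoc, Rinv_l; lra. }
  set (K := 2 * Rpower y0 (s / 2)).
  assert (K0 : 0 < K) by (unfold K; pose proof (exp_pos (s / 2 * ln y0)); unfold Rpower; lra).
  assert (Rsq : forall c a, 0 < c -> Rpower c (2 * a) = Rpower (c ^ 2) a).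
  { intros c a Hc. rewrite <- Rpower_mult. f_equal.
    replace 2 with (INR 2) at 1 by (simpl; ring). apply Rpower_pow, Hc. }
  exists K. split.
  - destruct (star_facts s (ltac:(lra))) as [C0 [X0 [P0 [C2 X2]]]].
    set (c0 := sqrt y0).
    assert (Hc0 : 0 < c0) by (apply sqrt_lt_R0; lra).
    assert (Ec0 : c0 ^ 2 = y0) by (unfold c0; simpl; rewrite Rmult_1_r, sqrt_sqrt; lra).
    assert (Con : c0 ^ 2 + (2 * c0 / s) ^ 2 = 1).
    { replace ((2 * c0 / s) ^ 2) with (4 * c0 ^ 2 / s ^ 2) by (field; lra). rewrite Ec0.
      unfold y0, ythr. field. split; [lra | nra]. }
    assert (Ek : s * Rpower c0 (s - 1) * (2 * c0 / s) = K).
    { unfold K. rewrite <- Ec0, <- (Rsq c0 (s / 2) Hc0).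
      replace (2 * (s / 2)) with ((s - 1) + 1) by field. rewrite Rpower_plus, Rpower_1 by exact Hc0. field; lra. }
    assert (A := amgm_stable s c0 (2 * c0 / s) (ltac:(lra)) Hc0).
    rewrite Ek in A. specialize (A (ltac:(apply Rmult_le_pos; [lra | left; apply Rinv_0_lt_compat; lra])) (ltac:(lra))).
    (* y0 = 1 - 1 / s would mean (s - 2)^2 = 0. *)
    assert (N : c0 / cstar s <> 1).
    { intros E. assert (E2 : c0 = cstar s) by (apply (Rmult_eq_reg_r (/ cstar s)); [rewrite Rinv_r by lra; exact E | apply Rinv_neq_0_compat; lra]).
      apply (f_equal (fun y => y ^ 2)) in E2. rewrite Ec0, C2 in E2. unfold y0, ythr in E2.
      apply (f_equal (fun y => y * (s * (s ^ 2 + 4)))) in E2.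
      replace (s ^ 2 / (s ^ 2 + 4) * (s * (s ^ 2 + 4))) with (s ^ 3) in E2 by (field; lra).
      replace ((1 - / s) * (s * (s ^ 2 + 4))) with ((s - 1) * (s ^ 2 + 4)) in E2 by (field; lra).
      assert (0 < (s - 2) * (s - 2)) by nra. simpl in E2. nra. }
    assert (Q : 0 < (s - 1) * (c0 / cstar s - 1) ^ 2).
    { apply Rmult_lt_0_compat; [lra |]. simpl. rewrite Rmult_1_r.
      assert (c0 / cstar s - 1 <> 0) by lra. apply Rsqr_pos_lt; assumption. }
    pose proof (pow2_ge_0 (2 * c0 / s / xstar s - 1)) as Q2.
    apply Rnot_le_lt. intros L.
    assert (Cstar s ^ 2 <= K ^ 2) by (apply pow_incr; lra).
    assert (0 < K ^ 2) by (apply pow_lt, K0). nra.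
  - intros c x Hc Hx Con Hsx.
    set (y := c ^ 2). assert (Hy : 0 < y) by (apply pow_lt, Hc).
    assert (Hy1 : y <= 1) by (pose proof (pow2_ge_0 x); unfold y; lra).
    set (m := s / 2 - 1). assert (Hm : 0 < m) by (unfold m; lra).
    replace (Rpower c (s - 2)) with (Rpower y m).
    2: { unfold y. rewrite <- Rsq by exact Hc. f_equal. unfold m. field. }
    fold y.
    assert (KE : K = Rpower y0 m * (2 * y0)).
    { unfold K. replace (s / 2) with (m + 1) by (unfold m; field). rewrite Rpower_plus, Rpower_1 by lra. ring. }
    assert (Py : 0 < Rpower y m) by apply exp_pos.
    destruct (Rle_lt_dec y y0) as [L | L].
    + assert (X : s ^ 2 / 4 * x ^ 2 <= y).
      { assert ((s * x) ^ 2 <= (2 * c) ^ 2) by (apply pow_incr; split; [apply Rmult_le_pos; lra | exact Hsx]).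
        rewrite !Rpow_mult_distr in H. unfold y. simpl in *. lra. }
      rewrite KE. apply Rmult_le_compat; [lra | pose proof (pow2_ge_0 x); nra | | lra].
      unfold Rpower. destruct L as [L | ->]; [| lra]. left. apply exp_increasing.
      apply Rmult_lt_compat_l; [exact Hm | apply ln_increasing; lra].
    (* y^m T is decreasing in y beyond y0; compare logarithms with tangents at y0. *)
    + set (T := s ^ 2 / 4 - (s ^ 2 / 4 - 1) * y).
      assert (XT : y + s ^ 2 / 4 * x ^ 2 <= T).
      { unfold T. assert (s ^ 2 / 4 * x ^ 2 <= s ^ 2 / 4 * (1 - y)) by (apply Rmult_le_compat_l; unfold y; lra). lra. }
      assert (T0 : 0 < T) by (unfold T; nra).
      assert (T1 : s ^ 2 / 4 - (s ^ 2 / 4 - 1) * y0 = 2 * y0) by (unfold y0, ythr; field; lra).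
      apply Rle_trans with (Rpower y m * T); [apply Rmult_le_compat_l; lra |].
      rewrite KE.
      set (t := T / (2 * y0)). assert (Ht : 0 < t) by (apply Rdiv_lt_0_compat; lra).
      assert (ET : T = t * (2 * y0)) by (unfold t; field; lra).
      set (z := y / y0). assert (Hz : 0 < z) by (apply Rdiv_lt_0_compat; lra).
      assert (Ez : y = y0 * z) by (unfold z; field; lra).
      rewrite Ez at 1. rewrite <- Rpower_mult_distr by lra. rewrite ET.
      replace (Rpower y0 m * Rpower z m * (t * (2 * y0))) with ((Rpower y0 m * (2 * y0)) * (Rpower z m * t)) by ring.
      rewrite <- (Rmult_1_r (Rpower y0 m * (2 * y0))) at 2.
      apply Rmult_le_compat_l.
      { apply Rmult_le_pos; [left; apply exp_pos | lra]. }
      rewrite <- (exp_ln t Ht). unfold Rpower. rewrite <- exp_plus. rewrite <- exp_0.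
      assert (D : m * ln z + ln t <= 0).
      { assert (Lz := ln_le_sub1 z Hz). assert (Lt := ln_le_sub1 t Ht).
        assert (Lz2 : m * ln z <= m * (z - 1)) by (apply Rmult_le_compat_l; lra).
        assert (E : m * (z - 1) + (t - 1) = - ((s - 2) * (s - 2) / 8) * (z - 1)).
        { assert (t = 1 - (s ^ 2 / 4 - 1) / 2 * (z - 1)).
          { unfold t. replace T with (2 * y0 - (s ^ 2 / 4 - 1) * (y - y0)) by (unfold T; lra).
            rewrite Ez. field. lra. }
          rewrite H. unfold m. field. }
        assert (Z1 : 0 <= z - 1).
        { assert (1 < z); [| lra]. unfold z. apply (Rmult_lt_reg_r y0); [lra |].
          unfold Rdiv. rewrite Rmult_assoc, Rinv_l; lra. }
        assert (0 <= (s - 2) * (s - 2) / 8 * (z - 1)) by (apply Rmult_le_pos; [nra | exact Z1]).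
        lra. }
      destruct D as [D | D]; [left; apply exp_increasing, D | rewrite D; lra].
Qed.

(** Psi is a concave quadratic in b with vertex s x / (2 c).  If the vertex is
    at most 1, [interior_bound] applies to its value there; otherwise Psi
    increases up to b = 1, where it equals A. *)
Lemma coefficient_maximum s : 2 < s -> exists K, K < Cstar s /\
  forall b c x, 0 <= b <= 1 -> 0 < c -> 0 <= x -> c ^ 2 + x ^ 2 <= 1 ->
  let Psi := (1 - b ^ 2) * Rpower c s + b * (s * Rpower c (s - 1) * x) in
  Psi <= K \/ exists A, Psi <= A - Rpower c s * (1 - b) ^ 2 /\ 0 <= A /\
    A ^ 2 * (1 + ((s - 1) * (c / cstar s - 1) ^ 2 + (x / xstar s - 1) ^ 2)) <= Cstar s ^ 2.
Proof.
  intros Hs. destruct (interior_bound s Hs) as [K [HK Int]]. exists K. split; [exact HK |].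
  intros b c x Hb Hc Hx Con Psi.
  assert (P2 : 0 < Rpower c (s - 2)) by apply exp_pos.
  assert (E1 : Rpower c (s - 1) = Rpower c (s - 2) * c).
  { replace (s - 1) with ((s - 2) + 1) by ring. rewrite Rpower_plus, Rpower_1; auto. }
  assert (E0 : Rpower c s = Rpower c (s - 2) * c ^ 2).
  { replace s with ((s - 2) + 1 + 1) at 1 by ring. rewrite !Rpower_plus, !Rpower_1 by exact Hc. simpl; ring. }
  destruct (Rle_lt_dec (s * x) (2 * c)) as [L | L].
  - left. eapply Rle_trans; [| apply (Int c x); assumption].
    unfold Psi. rewrite E0, E1.
    assert (0 <= Rpower c (s - 2) * (b * c - s * x / 2) ^ 2)
      by (apply Rmult_le_pos; [lra | apply pow2_ge_0]).
    simpl in *. lra.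
  - right. exists (s * Rpower c (s - 1) * x). split; [| split].
    + unfold Psi. rewrite E0, E1.
      assert (0 <= Rpower c (s - 2) * (c * ((1 - b) * (s * x - 2 * c)))).
      { repeat apply Rmult_le_pos; lra. }
      simpl in *. lra.
    + apply Rmult_le_pos; [| exact Hx]. apply Rmult_le_pos; [lra | left; apply exp_pos].
    + apply amgm_stable; lra.
Qed.

Lemma coefficient_bound s b c x : 2 < s -> 0 <= b <= 1 -> 0 < c -> 0 <= x -> c ^ 2 + x ^ 2 <= 1 ->
  (1 - b ^ 2) * Rpower c s + b * (s * Rpower c (s - 1) * x) <= Cstar s.
Proof.
  intros Hs Hb Hc Hx Con. destruct (coefficient_maximum s Hs) as [K [HK M]].
  destruct (M b c x Hb Hc Hx Con) as [L | [A [L [A0 Q]]]]; [lra |].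
  assert (0 <= Rpower c s * (1 - b) ^ 2) by (apply Rmult_le_pos; [left; apply exp_pos | apply pow2_ge_0]).
  assert (A ^ 2 <= Cstar s ^ 2).
  { eapply Rle_trans; [| exact Q]. rewrite <- (Rmult_1_r (A ^ 2)) at 1.
    apply Rmult_le_compat_l; [apply pow2_ge_0 |].
    pose proof (pow2_ge_0 (x / xstar s - 1)).
    assert (0 <= (s - 1) * (c / cstar s - 1) ^ 2) by (apply Rmult_le_pos; [lra | apply pow2_ge_0]). lra. }
  destruct (star_facts s (ltac:(lra))) as [_ [_ [P0 _]]].
  assert (A <= Cstar s); [| lra].
  apply Rsqr_incr_0_var; [| lra]. rewrite !Rsqr_pow2. assumption.
Qed.

(** * The case p < 1 *)

(** The extra factor r puts the mean of |r f(r z)|^p strictly below 1. *)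
Lemma dilated_factorization p f r : 0 < p -> unit_norm p f -> 0 < r < 1 ->
  exists b g h c, factored (2 / p) (fun k => RtoC (r ^ S k) * tc f k)%C b g h c.
Proof.
  intros Hp Hf Hr. assert (Af := proj1 Hf).
  destruct (disc_dilate f r Af Hr) as [H1 H2].
  set (F := fun z => (RtoC r * f (RtoC r * z))%C).
  assert (AF : analytic (1 / r) F) by (apply analytic_mult; [apply analytic_const | exact H2]).
  assert (Cf := disc_circle_ccont f r Af (ltac:(lra))).
  destruct (factorization F (1 / r) p Hp H1 AF) as [b [g [h [c Fac]]]].
  - rewrite (Rmean_ext _ (fun t => rpow r p * rpow (Cmod (f (RtoC r * cis t)%C)) p)).
    + rewrite Rmean_scal by (apply (rcont_rpow_mod _ p Hp Cf)).
      fold (Mp p f r). pose proof (unit_norm_Mp_le p f r Hf Hr).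
      pose proof (Mp_ge0 p f r Hp Af (ltac:(lra))).
      assert (rpow r p < 1) by (rewrite <- (rpow_1_l p); apply rpow_lt; lra).
      pose proof (rpow_ge0 r p (ltac:(lra))). nra.
    + intros t. unfold F. rewrite Cmod_mult, Cmod_R, Rabs_pos_eq by lra.
      apply rpow_mult; [lra | apply Cmod_ge_0].
  - exists b, g, h, c.
    assert (E : forall k, coef F (Z.of_nat k) = (RtoC (r ^ S k) * tc f k)%C).
    { intros k. unfold F, coef. rewrite fcoef_scal by exact Cf.
      change (fcoef (fun t => f (RtoC r * cis t)%C) (Z.of_nat k))
        with (coef (fun z => f (RtoC r * z)%C) (Z.of_nat k)).
      rewrite (tc_coef f r k Af Hr). simpl. rewrite !RtoC_mult. ring. }
    destruct Fac as [P0 P1 P2 P3 P4 P5 P6 P7 P8]. split; try assumption.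
    intros k. rewrite <- E. apply P0.
Qed.

Lemma factored_ranges s F b g h c : factored s F b g h c ->
  0 <= Cmod (b O) <= 1 /\ 0 < c /\ 0 <= Cmod (h 1%nat) /\ c ^ 2 + Cmod (h 1%nat) ^ 2 <= 1.
Proof.
  intros [P H0 Hc G0 B1 Bk H1 _ _]. repeat split; try assumption; try apply Cmod_ge_0.
  specialize (Bk 1%nat (Nat.le_refl 1)). pose proof (pow2_ge_0 (Cmod (b 1%nat))).
  pose proof (Cmod_ge_0 (b O)). nra.
Qed.

Lemma two_lt_two_div p : 0 < p < 1 -> 2 < 2 / p.
Proof.
  intros Hp. apply (Rmult_lt_reg_r p); [lra |]. unfold Rdiv. rewrite Rmult_assoc, Rinv_l; lra.
Qed.

Lemma derive_le_Cstar p f : 0 < p < 1 -> unit_norm p f ->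
  Cmod (C_derive f 0%C) <= Cstar (2 / p).
Proof.
  intros Hp Hf.
  assert (Hs := two_lt_two_div p Hp).
  replace (Cmod (C_derive f 0%C)) with (1 ^ 2 * Cmod (C_derive f 0%C)) by ring.
  apply (left_limit_le (fun r => r ^ 2 * Cmod (C_derive f 0%C))).
  { apply continuous_Rmult; [apply (continuous_sqr (fun r : R => r)), continuous_id | apply continuous_const]. }
  intros r Hr. destruct (dilated_factorization p f r (proj1 Hp) Hf Hr) as [b [g [h [c Fac]]]].
  destruct (factored_ranges _ _ _ _ _ _ Fac) as [R1 [R2 [R3 R4]]].
  assert (B := factored_derive_bound (2 / p) _ _ _ _ _ (ltac:(lra)) Fac). cbv beta in B.
  rewrite (tc_1 f _ (proj1 Hf) (analytic_derive0 f (proj1 Hf))), Cmod_mult, Cmod_R in B.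
  rewrite Rabs_pos_eq in B by apply pow2_ge_0.
  eapply Rle_trans; [exact B |]. apply coefficient_bound; assumption.
Qed.

(** ** Limits of complex sequences *)

Definition clim (u : nat -> C) (l : C) : Prop :=
  is_lim_seq (fun n => Re (u n)) (Re l) /\ is_lim_seq (fun n => Im (u n)) (Im l).

Lemma clim_ext u v l : (forall n, u n = v n) -> clim u l -> clim v l.
Proof.
  intros E [A B]. split; [revert A | revert B]; apply is_lim_seq_ext; intros n; rewrite E; reflexivity.
Qed.

Lemma clim_R (x : nat -> R) (l : R) : is_lim_seq x l -> clim (fun n => RtoC (x n)) (RtoC l).
Proof. intros H. split; [exact H | apply is_lim_seq_const]. Qed.

Lemma clim_const c : clim (fun _ => c) c.
Proof. split; apply is_lim_seq_const. Qed.

Lemma clim_plus u v a b : clim u a -> clim v b -> clim (fun n => u n + v n)%C (a + b)%C.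
Proof.
  intros [A B] [D E]. split.
  - apply (is_lim_seq_plus' (fun n => Re (u n)) (fun n => Re (v n)) (Re a) (Re b) A D).
  - apply (is_lim_seq_plus' (fun n => Im (u n)) (fun n => Im (v n)) (Im a) (Im b) B E).
Qed.

Lemma clim_mult u v a b : clim u a -> clim v b -> clim (fun n => u n * v n)%C (a * b)%C.
Proof.
  intros [A B] [D E]. split.
  - apply (is_lim_seq_minus' (fun n => Re (u n) * Re (v n)) (fun n => Im (u n) * Im (v n))
      (Re a * Re b) (Im a * Im b)); apply is_lim_seq_mult'; assumption.
  - apply (is_lim_seq_plus' (fun n => Re (u n) * Im (v n)) (fun n => Im (u n) * Re (v n))
      (Re a * Im b) (Im a * Re b)); apply is_lim_seq_mult'; assumption.
Qed.

Lemma clim_minus u v a b : clim u a -> clim v b -> clim (fun n => u n - v n)%C (a - b)%C.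
Proof.
  intros Hu Hv. apply (clim_ext (fun n => u n + - (1) * v n)%C).
  - intros n. ring.
  - replace (a - b)%C with (a + - (1) * b)%C by ring.
    apply clim_plus; [exact Hu | apply clim_mult; [apply clim_const | exact Hv]].
Qed.

Lemma clim_inv u a : clim u a -> a <> 0%C -> clim (fun n => / u n)%C (/ a)%C.
Proof.
  intros [A B] N. pose proof (Cnz_mod2 a N) as P.
  assert (D : is_lim_seq (fun n => / (Re (u n) ^ 2 + Im (u n) ^ 2)) (/ (Re a ^ 2 + Im a ^ 2))).
  { apply (is_lim_seq_inv (fun n => Re (u n) ^ 2 + Im (u n) ^ 2) (Re a ^ 2 + Im a ^ 2)).
    - apply is_lim_seq_plus'; (apply is_lim_seq_mult'; [| apply is_lim_seq_mult'; [| apply is_lim_seq_const]]); assumption.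
    - intros E. injection E as E. simpl in E. nra. }
  split.
  - apply (is_lim_seq_mult' (fun n => Re (u n)) (fun n => / (Re (u n) ^ 2 + Im (u n) ^ 2)) (Re a) (/ (Re a ^ 2 + Im a ^ 2)) A D).
  - apply (is_lim_seq_mult' (fun n => - Im (u n)) (fun n => / (Re (u n) ^ 2 + Im (u n) ^ 2)) (- Im a) (/ (Re a ^ 2 + Im a ^ 2))); [| exact D].
    apply (proj1 (is_lim_seq_opp (fun n => Im (u n)) (Im a)) B).
Qed.

Lemma clim_unique u a b : clim u a -> clim u b -> a = b.
Proof.
  intros [A B] [D E]. apply C_ext.
  - apply is_lim_seq_unique in A. apply is_lim_seq_unique in D. rewrite A in D. injection D; auto.
  - apply is_lim_seq_unique in B. apply is_lim_seq_unique in E. rewrite B in E. injection E; auto.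
Qed.

Lemma clim_csum (a : nat -> nat -> C) (l : nat -> C) m :
  (forall k, (k < m)%nat -> clim (fun n => a n k) (l k)) ->
  clim (fun n => csum (a n) m) (csum l m).
Proof.
  induction m as [|m IH]; intros H; simpl; [apply clim_const |].
  apply clim_plus; [apply IH; intros; apply H; lia | apply H; lia].
Qed.

Lemma clim_mod u l : clim u l -> is_lim_seq (fun n => Cmod (u n)) (Cmod l).
Proof.
  intros [A B]. unfold Cmod.
  apply (is_lim_seq_continuous sqrt (fun n => fst (u n) ^ 2 + snd (u n) ^ 2) (fst l ^ 2 + snd l ^ 2)).
  - apply continuity_pt_sqrt. pose proof (pow2_ge_0 (fst l)). pose proof (pow2_ge_0 (snd l)). lra.
  - apply is_lim_seq_plus'; (apply is_lim_seq_mult'; [| apply is_lim_seq_mult'; [| apply is_lim_seq_const]]);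
    assumption.
Qed.

Lemma lim_of_sq (u d : nat -> R) (l : R) :
  Hierarchy.eventually (fun n => (u n - l) ^ 2 <= d n) -> is_lim_seq d 0 -> is_lim_seq u l.
Proof.
  intros H Hd. apply is_lim_seq_spec. intros e.
  apply is_lim_seq_spec in Hd.
  assert (E2 : 0 < e ^ 2) by (apply pow_lt, cond_pos).
  specialize (Hd (mkposreal _ E2)). simpl in Hd.
  generalize (filter_and _ _ H Hd). apply filter_imp. intros n [A B].
  rewrite Rminus_0_r in B. pose proof (Rle_abs (d n)).
  rewrite <- (Rabs_pos_eq e) by (left; apply cond_pos).
  apply Rsqr_lt_abs_0. rewrite !Rsqr_pow2. simpl in *. lra.
Qed.

Lemma clim_0_of_sq (u : nat -> C) (d : nat -> R) :
  (forall n, Cmod (u n) ^ 2 <= d n) -> is_lim_seq d 0 -> clim u 0%C.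
Proof.
  intros H Hd. split; apply (lim_of_sq _ d); try exact Hd; exists O; intros n _;
    specialize (H n); rewrite Cmod2_alt in H; simpl (Re 0); simpl (Im 0);
    pose proof (pow2_ge_0 (Re (u n))); pose proof (pow2_ge_0 (Im (u n)));
    rewrite Rminus_0_r; lra.
Qed.

Lemma csum_first (a : nat -> C) n : csum a (S n) = (a O + csum (fun k => a (S k)) n)%C.
Proof.
  induction n as [|n IH]; [simpl; ring |].
  change (csum a (S (S n))) with (csum a (S n) + a (S n))%C. rewrite IH. simpl. ring.
Qed.

Lemma csum_zero n : csum (fun _ => 0%C) n = 0%C.
Proof. induction n as [|n IH]; simpl; [reflexivity | rewrite IH; ring]. Qed.

(** Any sequence in (0, 1) with limit 1 would do. *)
Definition radius (n : nat) : R := 1 - / (INR n + 2).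

Lemma radius_range n : 0 < radius n < 1.
Proof.
  unfold radius. pose proof (pos_INR n).
  assert (0 < / (INR n + 2)) by (apply Rinv_0_lt_compat; lra).
  assert (/ (INR n + 2) < 1) by (rewrite <- Rinv_1; apply Rinv_lt_contravar; lra). lra.
Qed.

Lemma radius_lim : is_lim_seq radius 1.
Proof.
  replace (Finite 1) with (Finite (1 - 0)) by (f_equal; ring).
  apply (is_lim_seq_minus' (fun _ => 1) (fun n => / (INR n + 2)) 1 0); [apply is_lim_seq_const |].
  apply (is_lim_seq_ext (fun n => / INR (n + 2))).
  - intros n. rewrite plus_INR. reflexivity.
  - apply (is_lim_seq_incr_n (fun n => / INR n) 2).
    apply (is_lim_seq_inv INR p_infty is_lim_seq_INR). discriminate.
Qed.

Lemma lim_cont (phi : R -> R) (u : nat -> R) (l : R) :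
  continuity_pt phi l -> is_lim_seq u l -> is_lim_seq (fun n => phi (u n)) (phi l).
Proof. apply is_lim_seq_continuous. Qed.

(** Near-extremal data converge: |b0| -> 1 and (c, |h1|) to the unique
    maximizer (cstar, xstar). *)
Lemma near_extremal_limits s (b c x : nat -> R) : 2 < s ->
  (forall n, 0 <= b n <= 1 /\ 0 < c n /\ 0 <= x n /\ c n ^ 2 + x n ^ 2 <= 1) ->
  (forall n, radius n ^ 2 * Cstar s <=
     (1 - b n ^ 2) * Rpower (c n) s + b n * (s * Rpower (c n) (s - 1) * x n)) ->
  is_lim_seq b 1 /\ is_lim_seq c (cstar s) /\ is_lim_seq x (xstar s).
Proof.
  intros Hs Rg Psi. destruct (star_facts s (ltac:(lra))) as [C0 [X0 [P0 [C2 X2]]]].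
  destruct (coefficient_maximum s Hs) as [K [HK M]].
  assert (L2 : is_lim_seq (fun n => radius n ^ 2) 1).
  { replace (Finite 1) with (Finite (1 ^ 2)) by (f_equal; ring).
    apply (lim_cont (fun y => y ^ 2)); [apply derivable_continuous_pt, derivable_pt_pow | apply radius_lim]. }
  assert (L4 : is_lim_seq (fun n => / radius n ^ 4 - 1) 0).
  { replace (Finite 0) with (Finite (/ 1 ^ 4 - 1)) by (f_equal; field).
    apply (lim_cont (fun y => / y ^ 4 - 1)); [| apply radius_lim].
    apply derivable_continuous_pt. reg. apply pow_nonzero. lra. }
  assert (Ev : Hierarchy.eventually (fun n => exists A,
     radius n ^ 2 * Cstar s <= A - Rpower (c n) s * (1 - b n) ^ 2 /\ 0 <= A /\
     A ^ 2 * (1 + ((s - 1) * (c n / cstar s - 1) ^ 2 + (x n / xstar s - 1) ^ 2)) <= Cstar s ^ 2)).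
  { assert (L : is_lim_seq (fun n => radius n ^ 2 * Cstar s) (1 * Cstar s))
      by (apply is_lim_seq_mult'; [exact L2 | apply is_lim_seq_const]).
    rewrite Rmult_1_l in L. apply is_lim_seq_spec in L.
    specialize (L (mkposreal (Cstar s - K) (ltac:(lra)))). revert L. apply filter_imp.
    intros n Hn. simpl in Hn. apply Rabs_def2 in Hn.
    destruct (Rg n) as [R1 [R2 [R3 R4]]]. specialize (Psi n).
    destruct (M (b n) (c n) (x n) R1 R2 R3 R4) as [T | [A [T1 [T2 T3]]]]; [lra |].
    exists A. repeat split; [lra | exact T2 | exact T3]. }
  assert (Quad : Hierarchy.eventually (fun n =>
     (s - 1) * (c n / cstar s - 1) ^ 2 + (x n / xstar s - 1) ^ 2 <= / radius n ^ 4 - 1 /\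
     Rpower (c n) s * (1 - b n) ^ 2 <= Cstar s * (1 - radius n ^ 2))).
  { revert Ev. apply filter_imp. intros n [A [T1 [T2 T3]]].
    destruct (Rg n) as [R1 [R2 [R3 R4]]]. pose proof (radius_range n) as Rr.
    set (q := (s - 1) * (c n / cstar s - 1) ^ 2 + (x n / xstar s - 1) ^ 2) in *.
    assert (Q0 : 0 <= q).
    { unfold q. apply Rplus_le_le_0_compat; [| apply pow2_ge_0].
      apply Rmult_le_pos; [lra | apply pow2_ge_0]. }
    assert (B0 : 0 <= Rpower (c n) s * (1 - b n) ^ 2)
      by (apply Rmult_le_pos; [left; apply exp_pos | apply pow2_ge_0]).
    set (r2 := radius n ^ 2) in *. assert (Hr2 : 0 < r2) by (apply pow_lt, Rr).
    assert (E4 : radius n ^ 4 = r2 * r2) by (unfold r2; ring). rewrite E4.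
    assert (A1 : r2 * Cstar s <= A) by lra.
    assert (RC : 0 < r2 * Cstar s) by (apply Rmult_lt_0_compat; assumption).
    assert (A2 : (r2 * Cstar s) ^ 2 <= A ^ 2) by (apply pow_incr; lra).
    split.
    - assert (T : (r2 * Cstar s) ^ 2 * (1 + q) <= Cstar s ^ 2).
      { eapply Rle_trans; [| exact T3]. apply Rmult_le_compat_r; lra. }
      assert (C20 : 0 < Cstar s ^ 2) by (apply pow_lt, P0).
      assert (T' : r2 * r2 * (1 + q) <= 1).
      { apply (Rmult_le_reg_r (Cstar s ^ 2)); [exact C20 |]. rewrite Rpow_mult_distr in T.
        replace (r2 ^ 2) with (r2 * r2) in T by ring. lra. }
      assert (RR : 0 < r2 * r2) by (apply Rmult_lt_0_compat; assumption).
      assert (1 + q <= / (r2 * r2)); [| lra].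
      apply (Rmult_le_reg_l (r2 * r2)); [exact RR |]. rewrite Rinv_r by lra. exact T'.
    - assert (A <= Cstar s); [| lra].
      apply Rsqr_incr_0_var; [| lra]. rewrite !Rsqr_pow2.
      eapply Rle_trans; [| exact T3]. rewrite <- (Rmult_1_r (A ^ 2)) at 1.
      apply Rmult_le_compat_l; [apply pow2_ge_0 | lra]. }
  assert (Lc : is_lim_seq c (cstar s)).
  { assert (L : is_lim_seq (fun n => c n / cstar s) 1).
    { apply (lim_of_sq _ (fun n => / (s - 1) * (/ radius n ^ 4 - 1))).
      - revert Quad. apply filter_imp. intros n [T _].
        pose proof (pow2_ge_0 (x n / xstar s - 1)).
        apply (Rmult_le_reg_l (s - 1)); [lra |]. rewrite <- Rmult_assoc, Rinv_r by lra. lra.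
      - replace (Finite 0) with (Finite (/ (s - 1) * 0)) by (f_equal; ring).
        apply is_lim_seq_mult'; [apply is_lim_seq_const | exact L4]. }
    apply (is_lim_seq_ext (fun n => c n / cstar s * cstar s)); [intros n; field; lra |].
    replace (Finite (cstar s)) with (Finite (1 * cstar s)) by (f_equal; ring).
    apply is_lim_seq_mult'; [exact L | apply is_lim_seq_const]. }
  assert (Lx : is_lim_seq x (xstar s)).
  { assert (L : is_lim_seq (fun n => x n / xstar s) 1).
    { apply (lim_of_sq _ (fun n => / radius n ^ 4 - 1)); [| exact L4].
      revert Quad. apply filter_imp. intros n [T _].
      assert (0 <= (s - 1) * (c n / cstar s - 1) ^ 2) by (apply Rmult_le_pos; [lra | apply pow2_ge_0]). lra. }
    apply (is_lim_seq_ext (fun n => x n / xstar s * xstar s)); [intros n; field; lra |].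
    replace (Finite (xstar s)) with (Finite (1 * xstar s)) by (f_equal; ring).
    apply is_lim_seq_mult'; [exact L | apply is_lim_seq_const]. }
  split; [| split; assumption].
  apply (lim_of_sq _ (fun n => Cstar s * (1 - radius n ^ 2) * / Rpower (c n) s)).
  - revert Quad. apply filter_imp. intros n [_ T].
    assert (E : 0 < Rpower (c n) s) by apply exp_pos.
    apply (Rmult_le_reg_r (Rpower (c n) s)); [exact E |].
    rewrite Rmult_assoc, Rinv_l by lra. 
    replace ((b n - 1) ^ 2 * Rpower (c n) s) with (Rpower (c n) s * (1 - b n) ^ 2) by ring. lra.
  - replace (Finite 0) with (Finite (Cstar s * (1 - 1) * / Rpower (cstar s) s)) by (f_equal; ring).
    apply is_lim_seq_mult'.
    + apply is_lim_seq_mult'; [apply is_lim_seq_const |].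
      apply is_lim_seq_minus'; [apply is_lim_seq_const | exact L2].
    + apply (lim_cont (fun y => / Rpower y s) c); [| exact Lc].
      apply continuity_pt_inv; [| apply Rgt_not_eq, exp_pos].
      apply derivable_continuous_pt. exists (s * Rpower (cstar s) (s - 1)).
      apply derivable_pt_lim_power, C0.
Qed.

(** In the limit B degenerates to a unimodular constant and h to
    cstar + H z, so z G' h = s z G h' becomes a recurrence for f. *)
Lemma extremal_recurrence p f : 0 < p < 1 -> unit_norm p f ->
  Cmod (C_derive f 0%C) = Cstar (2 / p) ->
  exists alpha H, Cmod H = xstar (2 / p) /\
    tc f 0 = (cis alpha * RtoC (Rpower (cstar (2 / p)) (2 / p)))%C /\
    forall m, (RtoC (INR (S m)) * tc f (S m) * RtoC (cstar (2 / p)) =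
               RtoC (2 / p - INR m) * tc f m * H)%C.
Proof.
  intros Hp Hf Hext. set (s := 2 / p) in *.
  assert (Hs : 2 < s) by (apply two_lt_two_div, Hp).
  destruct (star_facts s (ltac:(lra))) as [C0 [X0 [P0 [C2 X2]]]].
  destruct (functional_choice (fun n (q : (nat -> C) * (nat -> C) * (nat -> C) * R) =>
     factored s (fun k => RtoC (radius n ^ S k) * tc f k)%C
       (fst (fst (fst q))) (snd (fst (fst q))) (snd (fst q)) (snd q))) as [q Fac].
  { intros n. destruct (dilated_factorization p f (radius n) (proj1 Hp) Hf (radius_range n))
      as [b [g [h [c F]]]]. exists (b, g, h, c). exact F. }
  set (b := fun n => fst (fst (fst (q n)))) in *. set (g := fun n => snd (fst (fst (q n)))) in *.
  set (h := fun n => snd (fst (q n))) in *. set (c := fun n => snd (q n)) in *.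
  change (forall n, factored s (fun k => RtoC (radius n ^ S k) * tc f k)%C (b n) (g n) (h n) (c n)) in Fac.
  clearbody b g h c. clear q.
  assert (T1 : Cmod (tc f 1) = Cstar s).
  { rewrite (tc_1 f _ (proj1 Hf) (analytic_derive0 f (proj1 Hf))). exact Hext. }
  destruct (near_extremal_limits s (fun n => Cmod (b n O)) c (fun n => Cmod (h n 1%nat)) Hs) as [Lb [Lc Lx]].
  { intros n. apply (factored_ranges _ _ _ _ _ _ (Fac n)). }
  { intros n. assert (B := factored_derive_bound s _ _ _ _ _ (ltac:(lra)) (Fac n)). cbv beta in B.
    rewrite Cmod_mult, Cmod_R, T1 in B. rewrite Rabs_pos_eq in B by (apply pow2_ge_0). exact B. }
  set (gam := Rpower (cstar s) s). assert (Hg : 0 < gam) by apply exp_pos.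
  assert (Gn : RtoC gam <> 0%C) by (intros E; apply RtoC_inj in E; lra).
  assert (Lg0 : clim (fun n => g n O) (RtoC gam)).
  { apply (clim_ext (fun n => RtoC (Rpower (c n) s))).
    - intros n. symmetry. apply (fac_g0 _ _ _ _ _ _ (Fac n)).
    - apply clim_R. apply (lim_cont (fun y => Rpower y s) c); [| exact Lc].
      apply derivable_continuous_pt. exists (s * Rpower (cstar s) (s - 1)).
      apply derivable_pt_lim_power, C0. }
  assert (LF : forall k, clim (fun n => RtoC (radius n ^ S k) * tc f k)%C (tc f k)).
  { intros k.
    enough (K : clim (fun n => RtoC (radius n ^ S k) * tc f k)%C (RtoC (1 ^ S k) * tc f k)%C)
      by (rewrite pow1, Cmult_1_l in K; exact K).
    apply clim_mult; [| apply clim_const]. apply clim_R.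
    apply (lim_cont (fun y => y ^ S k)); [apply derivable_continuous_pt, derivable_pt_pow | apply radius_lim]. }
  set (beta := (tc f O * / RtoC gam)%C).
  assert (Lb0 : clim (fun n => b n O) beta).
  { apply (clim_ext (fun n => (RtoC (radius n ^ 1) * tc f O) * / g n O)%C).
    - intros n. rewrite (fac_prod _ _ _ _ _ _ (Fac n) O). simpl. rewrite (fac_g0 _ _ _ _ _ _ (Fac n)).
      field. intros E. apply RtoC_inj in E. pose proof (exp_pos (s * ln (c n))). unfold Rpower in E. lra.
    - apply clim_mult; [apply LF |]. apply clim_inv; assumption. }
  assert (Hbeta : Cmod beta = 1).
  { assert (K := clim_mod _ _ Lb0). apply is_lim_seq_unique in K. apply is_lim_seq_unique in Lb.
    rewrite Lb in K. injection K; auto. }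
  assert (Nb : beta <> 0%C) by (intros E; rewrite E, Cmod_0 in Hbeta; lra).
  assert (Lbk : forall k, (1 <= k)%nat -> clim (fun n => b n k) 0%C).
  { intros k Hk. apply (clim_0_of_sq _ (fun n => 1 - Cmod (b n O) ^ 2)).
    - intros n. pose proof (fac_bk _ _ _ _ _ _ (Fac n) k Hk). lra.
    - replace (Finite 0) with (Finite (1 - 1 ^ 2)) by (f_equal; ring).
      apply (lim_cont (fun y => 1 - y ^ 2) (fun n => Cmod (b n O))); [| exact Lb].
      apply derivable_continuous_pt. reg. }
  assert (Lh0 : clim (fun n => h n O) (RtoC (cstar s))).
  { apply (clim_ext (fun n => RtoC (c n))); [| apply clim_R, Lc].
    intros n. symmetry. apply (fac_h0 _ _ _ _ _ _ (Fac n)). }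
  assert (Lhk : forall k, (2 <= k)%nat -> clim (fun n => h n k) 0%C).
  { intros k Hk. apply (clim_0_of_sq _ (fun n => 1 - c n ^ 2 - Cmod (h n 1%nat) ^ 2)).
    - intros n. pose proof (fac_hk _ _ _ _ _ _ (Fac n) k Hk). lra.
    - replace (Finite 0) with (Finite (1 - cstar s ^ 2 - xstar s ^ 2)) by (f_equal; rewrite C2, X2; ring).
      apply is_lim_seq_minus'.
      + apply is_lim_seq_minus'; [apply is_lim_seq_const |].
        apply (lim_cont (fun y => y ^ 2) c); [apply derivable_continuous_pt, derivable_pt_pow | exact Lc].
      + apply (lim_cont (fun y => y ^ 2) (fun n => Cmod (h n 1%nat))); [apply derivable_continuous_pt, derivable_pt_pow | exact Lx]. }
  (* Dividing out b0, the coefficients of G inherit a limit from those of F = B G. *)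
  assert (Lg : forall k, clim (fun n => g n k) (tc f k * / beta)%C).
  { intros k. induction k as [k IH] using (well_founded_induction lt_wf).
    assert (Ls : clim (fun n => csum (fun j => b n (S j) * g n (k - S j)%nat)%C k) 0%C).
    { rewrite <- (csum_zero k). apply clim_csum. intros j Hj.
      replace (RtoC 0) with (0 * (tc f (k - S j)%nat * / beta))%C by ring.
      apply clim_mult; [apply Lbk; lia | apply IH; lia]. }
    assert (Ld := clim_minus _ _ _ _ (LF k) Ls).
    assert (Lq := clim_mult _ _ _ _ (clim_mult _ _ _ _ Ld (clim_const 1%C)) (clim_inv _ _ Lb0 Nb)).
    replace ((tc f k - 0) * 1 * / beta)%C with (tc f k * / beta)%C in Lq by ring.
    (* b0 vanishes at most for finitely many n, where the quotient below may fail. *)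
    assert (Ev : Hierarchy.eventually (fun n => b n O <> 0%C)).
    { apply is_lim_seq_spec in Lb. specialize (Lb (mkposreal 1 Rlt_0_1)). revert Lb. apply filter_imp.
      intros n Hn E. simpl in Hn. rewrite E, Cmod_0 in Hn. apply Rabs_def2 in Hn. lra. }
    assert (Eq : Hierarchy.eventually (fun n =>
      ((RtoC (radius n ^ S k) * tc f k - csum (fun j => b n (S j) * g n (k - S j)%nat) k) * 1 * / b n O)%C = g n k)).
    { revert Ev. apply filter_imp. intros n Hn.
      rewrite (fac_prod _ _ _ _ _ _ (Fac n) k), csum_first. rewrite Nat.sub_0_r. field. exact Hn. }
    destruct Lq as [L1 L2]. split.
    - apply (is_lim_seq_ext_loc _ (fun n => Re (g n k))) in L1; [exact L1 |].
      revert Eq. apply filter_imp. intros n E. rewrite E. reflexivity.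
    - apply (is_lim_seq_ext_loc _ (fun n => Im (g n k))) in L2; [exact L2 |].
      revert Eq. apply filter_imp. intros n E. rewrite E. reflexivity. }
  set (H := (tc f 1 * / beta * RtoC (cstar s) * / (RtoC s * RtoC gam))%C).
  assert (Sn : RtoC s <> 0%C) by (intros E; apply RtoC_inj in E; lra).
  assert (Lh1 : clim (fun n => h n 1%nat) H).
  { apply (clim_ext (fun n => g n 1%nat * h n O * / (RtoC s * g n O))%C).
    - intros n. assert (O := fac_ode _ _ _ _ _ _ (Fac n) 1%nat). simpl in O.
      assert (G0 := fac_g0 _ _ _ _ _ _ (Fac n)).
      assert (Gz : g n 0%nat <> 0%C).
      { rewrite G0. intros E. apply RtoC_inj in E. pose proof (exp_pos (s * ln (c n))). unfold Rpower in E. lra. }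
      replace (g n 1%nat * h n 0%nat)%C with (RtoC s * g n 0%nat * h n 1%nat)%C.
      + field. split; assumption.
      + transitivity (0 + RtoC s * g n 0%nat * (1 * h n 1%nat) + RtoC s * g n 1%nat * (0 * h n 0%nat))%C; [ring |].
        rewrite <- O. ring.
    - apply clim_mult; [apply clim_mult; [apply Lg | exact Lh0] |].
      apply clim_inv; [apply clim_mult; [apply clim_const | exact Lg0] |].
      apply Cmult_neq_0; assumption. }
  destruct (polar beta) as [al Eal]. rewrite Hbeta, Cmult_1_l in Eal.
  exists al, H. split; [| split].
  - assert (K := clim_mod _ _ Lh1). apply is_lim_seq_unique in K. apply is_lim_seq_unique in Lx.
    rewrite Lx in K. injection K; auto.
  - rewrite <- Eal. unfold beta. fold gam. field. exact Gn.
  - intros m. set (Hk := fun k => match k with O => RtoC (cstar s) | 1%nat => H | _ => 0%C end).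
    assert (LH : forall k, clim (fun n => h n k) (Hk k)).
    { intros [|[|k]]; [exact Lh0 | exact Lh1 | apply Lhk; lia]. }
    set (a := fun k => (tc f k * / beta)%C) in *.
    assert (LL : clim (fun n => csum (fun j => RtoC (INR j) * g n j * h n (S m - j)%nat)%C (S (S m)))
       (csum (fun j => RtoC (INR j) * a j * Hk (S m - j)%nat)%C (S (S m)))).
    { apply clim_csum. intros j _.
      apply clim_mult; [apply clim_mult; [apply clim_const | apply Lg] | apply LH]. }
    assert (LR : clim (fun n => csum (fun j => RtoC (INR j) * g n j * h n (S m - j)%nat)%C (S (S m)))
       (csum (fun j => RtoC s * a j * (RtoC (INR (S m - j)) * Hk (S m - j)%nat))%C (S (S m)))).
    { apply (clim_ext (fun n => csum (fun j => RtoC s * g n j * (RtoC (INR (S m - j)) * h n (S m - j)%nat))%C (S (S m)))).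
      - intros n. symmetry. apply (fac_ode _ _ _ _ _ _ (Fac n)).
      - apply clim_csum. intros j _. apply clim_mult; [apply clim_mult; [apply clim_const | apply Lg] |].
        apply clim_mult; [apply clim_const | apply LH]. }
    assert (E := clim_unique _ _ _ LL LR).
    assert (Two : forall w : nat -> C, (forall j, (j < m)%nat -> w j = 0%C) -> csum w (S (S m)) = (w m + w (S m))%C).
    { intros w Hw. simpl. rewrite (csum_ext w (fun _ => 0%C) m Hw), csum_zero. ring. }
    assert (HZ : forall j, (j < m)%nat -> Hk (S m - j)%nat = 0%C).
    { intros j Hj. replace (S m - j)%nat with (S (S (m - j - 1))) by lia. reflexivity. }
    rewrite !Two in E by (intros j Hj; rewrite (HZ j Hj); ring).
    replace (S m - m)%nat with 1%nat in E by lia. rewrite Nat.sub_diag in E.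
    unfold Hk in E. simpl (INR 0) in E. simpl (INR 1) in E. unfold a in E.
    apply (f_equal (fun z => z * beta)%C) in E.
    replace ((RtoC (INR m) * (tc f m * / beta) * H + RtoC (INR (S m)) * (tc f (S m) * / beta) * RtoC (cstar s)) * beta)%C
      with (RtoC (INR m) * tc f m * H + RtoC (INR (S m)) * tc f (S m) * RtoC (cstar s))%C in E by (field; exact Nb).
    replace ((RtoC s * (tc f m * / beta) * (1 * H) + RtoC s * (tc f (S m) * / beta) * (0 * RtoC (cstar s))) * beta)%C
      with (RtoC s * tc f m * H)%C in E by (field; exact Nb).
    rewrite RtoC_minus.
    replace ((RtoC s - RtoC (INR m)) * tc f m * H)%C with (RtoC s * tc f m * H - RtoC (INR m) * tc f m * H)%C by ring.
    rewrite <- E. ring.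
Qed.

(** The differential equation characterizes (c + H z)^s up to a constant; in this
    form the branch of the power does not enter. *)
Lemma binomial_recurrence (F F1 : C -> C) (c H s : C) : analytic 1 F -> analytic 1 F1 ->
  (forall z, Cmod z < 1 -> cderiv F z (F1 z)) ->
  (forall z, Cmod z < 1 -> ((c + H * z) * F1 z = s * H * F z)%C) ->
  forall m, (RtoC (INR (S m)) * tc F (S m) * c = (s - RtoC (INR m)) * tc F m * H)%C.
Proof.
  intros AF AF1 HD Ode m.
  set (r := 1 / 2). assert (Hr : 0 < r < 1) by (unfold r; lra).
  destruct (disc_dilate F r AF Hr) as [R1 AG]. destruct (disc_dilate F1 r AF1 Hr) as [_ AG1'].
  set (G := fun z => F (RtoC r * z)%C) in *. set (G1 := fun z => (F1 (RtoC r * z) * (RtoC r * 1))%C).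
  assert (AG1 : analytic (1 / r) G1) by (apply analytic_mult; [exact AG1' | apply analytic_const]).
  assert (In : forall z : C, Cmod z = 1 -> Cmod (RtoC r * z) < 1).
  { intros z Hz. rewrite Cmod_mult, Cmod_R, Hz, Rabs_pos_eq; lra. }
  assert (KD : forall k : nat, coef (fun z => z * G1 z)%C (Z.of_nat k) = (RtoC (INR k) * coef G (Z.of_nat k))%C).
  { intros k. rewrite <- coef_nat_S. apply coef_deriv.
    - intros z Hz. apply (cderiv_comp F (fun z => RtoC r * z)%C); [apply HD, In, Hz |].
      apply cderiv_scal, cderiv_id.
    - apply (analytic_ccont G1 (1 / r) R1 AG1). }
  assert (CG := analytic_ccont G (1 / r) R1 AG).
  assert (CG1 : ccont (fun t => cis t * G1 (cis t))%C)
    by (apply ccont_mult; [apply ccont_cis1 | apply (analytic_ccont G1 (1 / r) R1 AG1)]).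
  assert (Cs : forall g, ccont g -> ccont (fun t => cis (IZR 1 * t) * g t)%C)
    by (intros g Hg; apply ccont_mult; [apply ccont_cis | exact Hg]).
  assert (E : fcoef (fun t => c * (cis t * G1 (cis t)) + (H * RtoC r) * (cis (IZR 1 * t) * (cis t * G1 (cis t))))%C (Z.of_nat (S m))
     = fcoef (fun t => (s * H * RtoC r) * (cis (IZR 1 * t) * G (cis t)))%C (Z.of_nat (S m))).
  { apply fcoef_ext. intros t. replace (IZR 1 * t) with t by (simpl; ring).
    assert (O := Ode (RtoC r * cis t)%C (In _ (cis_mod t))). unfold G, G1.
    transitivity (RtoC r * cis t * ((c + H * (RtoC r * cis t)) * F1 (RtoC r * cis t)))%C; [ring |].
    rewrite O. ring. }
  assert (Ca : ccont (fun t => c * (cis t * G1 (cis t)))%C)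
    by (apply ccont_mult; [apply ccont_const | exact CG1]).
  assert (Cb : ccont (fun t => H * RtoC r * (cis (IZR 1 * t) * (cis t * G1 (cis t))))%C)
    by (apply ccont_mult; [apply ccont_const | apply (Cs _ CG1)]).
  rewrite (fcoef_plus _ _ _ Ca Cb) in E.
  rewrite (fcoef_scal c) in E by exact CG1.
  rewrite (fcoef_scal (H * RtoC r)) in E by (apply (Cs _ CG1)).
  rewrite (fcoef_scal (s * H * RtoC r)) in E by (apply (Cs _ CG)).
  rewrite !fcoef_shift in E. replace (Z.of_nat (S m) - 1)%Z with (Z.of_nat m) in E by lia.
  fold (coef G (Z.of_nat m)) in E.
  change (fcoef (fun t => cis t * G1 (cis t))%C (Z.of_nat (S m)))
    with (coef (fun z => z * G1 z)%C (Z.of_nat (S m))) in E.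
  change (fcoef (fun t => cis t * G1 (cis t))%C (Z.of_nat m))
    with (coef (fun z => z * G1 z)%C (Z.of_nat m)) in E.
  rewrite !KD in E. unfold G in E. rewrite !(tc_coef F r _ AF Hr) in E.
  assert (Rn : RtoC (r ^ S m) <> 0%C).
  { intros Z. apply RtoC_inj in Z. pose proof (pow_lt r (S m) (proj1 Hr)). lra. }
  assert (Rs : RtoC (r ^ S m) = (RtoC r * RtoC (r ^ m))%C) by (rewrite <- RtoC_mult; reflexivity).
  transitivity ((c * (RtoC (INR (S m)) * (RtoC (r ^ S m) * tc F (S m)))
     + H * RtoC r * (RtoC (INR m) * (RtoC (r ^ m) * tc F m))) / RtoC (r ^ S m)
     - RtoC (INR m) * tc F m * H)%C.
  - rewrite Rs. field. rewrite Rs in Rn. split; intros Z; apply Rn; rewrite Z; ring.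
  - rewrite E, Rs. field. rewrite Rs in Rn. split; intros Z; apply Rn; rewrite Z; ring.
Qed.

Lemma inv_two_div p : 0 < p -> / (2 / p) = p / 2.
Proof. intros Hp. field. lra. Qed.

Lemma f_lt1_star p z : 0 < p -> f_lt1 p z =
  Cexp (RtoC (2 / p) * Clog (RtoC (cstar (2 / p)) + RtoC (xstar (2 / p)) * z))%C.
Proof.
  intros Hp. unfold f_lt1. rewrite Cpow_principal_exp. unfold cstar, xstar.
  rewrite inv_two_div by exact Hp. rewrite (Cmult_comm z). reflexivity.
Qed.

Lemma base_re_pos s z : 2 < s -> Cmod z < 1 -> 0 < Re (RtoC (cstar s) + RtoC (xstar s) * z).
Proof.
  intros Hs Hz. destruct (star_facts s (ltac:(lra))) as [C0 [X0 [_ [C2 X2]]]].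
  assert (/ s < 1 - / s).
  { assert (/ s < / 2) by (apply Rinv_lt_contravar; lra). lra. }
  assert (L : xstar s < cstar s).
  { apply Rsqr_incrst_0; [| lra | lra]. rewrite !Rsqr_pow2. lra. }
  pose proof (re_le_Cmod z) as K. apply Rabs_le_between in K.
  replace (Re (RtoC (cstar s) + RtoC (xstar s) * z)) with (cstar s + xstar s * Re z)
    by (destruct z; simpl; ring).
  nra.
Qed.

Lemma f_lt1_derive p z : 0 < p < 1 -> Cmod z < 1 ->
  cderiv (f_lt1 p) z (RtoC (2 / p) * RtoC (xstar (2 / p)) * f_lt1 p z
     * / (RtoC (cstar (2 / p)) + RtoC (xstar (2 / p)) * z))%C.
Proof.
  intros Hp Hz. set (s := 2 / p).
  assert (Hs : 2 < s) by (apply two_lt_two_div, Hp).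
  pose proof (base_re_pos s z Hs Hz) as P.
  set (w := fun z => (RtoC (cstar s) + RtoC (xstar s) * z)%C).
  apply (cderiv_ext (fun z => Cexp (RtoC s * Clog (w z)))).
  - intros u. symmetry. apply f_lt1_star. lra.
  - rewrite (f_lt1_star p z) by lra. fold s.
    replace (RtoC s * RtoC (xstar s) * Cexp (RtoC s * Clog (RtoC (cstar s) + RtoC (xstar s) * z))
       * / (RtoC (cstar s) + RtoC (xstar s) * z))%C
      with (Cexp (RtoC s * Clog (w z)) * (RtoC s * (/ w z * (0 + RtoC (xstar s) * 1))))%C
      by (unfold w; ring).
    apply (cderiv_comp Cexp (fun z => RtoC s * Clog (w z))%C); [apply cderiv_Cexp |].
    apply (cderiv_scal (RtoC s) (fun z => Clog (w z))).
    apply (cderiv_comp Clog w); [apply cderiv_Clog, P |].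
    apply cderiv_plus; [apply cderiv_const | apply cderiv_scal, cderiv_id].
Qed.

Lemma f_lt1_0 p : 0 < p < 1 -> f_lt1 p 0%C = RtoC (Rpower (cstar (2 / p)) (2 / p)).
Proof.
  intros Hp. assert (Hs := two_lt_two_div p Hp).
  destruct (star_facts (2 / p) (ltac:(lra))) as [C0 _].
  rewrite f_lt1_star by lra.
  replace (RtoC (cstar (2 / p)) + RtoC (xstar (2 / p)) * 0)%C with (RtoC (cstar (2 / p))) by ring.
  replace (Clog (RtoC (cstar (2 / p)))) with (RtoC (ln (cstar (2 / p)))).
  - rewrite <- RtoC_mult, Cexp_R. reflexivity.
  - unfold Clog, Carg. rewrite Cmod_R, Rabs_pos_eq by lra. simpl.
    unfold Rdiv. rewrite Rmult_0_l, atan_0, Rmult_0_r. reflexivity.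
Qed.

(** Raising (c + x z)^(2/p) to the power p leaves the squared modulus
    of an affine function, whose mean is explicit. *)
Lemma f_lt1_mod p z : 0 < p < 1 -> Cmod z < 1 ->
  rpow (Cmod (f_lt1 p z)) p = Cmod (RtoC (cstar (2 / p)) + RtoC (xstar (2 / p)) * z) ^ 2.
Proof.
  intros Hp Hz. assert (Hs := two_lt_two_div p Hp).
  pose proof (base_re_pos (2 / p) z Hs Hz) as P.
  destruct (Re_pos_mod _ P) as [M _].
  rewrite f_lt1_star, Cexp_mod by lra. rewrite rpow_pos by apply exp_pos.
  unfold Rpower. rewrite ln_exp, Re_scal. unfold Clog at 1. simpl Re.
  set (m := Cmod (RtoC (cstar (2 / p)) + RtoC (xstar (2 / p)) * z)) in *.
  replace (p * (2 / p * ln m)) with (ln m + ln m) by (field; lra).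
  rewrite exp_plus, exp_ln by exact M. simpl. ring.
Qed.

Lemma f_lt1_extremal p : 0 < p < 1 ->
  unit_norm p (f_lt1 p) /\ Cmod (C_derive (f_lt1 p) 0%C) = Cstar (2 / p).
Proof.
  intros Hp. assert (Hs := two_lt_two_div p Hp).
  destruct (star_facts (2 / p) (ltac:(lra))) as [C0 [X0 [P0 [C2 X2]]]].
  set (s := 2 / p) in *.
  assert (E : forall r, 0 < r < 1 -> Mp p (f_lt1 p) r = 1 - / s + / s * r ^ 2).
  { intros r Hr. unfold Mp.
    rewrite (Rmean_ext _ (fun t => Cmod (RtoC (cstar s) + RtoC (xstar s * r) * cis t) ^ 2)).
    - change (msq (fun t => RtoC (cstar s) + RtoC (xstar s * r) * cis t)%C = 1 - / s + / s * r ^ 2).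
      rewrite msq_affine, !Cmod_R, !RPow_abs, !Rabs_pos_eq, Rpow_mult_distr, C2, X2 by apply pow2_ge_0.
      reflexivity.
    - intros t. rewrite f_lt1_mod; [| exact Hp |].
      + fold s. rewrite RtoC_mult, <- Cmult_assoc. reflexivity.
      + rewrite Cmod_mult, cis_mod, Cmod_R, Rabs_pos_eq; lra. }
  assert (S01 : 0 < / s < 1).
  { split; [apply Rinv_0_lt_compat; lra |]. rewrite <- Rinv_1. apply Rinv_lt_contravar; lra. }
  split.
  - apply unit_norm_intro.
    + intros z Hz. eexists. apply f_lt1_derive; assumption.
    + intros r Hr. rewrite E by exact Hr. assert (r ^ 2 <= 1) by (simpl; nra). nra.
    + intros e He. exists (Rmax (1 / 2) (1 - e / 3)).
      assert (A1 : 1 / 2 <= Rmax (1 / 2) (1 - e / 3)) by apply Rmax_l.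
      assert (A2 : 1 - e / 3 <= Rmax (1 / 2) (1 - e / 3)) by apply Rmax_r.
      assert (A3 : Rmax (1 / 2) (1 - e / 3) < 1) by (apply Rmax_lub_lt; lra).
      set (r := Rmax (1 / 2) (1 - e / 3)) in *.
      split; [lra |]. rewrite E by lra.
      assert (1 - r ^ 2 <= 2 * (1 - r)) by (simpl; nra).
      assert (0 <= 1 - r ^ 2) by (simpl; nra). nra.
  - rewrite (C_derive_cderiv _ _ _ (f_lt1_derive p 0%C Hp (ltac:(rewrite Cmod_0; lra)))).
    rewrite f_lt1_0 by exact Hp. fold s.
    replace (RtoC (cstar s) + RtoC (xstar s) * 0)%C with (RtoC (cstar s)) by ring.
    assert (Q : RtoC (cstar s) <> 0%C) by (intros K; apply RtoC_inj in K; lra).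
    rewrite !Cmod_mult, Cmod_inv, !Cmod_R by exact Q.
    assert (0 < Rpower (cstar s) s) by apply exp_pos.
    rewrite !Rabs_pos_eq by lra. unfold Cstar.
    assert (ES : Rpower (cstar s) s = Rpower (cstar s) (s - 1) * cstar s).
    { rewrite <- (Rpower_1 (cstar s)) at 3 by exact C0. rewrite <- Rpower_plus. f_equal. ring. }
    rewrite ES. field. lra.
Qed.

Lemma Cstar_value p : 0 < p < 1 ->
  Cstar (2 / p) = sqrt (2 / p) * Rpower (1 - p / 2) (1 / p - 1 / 2).
Proof.
  intros Hp. unfold Cstar, cstar, xstar.
  rewrite <- Rpower_sqrt by (rewrite inv_two_div; lra).
  rewrite Rpower_mult, sqrt_inv, inv_two_div by lra.
  replace (/ 2 * (2 / p - 1)) with (1 / p - 1 / 2) by (field; lra).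
  assert (S : 0 < 2 / p) by (apply Rdiv_lt_0_compat; lra).
  pose proof (sqrt_lt_R0 _ S) as S0.
  rewrite <- (sqrt_sqrt (2 / p)) at 1 by lra. field. lra.
Qed.

(** The extremal function and the rotated [f_lt1 p] satisfy the same two-term
    recurrence with the same constant term. *)
Lemma case_lt_1 p : 0 < p < 1 ->
  const_C1 p = Finite (sqrt (2 / p) * Rpower (1 - p / 2) (1 / p - 1 / 2)) /\
  forall f, extremal p f <-> trivial_modification (f_lt1 p) f.
Proof.
  intros Hp. rewrite <- Cstar_value by exact Hp.
  assert (Hs := two_lt_two_div p Hp).
  destruct (star_facts (2 / p) (ltac:(lra))) as [C0 [X0 _]].
  destruct (f_lt1_extremal p Hp) as [U D].
  destruct (extremal_problem p (Cstar (2 / p)) (f_lt1 p) (proj1 Hp) U D) as [E1 E2].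
  { intros f Hf. apply derive_le_Cstar; assumption. }
  split; [exact E1 |]. intros f. rewrite E2. split.
  - intros [Hf Hd].
    destruct (extremal_recurrence p f Hp Hf Hd) as [al [H [MH [T0 Rec]]]].
    destruct (polar H) as [th Eth]. rewrite MH in Eth.
    set (s := 2 / p) in *.
    set (psi := fun z => (cis al * f_lt1 p (cis th * z))%C).
    set (psi1 := fun z => (cis al * ((RtoC s * RtoC (xstar s) * f_lt1 p (cis th * z)
        * / (RtoC (cstar s) + RtoC (xstar s) * (cis th * z))) * cis th))%C).
    assert (Rot : forall z, Cmod z < 1 -> Cmod (cis th * z) < 1)
      by (intros z Hz; rewrite Cmod_mult, cis_mod; lra).
    assert (Dpsi : forall z, Cmod z < 1 -> cderiv psi z (psi1 z)).
    { intros z Hz. apply cderiv_rotate, f_lt1_derive; [exact Hp | apply Rot, Hz]. }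
    assert (Bnz : forall z, Cmod z < 1 -> (RtoC (cstar s) + RtoC (xstar s) * (cis th * z))%C <> 0%C).
    { intros z Hz K. pose proof (base_re_pos s _ Hs (Rot z Hz)) as P. rewrite K in P. simpl in P. lra. }
    assert (Ap : analytic 1 psi) by (intros z Hz; exists (psi1 z); apply Dpsi, Hz).
    assert (Ap1 : analytic 1 psi1).
    { intros z Hz.
      destruct (analytic_scale (f_lt1 p) (cis th) 1 1 Rot (proj1 U) z Hz) as [d Hd'].
      eexists. apply (cderiv_scal (cis al) (fun z => (RtoC s * RtoC (xstar s) * f_lt1 p (cis th * z)
        * / (RtoC (cstar s) + RtoC (xstar s) * (cis th * z))) * cis th)%C).
      apply (cderiv_mult (fun z => RtoC s * RtoC (xstar s) * f_lt1 p (cis th * z)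
        * / (RtoC (cstar s) + RtoC (xstar s) * (cis th * z)))%C (fun _ => cis th)); [| apply cderiv_const].
      apply (cderiv_mult (fun z => RtoC s * RtoC (xstar s) * f_lt1 p (cis th * z))%C).
      - apply (cderiv_scal (RtoC s * RtoC (xstar s))), Hd'.
      - apply cderiv_inv; [| apply Bnz, Hz].
        apply cderiv_plus; [apply cderiv_const |].
        apply (cderiv_scal (RtoC (xstar s)) (fun z => cis th * z)%C), cderiv_scal, cderiv_id. }
    assert (RecP := binomial_recurrence psi psi1 (RtoC (cstar s)) H (RtoC s) Ap Ap1 Dpsi).
    assert (RecP' : forall m, (RtoC (INR (S m)) * tc psi (S m) * RtoC (cstar s) = (RtoC s - RtoC (INR m)) * tc psi m * H)%C).
    { apply RecP. intros z Hz. specialize (Bnz z Hz). unfold psi1, psi. rewrite Eth.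
      replace (RtoC (xstar s) * (cis th * z))%C with (RtoC (xstar s) * cis th * z)%C in * by ring.
      field. exact Bnz. }
    assert (Cn : RtoC (cstar s) <> 0%C) by (intros K; apply RtoC_inj in K; lra).
    assert (Eq : forall k, tc f k = tc psi k).
    { induction k as [|m IH].
      - rewrite T0, (tc_0 psi Ap). unfold psi.
        replace (cis th * 0)%C with (RtoC 0) by ring. rewrite f_lt1_0 by exact Hp. reflexivity.
      - assert (Sn : RtoC (INR (S m)) <> 0%C).
        { intros K. apply RtoC_inj in K. pose proof (lt_0_INR (S m) (Nat.lt_0_succ m)). lra. }
        assert (K : (RtoC (INR (S m)) * tc f (S m) * RtoC (cstar s) = RtoC (INR (S m)) * tc psi (S m) * RtoC (cstar s))%C).
        { rewrite Rec, RecP', IH, RtoC_minus. reflexivity. }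
        replace (tc f (S m)) with (RtoC (INR (S m)) * tc f (S m) * RtoC (cstar s) / (RtoC (INR (S m)) * RtoC (cstar s)))%C
          by (field; auto).
        rewrite K. field; auto. }
    exists al, th. intros z Hz. apply (tc_unique f psi (proj1 Hf) Ap Eq z Hz).
  - intros T. destruct (trivial_modification_invariant p f (f_lt1 p) (proj1 Hp) T U) as [A B].
    split; [exact A | rewrite B; exact D].
Qed.

Theorem theorem4p1 :
  forall p : R, 0 < p ->
    (1 <= p -> const_C1 p = Finite 1) /\
    (p < 1 ->
      const_C1 p = Finite (sqrt (2 / p) * Rpower (1 - p / 2) (1 / p - 1 / 2))) /\
    (forall f : C -> C,
      (1 < p -> (extremal p f <-> trivial_modification f_gt1 f)) /\
      (p = 1 -> (extremal p f <->
        exists a : R, 0 <= a <= 1 /\ trivial_modification (f_eq1 a) f)) /\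
      (p < 1 -> (extremal p f <-> trivial_modification (f_lt1 p) f))).
Proof.
  intros p Hp. split; [| split].
  - intros H. apply (case_ge_1 p H).
  - intros H. apply (case_lt_1 p (conj Hp H)).
  - intros f. split; [| split].
    + intros H. apply (proj2 (case_ge_1 p (Rlt_le _ _ H)) f), H.
    + intros E. apply (proj2 (case_ge_1 p (Req_le _ _ (eq_sym E))) f), E.
    + intros H. apply (case_lt_1 p (conj Hp H)).
Qed.
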